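(* Let $f:\mathbf C^2\to\mathbf C^2$ be a polynomial diffeomorphism with dynamical degree $d\ge2$. Then the dynamical critical locus $$\mathcal C=\{p\in U^+\cap U^-:\ \partial G^+\wedge\partial G^-=0\text{ at }p\}$$ is nonempty.
   Context: The dynamical degree of a polynomial diffeomorphism (polynomial map with polynomial inverse) is $d=\lim_{n\to\infty}(\deg f^n)^{1/n}$. $G^\pm(x,y)=\lim_{n\to\infty}d^{-n}\log^+|f^{\pm n}(x,y)|$; $U^\pm$ is the set of points with unbounded forward/backward orbit, $U^\pm=\{G^\pm>0\}$, on which $G^\pm$ is pluriharmonic. *)

(* Defs.v *)
From HB Require Import structures.
From mathcomp Require Import all_boot all_order all_algebra.
From mathcomp Require Import all_classical all_reals all_analysis.
From mathcomp Require Import complex.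
(* The notations of mpoly clash with those of MathComp-Analysis. *)
From mathcomp Require Import -(notations) mpoly.

Set Implicit Arguments.
Unset Strict Implicit.
Unset Printing Implicit Defensive.

Import Order.TTheory GRing.Theory Num.Theory.
Import numFieldNormedType.Exports.

Local Open Scope classical_set_scope.
Local Open Scope ring_scope.
Local Open Scope complex_scope.

Notation C2 R := 'rV[R[i]]_2.

Definition polymap (R : realType) : Type := 2.-tuple (mpoly 2 R[i]).

Definition polymap_eval (R : realType) (f : polymap R) (p : C2 R) : C2 R :=
  \row_(i < 2) meval (p 0) (tnth f i).

Definition polymap_id (R : realType) : polymap R :=
  [tuple mpolyX R[i] (mnm1 i) | i < 2].

Definition polymap_comp (R : realType) (f g : polymap R) : polymap R :=
  [tuple comp_mpoly g (tnth f i) | i < 2].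

Definition polymap_iter (R : realType) (f : polymap R) (n : nat) : polymap R :=
  iter n (polymap_comp f) (polymap_id R).

(* mmeasure mdeg (msize) is one more than the total degree, and 0 for the zero
   polynomial. *)
Definition polymap_deg (R : realType) (f : polymap R) : nat :=
  \max_(i < 2) (mmeasure mdeg (tnth f i)).-1.

(* The polynomial inverse is part of the data; it is determined by the map. *)
Record polydiffeo (R : realType) := PolyDiffeo {
  pd_fwd : polymap R;
  pd_bwd : polymap R;
  pd_fwdK : cancel (polymap_eval pd_fwd) (polymap_eval pd_bwd);
  pd_bwdK : cancel (polymap_eval pd_bwd) (polymap_eval pd_fwd)
}.

Definition dynamical_degree (R : realType) (f : polydiffeo R) : R :=
  limn (fun n : nat =>
    (polymap_deg (polymap_iter (pd_fwd f) n))%:R `^ (n%:R^-1) : R).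

Definition fwd_orbit (R : realType) (f : polydiffeo R) (n : nat) (p : C2 R) : C2 R :=
  iter n (polymap_eval (pd_fwd f)) p.

Definition bwd_orbit (R : realType) (f : polydiffeo R) (n : nat) (p : C2 R) : C2 R :=
  iter n (polymap_eval (pd_bwd f)) p.

(* The Euclidean norm, with values in R (the norm of R[i] takes values in R[i]). *)
Definition norm2 (R : realType) (p : C2 R) : R :=
  Num.sqrt (\sum_(i < 2) (complex.Re (p 0 i) ^+ 2 + complex.Im (p 0 i) ^+ 2)).

(* The value at 0 is 0, because ln 0 = 0 in the library. *)
Definition logp (R : realType) (x : R) : R := Num.max 0 (ln x).

(* Both Green functions are normalized by the dynamical degree of f. *)
Definition Gplus (R : realType) (f : polydiffeo R) (p : C2 R) : R :=
  limn (fun n : nat => dynamical_degree f ^- n * logp (norm2 (fwd_orbit f n p))).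

Definition Gminus (R : realType) (f : polydiffeo R) (p : C2 R) : R :=
  limn (fun n : nat => dynamical_degree f ^- n * logp (norm2 (bwd_orbit f n p))).

Definition Uplus (R : realType) (f : polydiffeo R) : set (C2 R) :=
  [set p | forall M : R, exists n : nat, M < norm2 (fwd_orbit f n p)].

Definition Uminus (R : realType) (f : polydiffeo R) : set (C2 R) :=
  [set p | forall M : R, exists n : nat, M < norm2 (bwd_orbit f n p)].

(* Derivative at p of G : C^2 -> R along the real line through p directed by v. *)
Definition real_derive (R : realType) (G : C2 R -> R) (p v : C2 R) : R :=
  derive1 (fun t : R => G (p + t%:C *: v)) 0.

(* The (1,0)-form dG at p, as the row of its coefficients on dx and dy: the
   Wirtinger derivatives 1/2 (d/ds - i d/dt) for each coordinate s + it. *)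
Definition del (R : realType) (G : C2 R -> R) (p : C2 R) : 'rV[R[i]]_2 :=
  \row_(j < 2) (real_derive G p (delta_mx 0 j) / 2
               -i* (real_derive G p ((0 +i* 1) *: delta_mx 0 j) / 2)).

(* Coefficient on dx /\ dy of the wedge product of two (1,0)-covectors. *)
Definition wedge (R : realType) (a b : 'rV[R[i]]_2) : R[i] :=
  a 0 0 * b 0 1 - a 0 1 * b 0 0.

Definition critical_locus (R : realType) (f : polydiffeo R) : set (C2 R) :=
  [set p | (Uplus f `&` Uminus f) p /\ wedge (del (Gplus f) p) (del (Gminus f) p) = 0].

(* Main.v *)
(* By Jung's theorem the map is a word in triangular maps and the coordinate swap;
   after conjugation by some phi it is either affine or triangular, which the degree
   hypothesis excludes, or a composition g of generalized Henon maps, whose algebraic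
   degree is then the dynamical degree.  Where |y| is large and |x| <= |y|, the Green
   function of g is the limit of d^-n log |y_n|, and the logarithmic derivatives of
   the polynomials y_n converge uniformly; so the (1,0)-form of G+ is close to
   dy / 2y.  Passing from g back to phi^-1 g phi only multiplies G+ by a constant,
   because phi^-1 g^N has no cancellation left in it once N is large.

   The inverse map is treated in the same way.  If its first letter is
   (x, y) |-> (.., p(x) - a y), then on the line y = C with C very large the wedge
   product of the two forms is, up to a nowhere zero factor, p'(x) plus a small
   error.  For the polynomial approximations of the Green functions the error is a
   rational function of x, so Rouche's theorem gives zeros near a zero of p', and
   these accumulate at a zero of the limit. *)

From HB Require Import structures.
Require Import Defs.
From mathcomp Require Import all_boot all_order all_algebra.
From mathcomp Require Import all_classical all_reals all_analysis.
From mathcomp Require Import complex.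
From mathcomp Require Import -(notations) mpoly.
From mathcomp Require Import zify ring lra.

Set Implicit Arguments.
Unset Strict Implicit.
Unset Printing Implicit Defensive.

Import Order.TTheory GRing.Theory Num.Theory.
Import numFieldNormedType.Exports.

Local Open Scope classical_set_scope.
Local Open Scope ring_scope.

(** * Words in triangular maps and the swap *)

(** All objects are kept polynomial. A word acts on pairs of numbers and on pairs of one-variable
    polynomials, and tangent vectors follow the formal chain rule; analysis enters only through the
    real derivative of [ln |q|] along lines and through limits with rate [2^-n]. Jung's theorem
    comes from the blow-up [x = s], [y = s t]: the degree in [s] is the total degree, and the
    Jacobian of an automorphism has to divide [s]. So small a Jacobian forces one of the two degrees
    to divide the other. Degrees of iterates are not computed from coefficients but read off from
    growth at infinity.

    The main obstacle is to find points where both Green functions are under control: the forward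
    estimates want [|y|] to dominate, and the inverse word, reached through a swap, wants [|x|] to
    dominate. One letter of the inverse word, applied before its estimates start, reconciles the two
    on the line [y = C]; the derivative of this letter is also what brings [p'] into the wedge
    product. *)

Definition hE := (hornerD, hornerN, hornerZ, hornerM, hornerXn, hornerX, hornerC).

Section Letters.
Variable K : fieldType.

(* Letters act as swap o tri; the hyper ones are the generalized Henon maps. *)
Record letter := Letter { lp : {poly K}; la : K; lb : K; lc : K }.

Implicit Types (l e : letter) (w : seq letter) (z : K * K).

Definition tri e z := (la e * z.1 + (lp e).[z.2], lb e * z.2 + lc e).
Definition swap z := (z.2, z.1).
Definition step l z := swap (tri l z).
Definition lok l := (la l != 0) && (lb l != 0).
Definition hyper l := lok l && (2 < size (lp l))%N.

Fixpoint run w z := if w is l :: w' then run w' (step l z) else z.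

Definition lid := Letter 0 1 1 0.
Definition tmul e1 e2 :=
  Letter (la e1 *: lp e2 + (lp e1 \Po (lb e2 *: 'X + (lc e2)%:P)))
    (la e1 * la e2) (lb e1 * lb e2) (lb e1 * lc e2 + lc e1).
Definition tinv e :=
  Letter (- (la e)^-1 *: (lp e \Po ((lb e)^-1 *: 'X - (lc e / lb e)%:P)))
    (la e)^-1 (lb e)^-1 (- (lc e / lb e)).

(** A letter ends with a swap, so its inverse is the swap followed by [tri (tinv l)]; as a word this
    takes three letters, [step lid] being the swap. *)
Fixpoint winv w := if w is l :: w' then winv w' ++ [:: lid; tinv l; lid] else [::].

Lemma run_cat w1 w2 z : run (w1 ++ w2) z = run w2 (run w1 z).
Proof. by elim: w1 z => //= l w1 IH z; rewrite IH. Qed.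

Lemma swapK z : swap (swap z) = z. Proof. by case: z. Qed.

Lemma tri_lid z : tri lid z = z.
Proof. by case: z => x y; rewrite /tri /= horner0 !mul1r !addr0. Qed.

Lemma step_lid z : step lid z = swap z. Proof. by rewrite /step tri_lid. Qed.

Lemma triM e1 e2 z : tri (tmul e1 e2) z = tri e1 (tri e2 z).
Proof.
case: z => x y; rewrite /tri /= !hE horner_comp !hE.
by congr pair; ring.
Qed.

Lemma triK e : lok e -> cancel (tri e) (tri (tinv e)).
Proof.
case/andP=> a0 b0 [x y]; rewrite /tri /= !hE horner_comp !hE.
have -> : (lb e)^-1 * (lb e * y + lc e) - lc e / lb e = y by field.
by congr pair; field.
Qed.

Lemma triVK e : lok e -> cancel (tri (tinv e)) (tri e).
Proof.
case/andP=> a0 b0 [x y]; rewrite /tri /= !hE horner_comp !hE.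
by congr pair; field.
Qed.

Lemma lok_lid : lok lid. Proof. by rewrite /lok /= oner_eq0. Qed.

Lemma lok_tmul e1 e2 : lok e1 -> lok e2 -> lok (tmul e1 e2).
Proof. by rewrite /lok /= !mulf_eq0 !negb_or => /andP[-> ->] /andP[-> ->]. Qed.

Lemma lok_tinv e : lok e -> lok (tinv e).
Proof. by rewrite /lok /= !invr_eq0. Qed.

Lemma hyper_lok l : hyper l -> lok l. Proof. by case/andP. Qed.

Lemma all_hyper_lok w : all hyper w -> all lok w.
Proof. exact/sub_all/hyper_lok. Qed.

(** The left factor contributes a polynomial of degree at most one, too small to cancel the leading
    term of [lp l]. *)
Lemma hyper_tmul e l : lok e -> (size (lp e) <= 2)%N -> hyper l -> hyper (tmul e l).
Proof.
move=> eok se /andP[lo sl]; rewrite /hyper lok_tmul //=.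
have [a0 b0] := andP eok.
have /andP[_ b1] := lo.
have s2 : size (lb l *: 'X + (lc l)%:P) = 2%N.
  by rewrite size_polyDl size_scale ?size_polyX // size_polyC; case: eqP.
rewrite size_polyDl size_scale //.
by apply: leq_ltn_trans sl; rewrite size_comp_poly2.
Qed.

Lemma all_winv w : all lok w -> all lok (winv w).
Proof.
elim: w => //= l w IH /andP[lo /IH wo].
by rewrite all_cat wo /= lok_tinv ?lok_lid.
Qed.

Lemma runK w : all lok w -> cancel (run w) (run (winv w)).
Proof.
elim: w => //= l w IH /andP[lo wo] z.
by rewrite run_cat IH //= !step_lid /step !swapK triK.
Qed.

Lemma runVK w : all lok w -> cancel (run (winv w)) (run w).
Proof.
elim: w => //= l w IH /andP[lo wo] z; rewrite run_cat /= !step_lid.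
by rewrite /step swapK triVK // swapK IH.
Qed.

Lemma size2_horner (p : {poly K}) y : (size p <= 2)%N -> p.[y] = p`_1 * y + p`_0.
Proof.
move=> sp; rewrite (horner_coef_wide _ sp) !big_ord_recl big_ord0 /=.
by rewrite expr0 expr1 mulr1 addr0 addrC.
Qed.

Lemma size_lin (a b : K) : (size (a *: 'X + b%:P)%R <= 2)%N.
Proof.
apply: leq_trans (size_polyD _ _) _; rewrite geq_max size_polyC.
by rewrite (leq_trans (size_scale_leq _ _)) ?size_polyX //; case: eqP.
Qed.

(* Bruhat decomposition: the second alternative is the big cell. *)
Lemma swap_tri_swap l : lok l -> (size (lp l) <= 2)%N ->
  (exists2 D, lok D & forall z, swap (tri l (swap z)) = tri D z) \/
  (exists U1 U2, [/\ lok U1, lok U2, (size (lp U2) <= 2)%N &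
     forall z, swap (tri l (swap z)) = tri U1 (swap (tri U2 z))]).
Proof.
case/andP=> a0 b0 sl; have [p1|p1] := eqVneq (lp l)`_1 0.
  left; exists (Letter (lc l)%:P (lb l) (la l) (lp l)`_0).
    by rewrite /lok /= a0 b0.
  by case=> x y; rewrite /tri /swap /= size2_horner // p1 mul0r add0r hornerC.
right.
exists (Letter ((lb l / (lp l)`_1) *: 'X + (lc l - lb l * (lp l)`_0 / (lp l)`_1)%:P)
   (- (lb l * la l / (lp l)`_1)) 1 0).
exists (Letter (la l *: 'X + ((lp l)`_0)%:P) (lp l)`_1 1 0).
split.
- by rewrite /lok /= oner_eq0 oppr_eq0 !mulf_neq0 // ?invr_eq0.
- by rewrite /lok /= oner_eq0 p1.
- exact: size_lin.
case=> x y; rewrite /tri /swap /= size2_horner // !hE.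
by congr pair; field.
Qed.

Definition conjw w (v : seq letter) := exists2 c, all lok c & forall z, run c (run w z) = run v (run c z).

Lemma conjw_trans w1 w2 w3 : conjw w1 w2 -> conjw w2 w3 -> conjw w1 w3.
Proof.
move=> [c co e1] [d dd e2]; exists (c ++ d); first by rewrite all_cat co.
by move=> z; rewrite !run_cat e1 e2.
Qed.

Lemma conjw_rot u v : all lok u -> conjw (u ++ v) (v ++ u).
Proof. by move=> uo; exists u => // z; rewrite !run_cat. Qed.

Lemma conjw_run w v : run w =1 run v -> conjw w v.
Proof. by exists [::]. Qed.

Lemma nall_split (T : Type) (p : pred T) s : ~~ all p s ->
  exists s1 x s2, s = s1 ++ x :: s2 /\ ~~ p x.
Proof.
elim: s => //= x s IH; have [px|px] := boolP (p x) => /=; last by exists [::], x, s.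
by move=> /IH[s1 [y [s2 [-> py]]]]; exists (x :: s1), y, s2.
Qed.

(** A triangular map is written [[:: e; lid]], the second letter undoing the swap of the first. *)
Definition normal_word (v : seq letter) :=
  [\/ (0 < size v)%N /\ all hyper v,
      exists2 l, lok l & v = [:: l] /\ (size (lp l) <= 2)%N
    | exists2 e, lok e & v = [:: e; lid]].

Lemma run_tri e z : run [:: e; lid] z = tri e z.
Proof. by rewrite /= step_lid swapK. Qed.

(** Cyclic rotation brings a letter [l] that is not hyper between two others. The middle map,
    [tri l] between two swaps, is rewritten by the Bruhat decomposition, and three letters become
    one or two. Only words with all letters hyper, or of length at most two, remain. *)
Lemma word_normal_form w : all lok w ->
  exists2 v, all lok v & conjw w v /\ normal_word v.
Proof.
have [n] := ubnP (size w); elim: n w => // n IH w sw wo.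
have conj_IH v : all lok v -> (size v < size w)%N -> conjw w v ->
    exists2 v, all lok v & conjw w v /\ normal_word v.
  move=> vo sv cv; have [|v' vo' [c' nv']] := IH v _ vo; first by lia.
  by exists v' => //; split=> //; apply: conjw_trans c'.
have single l : lok l -> normal_word [:: l].
  move=> lo; have [h|h] := boolP (hyper l); first by constructor 1; rewrite /= h.
  by constructor 2; exists l => //; move: h; rewrite /hyper lo -leqNgt.
have [w0|w0] := posnP (size w).
  rewrite (size0nil w0); exists [:: lid; lid]; first by rewrite /= lok_lid.
  split; first by apply: conjw_run => z; rewrite run_tri tri_lid.
  by constructor 3; exists lid; rewrite ?lok_lid.
have [h|] := boolP (all hyper w); first by exists w => //; split; [exact: conjw_run|constructor 1].
case/nall_split=> w1 [l [w2 [ew nh]]]; move: conj_IH wo sw; rewrite ew {ew w0} => conj_IH.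
rewrite all_cat /= => /and3P[wo1 lo wo2] sw.
have sl : (size (lp l) <= 2)%N by move: nh; rewrite /hyper lo /= -leqNgt.
have: conjw (w1 ++ l :: w2) (l :: w2 ++ w1) by apply: (conjw_rot (l :: w2) wo1).
have: all lok (w2 ++ w1) by rewrite all_cat wo1 wo2.
have: size (w2 ++ w1) = (size (w1 ++ l :: w2)).-1 by rewrite !size_cat /=; lia.
case: (lastP (w2 ++ w1)) => [|r0 r] sr ro cr.
  exists [:: l]; first by rewrite /= lo.
  by split=> //; apply: single.
move: ro; rewrite all_rcons => /andP[rok r0o].
have {}cr : conjw (w1 ++ l :: w2) (r :: l :: r0).
  apply: conjw_trans cr _; rewrite -cats1 -cat_cons.
  by apply: (conjw_rot [:: r]); rewrite /= lo.
move: sr; rewrite size_rcons => sr.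
have [[D Do eD]|[U1 [U2 [U1o U2o sU eU]]]] := swap_tri_swap lo sl;
  case: r0 r0o cr sr => [|r1 r0] r0o cr sr.
- exists [:: tmul D r; lid]; first by rewrite /= lok_tmul ?lok_lid.
  split; last by constructor 3; exists (tmul D r); rewrite ?lok_tmul.
  apply: conjw_trans cr _; apply: conjw_run => z.
  by rewrite run_tri triM -eD.
- have [r1o {}r0o] := andP r0o.
  apply: (conj_IH (tmul r1 (tmul D r) :: r0)).
  + by rewrite /= !lok_tmul.
  + by move: sr => /=; lia.
  apply: conjw_trans cr _; apply: conjw_run => z /=.
  by rewrite [in RHS]/step !triM -eD.
- exists [:: tmul (tmul U2 r) U1]; first by rewrite /= !lok_tmul.
  split; last by apply: single; rewrite !lok_tmul.
  (* [U1] stands last here; conjugating by it moves it to the front, where it merges with [U2] and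
     [r]. *)
  apply: conjw_trans cr _; exists [:: tinv U1; lid].
    by rewrite /= lok_tinv ?lok_lid.
  move=> z; rewrite !run_tri /= [in RHS]/step !triM triVK //.
  by rewrite {1}/step eU triK.
- have [r1o {}r0o] := andP r0o.
  apply: (conj_IH [:: tmul U2 r, tmul r1 U1 & r0]).
  + by rewrite /= !lok_tmul.
  + by move: sr => /=; lia.
  apply: conjw_trans cr _; apply: conjw_run => z /=.
  by rewrite [in RHS]/step !triM -eU.
Qed.

Lemma affine_word (a0 a1 b0 b1 u v : K) : a0 * b1 - a1 * b0 != 0 ->
  exists2 w, all lok w &
    forall z, run w z = (a0 * z.1 + a1 * z.2 + u, b0 * z.1 + b1 * z.2 + v).
Proof.
move=> det0; have [b00|b00] := eqVneq b0 0.
  move: det0; rewrite b00 mulr0 subr0 mulf_eq0 negb_or => /andP[a00 b10].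
  exists [:: Letter (a1 *: 'X + u%:P) a0 b1 v; lid].
    by rewrite /= lok_lid /lok /= a00 b10.
  by move=> z; rewrite run_tri /tri /= !hE; congr pair; ring.
exists [:: Letter (b1 *: 'X + v%:P) b0 1 0;
   Letter ((a0 / b0) *: 'X + (u - a0 * v / b0)%:P) (- ((a0 * b1 - a1 * b0) / b0)) 1 0; lid].
  rewrite /= lok_lid /lok /= !oner_eq0 b00 oppr_eq0 mulf_neq0 ?invr_eq0 //=.
move=> z; rewrite /= step_lid /step /tri /swap /= !hE.
by congr pair; field.
Qed.

(** * Tangent maps of words, and words acting on polynomial curves *)

Definition tstep l z (v : K * K) := (lb l * v.2, la l * v.1 + (lp l)^`().[z.2] * v.2).

Fixpoint trun w z (v : K * K) := if w is l :: w' then trun w' (step l z) (tstep l z v) else v.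

Lemma trun_cat w1 w2 z v : trun (w1 ++ w2) z v = trun w2 (run w1 z) (trun w1 z v).
Proof. by elim: w1 z v => //= l w1 IH z v; rewrite IH. Qed.

Lemma trun_linear w z (a b : K) (v1 v2 : K * K) :
  trun w z (a * v1.1 + b * v2.1, a * v1.2 + b * v2.2) =
  (a * (trun w z v1).1 + b * (trun w z v2).1, a * (trun w z v1).2 + b * (trun w z v2).2).
Proof.
elim: w z v1 v2 => //= l w IH z v1 v2; rewrite -IH; congr trun.
by rewrite /tstep /=; congr pair; ring.
Qed.

Definition pev (Z : {poly K} * {poly K}) (t : K) := (Z.1.[t], Z.2.[t]).
Definition pder (Z : {poly K} * {poly K}) := (Z.1^`(), Z.2^`()).

(** A letter acting on curves with polynomial coordinates: along a line, any word becomes a pair of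
    polynomials in one variable. *)
Definition pstep l (Z : {poly K} * {poly K}) :=
  (lb l *: Z.2 + (lc l)%:P, la l *: Z.1 + (lp l \Po Z.2)).
Definition ptstep l (Z V : {poly K} * {poly K}) :=
  (lb l *: V.2, la l *: V.1 + ((lp l)^`() \Po Z.2) * V.2).

Fixpoint prun w Z := if w is l :: w' then prun w' (pstep l Z) else Z.
Fixpoint ptrun w Z V := if w is l :: w' then ptrun w' (pstep l Z) (ptstep l Z V) else V.

Lemma pev_step l Z t : pev (pstep l Z) t = step l (pev Z t).
Proof. by rewrite /pev /pstep /step /tri /swap /= !hE horner_comp. Qed.

Lemma pev_run w Z t : pev (prun w Z) t = run w (pev Z t).
Proof. by elim: w Z => //= l w IH Z; rewrite IH pev_step. Qed.

Lemma pev_trun w Z V t : pev (ptrun w Z V) t = trun w (pev Z t) (pev V t).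
Proof.
elim: w Z V => //= l w IH Z V; rewrite IH pev_step; congr trun.
by rewrite /pev /ptstep /tstep /= !hE horner_comp.
Qed.

Lemma pder_run w Z : pder (prun w Z) = ptrun w Z (pder Z).
Proof.
elim: w Z => //= l w IH Z; rewrite IH; congr ptrun.
by rewrite /pder /pstep /ptstep /= !derivD !derivZ derivC deriv_comp addr0.
Qed.

End Letters.

(** * The top forms of a polynomial automorphism *)

Section Bivariate.
Variable K : numFieldType.
Local Notation A := {poly {poly K}}.
Implicit Types (u v a b : A) (R : A).

Definition cc (c : K) : A := c%:P%:P.
Lemma cc_is_additive : additive cc.
Proof. by move=> x y; rewrite /cc !rmorphB. Qed.
Lemma cc_is_multiplicative : multiplicative cc.
Proof. by split=> [x y|]; rewrite /cc ?rmorphM ?rmorph1. Qed.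
HB.instance Definition _ := GRing.isAdditive.Build K A cc cc_is_additive.
HB.instance Definition _ := GRing.isMultiplicative.Build K A cc cc_is_multiplicative.

Fact commr_hu u : commr_rmorph cc u. Proof. by move=> x; apply: mulrC. Qed.
Definition hu u : {poly K} -> A := horner_morph (commr_hu u).
HB.instance Definition _ u := GRing.RMorphism.on (hu u).
Fact commr_ev2 u v : commr_rmorph (hu u) v. Proof. by move=> x; apply: mulrC. Qed.

(* Substitution of u for the inner variable and of v for the outer one. *)
Definition ev2 u v : A -> A := horner_morph (commr_ev2 u v).
HB.instance Definition _ u v := GRing.RMorphism.on (ev2 u v).

Lemma huC u c : hu u c%:P = cc c. Proof. exact: horner_morphC. Qed.
Lemma huX u : hu u 'X = u. Proof. exact: horner_morphX. Qed.
Lemma ev2C u v c : ev2 u v c%:P = hu u c. Proof. exact: horner_morphC. Qed.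
Lemma ev2X u v : ev2 u v 'X = v. Proof. exact: horner_morphX. Qed.
Lemma ev2cc u v c : ev2 u v (cc c) = cc c. Proof. by rewrite ev2C huC. Qed.

Definition dt u : A := map_poly (@deriv K) u.

Lemma coef_dt u i : (dt u)`_i = (u`_i)^`(). Proof. by rewrite coef_map_id0 // deriv0. Qed.

Lemma dt_is_additive : additive dt.
Proof. by move=> u v; apply/polyP=> i; rewrite !(coefB, coef_dt) derivB. Qed.
HB.instance Definition _ := GRing.isAdditive.Build A A dt dt_is_additive.

Lemma dtM u v : dt (u * v) = dt u * v + u * dt v.
Proof.
apply/polyP=> i; rewrite coefD coef_dt !coefM raddf_sum -big_split /=.
by apply: eq_bigr => j _; rewrite derivM !coef_dt.
Qed.

Lemma dtC c : dt c%:P = c^`()%:P.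
Proof. by apply/polyP=> i; rewrite coef_dt !coefC; case: eqP; rewrite ?deriv0. Qed.

Lemma dtX : dt 'X = 0.
Proof. by apply/polyP=> i; rewrite coef_dt coefX coef0; case: eqP; rewrite ?derivC // -polyC1 derivC. Qed.

Lemma size_dt u : (size (dt u) <= size u)%N. Proof. exact: size_poly. Qed.

Definition jac u v : A := u^`() * dt v - dt u * v^`().

Lemma jac_is_additive u : additive (jac u).
Proof. by move=> a b; rewrite /jac derivB raddfB /=; ring. Qed.
HB.instance Definition _ u := GRing.isAdditive.Build A A (jac u) (jac_is_additive u).

Lemma jacC u v : jac v u = - jac u v. Proof. by rewrite /jac; ring. Qed.
Lemma jacuu u : jac u u = 0. Proof. by rewrite /jac mulrC subrr. Qed.
Lemma jacM u a b : jac u (a * b) = jac u a * b + a * jac u b.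
Proof. by rewrite /jac derivM dtM; ring. Qed.
Lemma jac_cc u c : jac u (cc c) = 0.
Proof. by rewrite /jac /cc dtC !derivC polyC0 !mulr0 subrr. Qed.

Lemma jac_hu a u c : jac a (hu u c) = hu u c^`() * jac a u.
Proof.
elim/poly_ind: c => [|c x IH]; first by rewrite deriv0 !raddf0 mul0r.
rewrite derivD derivM derivX derivC mulr1 addr0.
by rewrite !rmorphD !rmorphM /= !huC !huX raddfD /= jacM IH jac_cc; ring.
Qed.

Lemma jac_ev2 a u v R :
  jac a (ev2 u v R) = ev2 u v R^`() * jac a v + ev2 u v (dt R) * jac a u.
Proof.
elim/poly_ind: R => [|R c IH].
  by rewrite deriv0 !raddf0 /= !mul0r addr0.
rewrite derivD derivM derivX derivC mulr1 addr0 [dt _]raddfD /= dtM dtX mulr0 addr0 dtC.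
rewrite !rmorphD !rmorphM /= !ev2C !ev2X raddfD /= jacM IH jac_hu.
by ring.
Qed.

Definition genby u v a := exists R, ev2 u v R = a.

Lemma ev2_ev2 u v U V R : ev2 u v (ev2 U V R) = ev2 (ev2 u v U) (ev2 u v V) R.
Proof.
elim/poly_ind: R => [|R c IH]; first by rewrite !raddf0.
rewrite !rmorphD !rmorphM /= !ev2X IH; congr (_ + _); rewrite !ev2C.
elim/poly_ind: c => [|c x IHc]; first by rewrite !raddf0.
by rewrite !rmorphD !rmorphM /= !huX !huC IHc ev2cc.
Qed.

Lemma genby_trans u v u' v' a : genby u v a -> genby u' v' u -> genby u' v' v ->
  genby u' v' a.
Proof. by move=> [R <-] [U <-] [V <-]; exists (ev2 U V R); rewrite ev2_ev2. Qed.

(* In the blow-up x = s, y = s t the outer variable is s and the inner one is t. *)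
Definition st : A := 'X * ('X)%:P.

(** By the chain rule the Jacobian of two polynomials in [u] and [v] is a multiple of [jac u v]. For
    the pair [s], [s t] it is [s], the Jacobian of the blow-up. *)
Lemma jac_dvd u v : genby u v 'X -> genby u v st ->
  exists M, M * jac u v = 'X.
Proof.
move=> [R1 e1] [R2 e2].
exists (ev2 u v (dt R1) * ev2 u v R2^`() - ev2 u v (dt R2) * ev2 u v R1^`()).
have jst : jac 'X st = 'X.
  by rewrite /jac /st dtM !dtX !derivM !derivX !derivC dtC derivX polyC1; ring.
transitivity (jac (ev2 u v R1) (ev2 u v R2)); last by rewrite e1 e2.
rewrite jac_ev2 (jacC v (ev2 _ _ _)) (jacC u (ev2 _ _ _)) !jac_ev2 !jacuu (jacC u v).
by ring.
Qed.

Lemma jac_dvd_size u v : genby u v 'X -> genby u v st ->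
  jac u v != 0 /\ (size (jac u v) <= 2)%N.
Proof.
move=> /jac_dvd h /h[M eM].
have J0 : jac u v != 0.
  by apply/eqP=> J0; move/eqP: eM; rewrite J0 mulr0 eq_sym polyX_eq0.
split=> //; have M0 : M != 0.
  by apply/eqP=> M0; move/eqP: eM; rewrite M0 mul0r eq_sym polyX_eq0.
have sM : (size M + size (jac u v)).-1 = 2%N by rewrite -size_mul // eM size_polyX.
have M1 : (0 < size M)%N by rewrite size_poly_gt0.
lia.
Qed.

(** Each term contains one derivative in the outer variable, which saves one degree; in terms of
    sizes, [deg u + deg a - 1] becomes [(size u).-2 + size a]. If [u] is constant in the outer
    variable, only one term is left. *)
Lemma size_jac u a : (size (jac u a) <= (size u).-2 + size a)%N.
Proof.
have [u1|u1] := leqP (size u) 1.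
  suff -> : jac u a = - (dt u * a^`()).
    rewrite size_polyN; have [->|a0] := eqVneq a 0; first by rewrite deriv0 mulr0 size_poly0.
    have h1 : (size (dt u * a^`())%R <= (size (dt u) + size a^`()).-1)%N := size_polyMleq _ _.
    have h2 : (size a^`() < size a)%N := lt_size_deriv a0.
    have h3 := size_dt u.
    have aux (x y z t r : nat) : (x <= (y + z).-1 -> z < t -> y <= r -> r <= 1 -> x <= r.-2 + t)%N by lia.
    exact: aux h1 h2 h3 u1.
  by rewrite /jac (size1_polyC u1) derivC mul0r sub0r.
have u0 : u != 0 by rewrite -size_poly_gt0; lia.
have [->|a0] := eqVneq a 0; first by rewrite raddf0 size_poly0.
apply: leq_trans (size_polyD _ _) _; rewrite size_polyN geq_max.
have h1 : (size (dt u * a^`())%R <= (size (dt u) + size a^`()).-1)%N := size_polyMleq _ _.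
have h2 : (size a^`() < size a)%N := lt_size_deriv a0.
have h3 : (size (u^`() * dt a)%R <= (size u^`() + size (dt a)).-1)%N := size_polyMleq _ _.
have h4 : (size u^`() < size u)%N := lt_size_deriv u0.
have h5 := size_dt u; have h6 := size_dt a.
have aux (x x' y z y' z' su sa : nat) : (x <= (y + z).-1 -> z < sa ->
  x' <= (y' + z').-1 -> y' < su -> y <= su -> z' <= sa -> 1 < su ->
  (x' <= su.-2 + sa) && (x <= su.-2 + sa))%N by lia.
exact: aux h1 h2 h3 h4 h5 h6 u1.
Qed.

Lemma nonroot (p : {poly K}) : p != 0 -> exists x, p.[x] != 0.
Proof.
move=> p0; apply: contrapT => h.
have ar : all (root p) [seq i%:R | i <- iota 0 (size p)].
  apply/allP=> _ /mapP[i _ ->]; apply/negPn/negP => r; apply: h.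
  by exists i%:R.
suff /(max_poly_roots p0 ar) : uniq [seq i%:R : K | i <- iota 0 (size p)].
  by rewrite size_map size_iota ltnn.
by rewrite map_inj_uniq ?iota_uniq // => i j /eqP; rewrite eqr_nat => /eqP.
Qed.

Lemma derivn_root (k : nat) (b : K) (E : {poly K}) :
  ((('X - b%:P) ^+ k * E)^`(k)).[b] = k`!%:R * E.[b].
Proof.
elim: k E => [|k IH] E; first by rewrite expr0 mul1r derivn0 mul1r.
have -> : (('X - b%:P) ^+ k.+1 * E)^`(k.+1) =
          (('X - b%:P) ^+ k * (k.+1%:R *: E + ('X - b%:P) * E^`()))^`(k).
  rewrite derivSn; congr (_^`(k)); rewrite derivM deriv_exp derivXsubC /= mul1r exprS.
  by rewrite scaler_nat mulrDr mulrnAl mulrnAr mulrCA mulrA.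
by rewrite IH !hornerE subrr mul0r addr0 mulrA factS natrM [_.+1%:R * _]mulrC.
Qed.

(* Multiplicity bound for a lacunary polynomial: all exponents of rho lie in one
   residue class mod p, so a nonzero root of multiplicity k costs degree k p. *)
Lemma lacunary_root (p j0 : nat) (b : K) (rho : {poly K}) :
  (0 < p)%N -> b != 0 -> rho != 0 -> (forall j, rho`_j != 0 -> j = j0 %[mod p]) ->
  exists2 k, (k * p < size rho)%N & (rho^`(k)).[b] != 0.
Proof.
move=> p0 b0 r0 hr; pose j1 := (j0 %% p)%N.
(* With the residue [j1] split off, [rho] is a polynomial [sg] in ['X^p]; the multiplicity of
   [b ^+ p] as a root of [sg] is the required [k]. *)
pose sg : {poly K} := \poly_(i < size rho) rho`_(i * p + j1).
have er : rho = (sg \Po 'X^p) * 'X^j1.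
  apply/polyP=> j; rewrite coefMXn; have [lt|le] := ltnP j j1.
    apply: contraTeq isT => /hr e; move: lt; rewrite /j1 -e.
    by rewrite ltnNge leq_mod.
  rewrite coef_comp_poly_Xn //; have [dv|ndv] := boolP (p %| j - j1)%N; last first.
    apply: contraNeq ndv => /hr e; rewrite /j1 -e; apply/dvdnP; exists (j %/ p)%N.
    by rewrite {1}(divn_eq j p) addnK.
  rewrite coef_poly divnK // subnK //; case: ltnP => // h.
  rewrite nth_default //; apply: leq_trans h _.
  by apply: leq_trans (leq_div _ _) _; rewrite leq_subr.
have sg0 : sg != 0 by apply: contraNneq r0 => s0; rewrite er s0 comp_poly0 mul0r.
have [k [tau + es]] := multiplicity_XsubC sg (b ^+ p).
rewrite sg0 /= => nr.
have tau0 : tau != 0 by apply: contraNneq sg0 => t0; rewrite es t0 mul0r.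
exists k.
  have st0 : (tau \Po 'X^p) != 0 by rewrite comp_poly_eq0 ?size_polyXn.
  have sp0 : (('X - (b ^+ p)%:P) \Po 'X^p) ^+ k != 0.
    by rewrite expf_neq0 // comp_poly_eq0 ?size_polyXn ?polyXsubC_eq0.
  rewrite er es comp_polyM rmorphXn /= size_mulXn ?mulf_neq0 // size_mul //.
  have := size_exp (('X - (b ^+ p)%:P) \Po 'X^p) k.
  rewrite size_comp_poly size_XsubC size_polyXn /= mul1n mulnC => <-.
  move: st0 sp0; rewrite -!size_poly_gt0.
  have aux (x y z : nat) : (0 < x -> 0 < y -> y.-1 < z + (x + y).-1)%N by lia.
  exact: aux.
(* [b] is a simple root of ['X^p - b^p]: the cofactor has the value [p b^(p-1)] there, nonzero in
   characteristic zero. *)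
have eE : rho = ('X - b%:P) ^+ k * ((\sum_(i < p) 'X^(p.-1 - i) * b%:P ^+ i) ^+ k
     * (tau \Po 'X^p) * 'X^j1).
  rewrite er es comp_polyM rmorphXn /= rmorphB /= comp_polyX comp_polyC rmorphXn /=.
  by rewrite subrXX exprMn; ring.
rewrite eE derivn_root !hornerM horner_exp horner_comp !hornerXn.
apply: mulf_neq0; first by rewrite pnatr_eq0 -lt0n fact_gt0.
apply: mulf_neq0; last by rewrite expf_neq0.
apply: mulf_neq0 => //; apply: expf_neq0.
rewrite horner_sum (eq_bigr (fun=> b ^+ p.-1)) => [|i _].
  by rewrite sumr_const card_ord -mulr_natl mulf_neq0 ?expf_neq0 // pnatr_eq0 -lt0n.
rewrite hornerM hornerXn -rmorphXn hornerC -exprD subnK //.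
by case: i => /= i; case: (p) p0.
Qed.

End Bivariate.

(** * Degree reduction for generating pairs *)

Section Jung.
Variable K : numFieldType.
Local Notation A := {poly {poly K}}.
Implicit Types (u v : A) (R : A).

Lemma coefM_top (T : comNzRingType) (p q : {poly T}) a b :
  (size p <= a.+1)%N -> (size q <= b.+1)%N ->
  (size (p * q)%R <= (a + b).+1)%N /\ (p * q)`_(a + b) = p`_a * q`_b.
Proof.
move=> sp sq; split.
  apply: leq_trans (size_polyMleq _ _) _.
  have aux (x y : nat) : (x <= a.+1 -> y <= b.+1 -> (x + y).-1 <= (a + b).+1)%N by lia.
  exact: aux.
rewrite coefM (bigD1 (Ordinal (leq_addr b a : (a < (a + b).+1)%N))) //= addKn.
rewrite big1 ?addr0 // => i; rewrite -val_eqE /= => ia.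
have [lt|ge] := ltnP i a.
  by rewrite [X in _ * X]nth_default ?mulr0 //; apply: leq_trans sq _; lia.
by rewrite nth_default ?mul0r //; apply: leq_trans sp _; lia.
Qed.

Lemma coefX_top (T : comNzRingType) (p : {poly T}) a k : (size p <= a.+1)%N ->
  (size (p ^+ k)%R <= (a * k).+1)%N /\ (p ^+ k)`_(a * k) = p`_a ^+ k.
Proof.
move=> sp; elim: k => [|k [IH1 IH2]]; first by rewrite muln0 !expr0 size_poly1 coef1.
by rewrite mulnS !exprS -IH2; apply: coefM_top.
Qed.

Lemma coef_monomial (p q : {poly K}) n m i j N :
  (size p <= n.+1)%N -> (size q <= m.+1)%N -> (n * i + m * j <= N)%N ->
  (p ^+ i * q ^+ j)`_N = if n * i + m * j == N then p`_n ^+ i * q`_m ^+ j else 0.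
Proof.
move=> sp sq le; have [sp' <-] := coefX_top i sp; have [sq' <-] := coefX_top j sq.
have [s e] := coefM_top sp' sq'; case: eqP => [<-|ne]; first exact: e.
by rewrite nth_default //; apply: leq_trans s _; lia.
Qed.

Lemma ev2E u v R Mj Mi : (forall j i, (Mj <= j)%N || (Mi <= i)%N -> R`_j`_i = 0) ->
  ev2 u v R = \sum_(j < Mj) \sum_(i < Mi) cc R`_j`_i * (u ^+ i * v ^+ j).
Proof.
move=> h; have {1}-> : R = \poly_(j < Mj) (\poly_(i < Mi) R`_j`_i).
  apply/polyP=> j; rewrite coef_poly; case: ltnP => hj; apply/polyP=> i.
    by rewrite coef_poly; case: ltnP => hi //; rewrite h // hi orbT.
  by rewrite coef0 h // hj.
rewrite poly_def rmorph_sum; apply: eq_bigr => j _ /=.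
rewrite -mul_polyC rmorphM rmorphXn /= ev2C ev2X.
rewrite poly_def rmorph_sum mulr_suml; apply: eq_bigr => i _ /=.
rewrite -mul_polyC rmorphM rmorphXn /= huC huX.
by rewrite mulrA.
Qed.

Lemma size_le_mulr (T : idomainType) (p q : {poly T}) : q != 0 -> (size p <= size (p * q)%R)%N.
Proof.
move=> q0; have [->|p0] := eqVneq p 0; first by rewrite size_poly0.
by rewrite size_mul // -subn1 -addnBA ?leq_addr // size_poly_gt0.
Qed.

(** The equation says [n (i - i') = m (j' - j)]; after division by the gcd, [n / g] is coprime to
    [m / g] and divides [j' - j]. *)
Lemma weights_modn n m i j i' j' : (0 < n)%N ->
  (n * i + m * j = n * i' + m * j')%N -> j = j' %[mod n %/ gcdn n m].
Proof.
move=> n0; wlog le : i j i' j' / (j <= j')%N.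
  by move=> h e; have [le|/ltnW le] := leqP j j'; [exact: h e|symmetry; exact: h (esym e)].
move=> e; apply/esym/eqP; rewrite eqn_mod_dvd //.
have g0 : (0 < gcdn n m)%N by rewrite gcdn_gt0 n0.
have cp : coprime (n %/ gcdn n m) (m %/ gcdn n m).
  rewrite /coprime -(eqn_pmul2l g0) muln1 muln_gcdr mulnC divnK ?dvdn_gcdl //.
  by rewrite mulnC divnK ?dvdn_gcdr.
rewrite -(Gauss_dvdr _ cp) -(dvdn_pmul2r g0) divnK ?dvdn_gcdl //.
rewrite mulnAC divnK ?dvdn_gcdr //; apply/dvdnP; exists (i - i')%N.
rewrite mulnBr mulnBl; nia.
Qed.

(* Write s = R(u, v).  Each derivative of R in v raises the degree in s by at most
   n - 1, whereas for some k, bounded by lacunary_root, the k-th derivative keeps its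
   top weighted form at the leading coefficients of u and v. *)
Lemma gen_deg_dvd u v n m : size u = n.+1 -> size v = m.+1 -> (0 < n)%N -> (0 < m)%N ->
  genby u v 'X -> jac u v != 0 -> (n %| m)%N || (m %| n)%N.
Proof.
move=> su sv n0 m0 [R eR] J0; apply: contraT; rewrite negb_or => /andP[nm mn].
have n2 : (1 < n)%N by case: n n0 nm {su mn} => [|[|n]] //; rewrite dvd1n.
have m2 : (1 < m)%N by case: m m0 mn {sv nm} => [|[|m]] //; rewrite dvd1n.
pose T k := ev2 u v R^`(k).
have sT k : (size (T k) <= 2 + k * n.-1)%N.
  elim: k => [|k IH]; first by rewrite /T derivn0 eR size_polyX.
  have eT : T k.+1 * jac u v = jac u (T k).
    by rewrite /T derivnS jac_ev2 jacuu mulr0 addr0.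
  apply: leq_trans (size_le_mulr (T k.+1) J0) _; rewrite eT.
  apply: leq_trans (size_jac _ _) _; rewrite su /= mulSn addnCA leq_add2l.
  exact: IH.
have lu0 : lead_coef u != 0 by rewrite lead_coef_eq0 -size_poly_gt0 su.
have lv0 : lead_coef v != 0 by rewrite lead_coef_eq0 -size_poly_gt0 sv.
(* A value of the inner variable at which neither leading coefficient vanishes; from here on only
   the degree in [s] counts. *)
have [t0] := nonroot (mulf_neq0 lu0 lv0).
rewrite hornerM mulf_eq0 negb_or /lead_coef su sv /= => /andP[al0 be0].
pose h := horner_eval t0; pose u0 := map_poly h u; pose v0 := map_poly h v.
have su0 : (size u0 <= n.+1)%N by rewrite -su size_poly.
have sv0 : (size v0 <= m.+1)%N by rewrite -sv size_poly.
have eu0 : u0`_n = (u`_n).[t0] by rewrite coef_map.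
have ev0 : v0`_m = (v`_m).[t0] by rewrite coef_map.
set al := (u`_n).[t0] in al0 eu0; set be := (v`_m).[t0] in be0 ev0.
pose Mj := size R; pose Mi := (\max_(j < Mj) size (R`_j)%R)%N.
have hM j i : (Mj <= j)%N || (Mi <= i)%N -> R`_j`_i = 0.
  have [lj _|lj /= li] := leqP Mj j; first by rewrite (nth_default _ lj) coef0.
  rewrite nth_default //; apply: leq_trans li.
  exact: (leq_bigmax (Ordinal lj)).
have lM j i : R`_j`_i != 0 -> (j < Mj)%N /\ (i < Mi)%N.
  by move=> nz; split; rewrite ltnNge; apply/negP=> le; move/eqP: nz; apply;
    apply: hM; rewrite le ?orbT.
have R0 : R != 0.
  by apply/eqP=> R0; move/eqP: eR; rewrite R0 raddf0 eq_sym polyX_eq0.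
(* With weight [n] for [u] and [m] for [v], the largest weight [w] of a monomial of [R] is the
   degree in [s] that [R(u, v)] would have without cancellation. *)
pose P w := [exists j : 'I_Mj, exists i : 'I_Mi, (R`_j`_i != 0) && (n * i + m * j == w)%N].
have Pi j i : R`_j`_i != 0 -> P (n * i + m * j)%N.
  move=> nz; have [lj li] := lM _ _ nz.
  by apply/existsP; exists (Ordinal lj); apply/existsP; exists (Ordinal li); rewrite nz /=.
have exP : exists w, P w.
  exists (n * (size (lead_coef R)).-1 + m * (size R).-1)%N; apply: Pi.
  by rewrite -!/(lead_coef _) !lead_coef_eq0.
have ubP w : P w -> (w <= n * Mi + m * Mj)%N.
  case/existsP=> j /existsP[i /andP[_ /eqP<-]].
  by apply: leq_add; rewrite leq_mul2l ltnW ?orbT.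
case: (ex_maxnP exP ubP) => w /existsP[js /existsP[is_ /andP[nzs /eqP ws]]] maxw.
(* [rho] is the top weighted part of [R] with [al] put for [u]: a polynomial in [v] alone, with all
   its exponents in one class mod [p]. *)
pose term j i : K := if (n * i + m * j == w)%N then R`_j`_i * al ^+ i else 0.
pose rho : {poly K} := \poly_(j < Mj) \sum_(i < Mi) term j i.
have rhoE j : rho`_j = \sum_(i < Mi) term j i.
  rewrite coef_poly; case: ltnP => // lj; rewrite big1 // => i _.
  by rewrite /term hM ?lj // mul0r if_same.
have rho_js : rho`_js != 0.
  rewrite rhoE (bigD1 is_) //= big1 ?addr0.
    by rewrite /term ws eqxx mulf_neq0 ?expf_neq0.
  move=> i ne; rewrite /term; case: eqP => // e; case/eqP: ne; apply/val_inj.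
  by move: ws; rewrite -e => /eqP; rewrite eqn_add2r eqn_pmul2l // => /eqP.
have rho0 : rho != 0 by apply: contraNneq rho_js => ->; rewrite coef0.
have rho_supp j : rho`_j != 0 -> exists i, (n * i + m * j = w)%N.
  rewrite rhoE => nz; apply: contrapT => h0; case/eqP: nz; rewrite big1 // => i _.
  by rewrite /term; case: eqP => // e; case: h0; exists i.
pose g := gcdn n m; pose p := (n %/ g)%N; pose q := (m %/ g)%N.
have g0 : (0 < g)%N by rewrite gcdn_gt0 n0.
have np : n = (p * g)%N by rewrite divnK ?dvdn_gcdl.
have mq : m = (q * g)%N by rewrite divnK ?dvdn_gcdr.
have p2 : (1 < p)%N.
  rewrite ltnNge; apply/negP => p1; case/negP: nm; have ng : g = n.
    by move: p1 np n0; case: (p) => [|[|//]] _ ->; rewrite ?mul0n ?mul1n.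
  by move: (dvdn_gcdr n m); rewrite -/g ng.
have q2 : (1 < q)%N.
  rewrite ltnNge; apply/negP => q1; case/negP: mn; have mg : g = m.
    by move: q1 mq m0; case: (q) => [|[|//]] _ ->; rewrite ?mul0n ?mul1n.
  by move: (dvdn_gcdl n m); rewrite -/g mg.
have pq : (p != q)%N.
  by apply: contraNneq nm => pq; rewrite mq -pq -np dvdnn.
have cl j : rho`_j != 0 -> j = js %[mod p].
  by move=> /rho_supp[i e]; apply: (@weights_modn n m i j is_ js n0); rewrite e ws.
have [k kp rk0] := @lacunary_root _ p js be rho (ltnW p2) be0 rho0 cl.
have [i0 wi0] : exists i, (n * i + m * (size rho).-1 = w)%N.
  by apply: rho_supp; rewrite -/(lead_coef rho) lead_coef_eq0.
have kmw : (m * (k * p) <= w)%N.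
  rewrite -wi0; apply: leq_trans (leq_addl _ _); rewrite leq_mul2l; apply/orP; right.
  by rewrite -ltnS prednK // size_poly_gt0.
have kmw' : (m * k <= w)%N by apply: leq_trans kmw; rewrite leq_mul2l leq_pmulr ?orbT // ltnW.
(* The coefficient of degree [w - m k] receives exactly the monomials of top weight, evaluated at
   the leading coefficients [al] and [be]. *)
have coefT : (map_poly h (T k))`_(w - m * k) = (rho^`(k)).[be].
  rewrite /T (@ev2E _ _ _ Mj Mi); last first.
    move=> j i hji; rewrite coef_derivn coefMn hM ?mul0rn //.
    by case/orP: hji => l; rewrite ?l ?orbT // (leq_trans l) ?leq_addl.
  rewrite rmorph_sum coef_sum (@horner_coef_wide _ Mj); last first.
    by apply/leq_sizeP=> j lj; rewrite coef_derivn rhoE big1 ?mul0rn // => i _;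
      rewrite /term hM ?mul0r ?if_same // (leq_trans lj) ?leq_addl.
  apply: eq_bigr => j _; rewrite [in RHS]coef_derivn rhoE rmorph_sum coef_sum.
  rewrite -sumrMnl mulr_suml; apply: eq_bigr => i _.
  rewrite coef_derivn coefMn !rmorphM !rmorphXn /= -/u0 -/v0 /cc map_polyC /= coefCM.
  rewrite /horner_eval hornerC /term.
  have [z|nz] := eqVneq (R`_(k + j)`_i) 0; first by rewrite z !mul0rn !mul0r if_same mul0rn mul0r.
  have le : (n * i + m * (k + j) <= w)%N by apply: maxw; apply: Pi.
  rewrite (coef_monomial su0 sv0); last by clear - le; rewrite mulnDr in le; lia.
  have -> : (n * i + m * j == w - m * k)%N = (n * i + m * (k + j) == w)%N.
    by clear - le kmw'; rewrite mulnDr in le *; lia.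
  by case: eqP => _; rewrite ?mulr0 ?mul0rn ?mul0r // eu0 ev0 -mulrnAl mulrA.
have lt : (w - m * k < 2 + k * n.-1)%N.
  apply: leq_trans (sT k); apply: leq_trans (size_poly _ _ : (size (map_poly h (T k)) <= _)%N).
  by rewrite ltnNge; apply/negP=> le; move/eqP: rk0; apply; rewrite -coefT nth_default.
(* If [k > 0], then [p q >= p + q + 1] for distinct [p, q >= 2], whence [w >= k (n + m + g)],
   against [w <= 1 + k (n + m - 1)]. *)
have [k0|k1] := posnP k; last first.
  have h1 : (p + q + 1 <= p * q)%N by clear - p2 q2 pq; nia.
  have h2 : (n + m + g <= m * p)%N by rewrite np mq; clear - h1; nia.
  have h3 : (k * (n + m + g) <= w)%N by clear - h2 kmw; nia.
  by clear - h3 lt k1 g0 n0 kmw'; nia.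
(* If [k = 0], the top weight is at most one; as [n, m >= 2], this makes [R] constant. *)
move: lt; rewrite k0 muln0 subn0 mul0n addn0 => w1.
have zero j i : (0 < i + j)%N -> R`_j`_i = 0.
  move=> ij; apply/eqP; apply: contraT => /Pi /maxw le; clear - le w1 ij n2 m2; nia.
have RE : R = cc R`_0`_0.
  apply/polyP=> j; apply/polyP=> i; rewrite /cc coefC; case: eqP => [->|j0].
    by rewrite coefC; case: eqP => [->//|i0']; rewrite zero // lt0n addn_eq0; case: eqP.
  by case: j j0 => // j _; rewrite coef0 zero // addnS.
by move: eR; rewrite RE ev2cc => /(congr1 (size \o val)) /=; rewrite size_polyX size_polyC; case: eqP.
Qed.

Lemma coef_deriv_mul_top (p q : {poly K}) a b :
  (size p <= a.+1)%N -> (size q <= b.+1)%N ->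
  (p^`() * q)`_(a + b).-1 = a%:R * (p`_a * q`_b).
Proof.
move=> sp sq; case: a sp => [|a] sp.
  by rewrite (size1_polyC sp) derivC mul0r coef0 mul0r.
have sp' : (size p^`() <= a.+1)%N by apply: leq_trans (size_poly _ _) _; rewrite -ltnS; case: (size p) sp.
by rewrite addSn /=; have [_ ->] := coefM_top sp' sq; rewrite coef_deriv -(mulr_natl p`_a.+1) mulrA.
Qed.

(** Comparison of leading coefficients makes the degrees equal. Subtracting the multiple of [q] with
    the leading coefficient of [p] keeps the relation and lowers the degree. *)
Lemma wronskian_eq0 (p q : {poly K}) : q != 0 -> p^`() * q = p * q^`() ->
  exists c, p = c *: q.
Proof.
move=> q0; have [n] := ubnP (size p); elim: n p => // n IH p sp e.
have [->|p0] := eqVneq p 0; first by exists 0; rewrite scale0r.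
have sp1 : size p = (size p).-1.+1 by rewrite prednK // size_poly_gt0.
have sq1 : size q = (size q).-1.+1 by rewrite prednK // size_poly_gt0.
have ab : (size p).-1 = (size q).-1.
  have := @coef_deriv_mul_top p q (size p).-1 (size q).-1.
  rewrite -sp1 -sq1 !leqnn e mulrC addnC => /(_ isT isT).
  rewrite coef_deriv_mul_top -?sp1 -?sq1 // => /eqP.
  rewrite [X in _ * X]mulrC -subr_eq0 -mulrBl !mulf_eq0 !lead_coef_eq0 (negPf p0) (negPf q0) !orbF.
  by rewrite subr_eq0 eqr_nat => /eqP ->.
pose c := lead_coef p / lead_coef q.
have [||d ed] := IH (p - c *: q).
  apply: (@leq_trans (size p)); last by rewrite -ltnS.
  rewrite [X in (_ < X)%N]sp1 ltnS; apply/leq_sizeP=> j; rewrite leq_eqVlt => /orP[/eqP<-|lt].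
    rewrite coefB coefZ {2}ab -!/(lead_coef _) divfK ?subrr // ?lead_coef_eq0 //.
  rewrite coefB coefZ !nth_default ?mulr0 ?subrr //; first by rewrite sq1 -ab.
  by rewrite sp1.
  by rewrite derivB derivZ !mulrBl e -!scalerAl [q * _]mulrC.
by exists (d + c); rewrite scalerDl -ed subrK.
Qed.

(** Since [jac u v] has degree at most one in [s], its coefficient of degree [n + n k - 1] vanishes.
    For the leading coefficients [a], [b] of [u], [v] this reads [a b' = k a' b], a vanishing
    Wronskian of [b] and [a ^+ k]. *)
Lemma top_reduce u v n k : size u = n.+1 -> size v = (n * k).+1 -> (0 < n)%N ->
  (0 < k)%N -> (2 < n + n * k)%N -> (size (jac u v) <= 2)%N ->
  exists c, (size (v - cc c * u ^+ k)%R <= n * k)%N.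
Proof.
move=> su sv n0 k0 nk sJ; set m := (n * k)%N in sv nk *.
have m0 : (0 < m)%N by rewrite muln_gt0 n0.
have sdu : (size u^`() <= n.-1.+1)%N by rewrite prednK // -ltnS -su lt_size_deriv // -size_poly_gt0 su.
have sdv : (size v^`() <= m.-1.+1)%N by rewrite prednK // -ltnS -sv lt_size_deriv // -size_poly_gt0 sv.
have stu : (size (dt u) <= n.+1)%N by rewrite -su size_dt.
have stv : (size (dt v) <= m.+1)%N by rewrite -sv size_dt.
have [_ e1] := coefM_top sdu stv; have [_ e2] := coefM_top stu sdv.
have : (jac u v)`_(n + m).-1 = 0.
  rewrite nth_default //; apply: leq_trans sJ _; clear - nk; lia.
have i1 : (n.-1 + m = (n + m).-1)%N by clear - n0; lia.
have i2 : (n + m.-1 = (n + m).-1)%N by clear - m0; lia.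
rewrite /jac coefB -{1}i1 e1 -i2 e2 !coef_dt !coef_deriv !prednK // => /eqP.
set a := u`_n; set b := v`_m; rewrite subr_eq0 => /eqP e.
have a0 : a != 0 by rewrite /a -[n]/(n.+1.-1) -su lead_coef_eq0 -size_poly_gt0 su.
have {}e : a * b^`() = k%:R * (a^`() * b).
  have nz : (n%:R : {poly K}) != 0 by rewrite -polyC_natr polyC_eq0 pnatr_eq0 -lt0n.
  apply: (mulfI nz); rewrite [RHS]mulrA -natrM -/m !mulr_natl.
  by rewrite -mulrnAl e mulrnAr.
have [c ec] : exists c, b = c *: a ^+ k.
  apply: wronskian_eq0; first by rewrite expf_neq0.
  rewrite deriv_exp -(prednK k0) /= exprS mulrA [_ * a]mulrC e prednK //.
  by rewrite -(mulr_natl (_ * _)) ; move: (k%:R) => k'; ring.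
exists c; apply/leq_sizeP => j; rewrite leq_eqVlt => /orP[/eqP<-|lt].
  have [_ eu] := coefX_top k (eq_leq su); rewrite coefB /cc coefCM eu -/a -/b ec.
  by rewrite mul_polyC subrr.
have [suk _] := coefX_top k (eq_leq su).
rewrite coefB /cc coefCM !nth_default ?mulr0 ?subrr //; first exact: leq_trans suk lt.
by rewrite sv.
Qed.

(** Singles out the polynomials in [s] and [s t] among those in [s] and [t]. *)
Definition homog u := forall i, (size (u`_i)%R <= i.+1)%N.

Lemma homogD u v : homog u -> homog v -> homog (u + v).
Proof.
by move=> hu hv i; rewrite coefD (leq_trans (size_polyD _ _)) // geq_max hu hv.
Qed.

Lemma homogN u : homog u -> homog (- u).
Proof. by move=> hu i; rewrite coefN size_polyN. Qed.

Lemma homog_sum (I : Type) (r : seq I) (P : pred I) (F : I -> A) :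
  (forall i, P i -> homog (F i)) -> homog (\sum_(i <- r | P i) F i).
Proof.
move=> h; elim/big_ind: _ => //; last exact: homogD.
by move=> i; rewrite coef0 size_poly0.
Qed.

Lemma homogM u v : homog u -> homog v -> homog (u * v).
Proof.
move=> hu hv i; rewrite coefM; apply: leq_trans (size_sum _ _ _) _.
apply/bigmax_leqP => j _; apply: leq_trans (size_polyMleq _ _) _.
have := hu j; have := hv (i - j)%N; have := ltn_ord j.
have aux (x y a b : nat) : (a < b.+1 -> x <= (b - a).+1 -> y <= a.+1 -> (y + x).-1 <= b.+1)%N by lia.
exact: aux.
Qed.

Lemma homog_cc c : homog (cc c).
Proof.
move=> i; rewrite /cc coefC; case: eqP => _; rewrite ?size_poly0 //.
by apply: leq_trans (size_polyC_leq1 _) _.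
Qed.

Lemma homog_exp u k : homog u -> homog (u ^+ k).
Proof.
move=> hu; elim: k => [|k IH]; last by rewrite exprS; apply: homogM.
by rewrite expr0 -(rmorph1 (@cc K)); apply: homog_cc.
Qed.

Lemma homogX : homog 'X.
Proof. by move=> i; rewrite coefX; case: eqP => [->|_]; rewrite ?size_poly1 ?size_poly0. Qed.

Lemma homog_st : homog (st K).
Proof.
move=> i; rewrite /st mulrC coefCM coefX; case: eqP => [->|_].
  by rewrite mulr1 size_polyX.
by rewrite mulr0 size_poly0.
Qed.

(* The value at the point (s, s t) of the polynomial that u represents. *)
Definition evst u (s t : K) := (u.[s%:P]).[t].

Lemma evst_sub u v c k s t :
  evst (v - cc c * u ^+ k) s t = evst v s t - c * evst u s t ^+ k.
Proof. by rewrite /evst !(hornerD, hornerN, hornerM, horner_exp, hornerC). Qed.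

Definition elem c k : letter K := Letter (c *: 'X^k) 1 1 0.

Lemma tri_elem c k z : tri (elem c k) z = (z.1 + c * z.2 ^+ k, z.2).
Proof. by rewrite /tri /= !hE !mul1r addr0. Qed.

Lemma homog1E u : homog u -> size u = 2%N ->
  exists a0 a1 b, u = (a0%:P + a1 *: 'X)%:P * 'X + cc b /\ u`_1 = a0%:P + a1 *: 'X.
Proof.
move=> h s; exists (u`_1)`_0, (u`_1)`_1, (u`_0)`_0.
have e1 : ((u`_1)`_0)%:P + (u`_1)`_1 *: 'X = u`_1.
  apply/polyP=> i; rewrite coefD coefC coefZ coefX.
  case: i => [|[|i]] /=; rewrite ?mulr0 ?addr0 ?mulr1 ?add0r //.
  by rewrite nth_default // (leq_trans (h 1%N)).
split=> //; rewrite e1; apply/polyP=> i; rewrite coefD coefCM coefX /cc coefC.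
case: i => [|[|i]] /=; rewrite ?mulr0 ?addr0 ?mulr1 ?add0r //.
  by rewrite -size1_polyC // (h 0%N).
by rewrite nth_default // s.
Qed.

(** Induction on the sum of the degrees: one degree divides the other, so a power of one component
    cancels the leading coefficient of the other, and one elementary letter undoes this. Two
    components of degree one give an affine map. [homog] is what turns a component constant in [s]
    into a scalar. *)
Lemma jung_word N u v : (size u + size v <= N)%N -> homog u -> homog v ->
  genby u v 'X -> genby u v (st K) ->
  exists2 w, all (@lok K) w & forall s t, run w (s, s * t) = (evst u s t, evst v s t).
Proof.
elim: N u v => [|N IH] u v sN hu hv g1 g2.
  have [J0 _] := jac_dvd_size g1 g2; case/eqP: J0.
  have : (size u <= 0)%N by apply: leq_trans (leq_addr _ _) sN.
  by rewrite leqn0 size_poly_eq0 => /eqP ->; rewrite /jac deriv0 raddf0 !mul0r subrr.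
have [J0 sJ] := jac_dvd_size g1 g2.
have cst x : homog x -> (size x <= 1)%N -> exists c, x = cc c.
  by move=> hx sx; exists (x`_0)`_0; rewrite /cc -(size1_polyC (hx 0%N)) -size1_polyC.
have su : (1 < size u)%N.
  rewrite ltnNge; apply/negP => /(cst _ hu)[c ec]; case/eqP: J0.
  by rewrite ec jacC jac_cc oppr0.
have sv : (1 < size v)%N.
  rewrite ltnNge; apply/negP => /(cst _ hv)[c ec]; case/eqP: J0.
  by rewrite ec jac_cc.
have [n en n0] : exists2 n, size u = n.+1 & (0 < n)%N.
  by exists (size u).-1; rewrite ?prednK //; clear - su; case: (size u) su => // [[]].
have [m em m0] : exists2 m, size v = m.+1 & (0 < m)%N.
  by exists (size v).-1; rewrite ?prednK //; clear - sv; case: (size v) sv => // [[]].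
have [nm2|nm] := leqP (n + m) 2.
  have n1 : n = 1%N by clear - nm2 n0 m0; lia.
  have m1 : m = 1%N by clear - nm2 n0 m0; lia.
  rewrite n1 in en; rewrite m1 in em.
  have [a0 [a1 [u0 [eu eu1]]]] := homog1E hu en.
  have [b0 [b1 [v0 [ev ev1]]]] := homog1E hv em.
  have det0 : a0 * b1 - a1 * b0 != 0.
    have dtE (x y c : K) : dt ((x%:P + y *: 'X)%:P * 'X + cc c) = y%:P%:P * 'X.
      rewrite [dt _]raddfD /= dtM dtX mulr0 addr0 /cc !dtC derivC addr0.
      by rewrite derivD derivC derivZ derivX add0r alg_polyC.
    have dE (x y c : K) : ((x%:P + y *: 'X)%:P * 'X + cc c)^`() = (x%:P + y *: 'X)%:P.
      by rewrite derivD derivM derivX /cc !derivC mul0r add0r mulr1 addr0.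
    apply: contraNneq J0 => det0; apply/eqP; rewrite eu ev /jac !dtE !dE.
    transitivity ((a0 * b1 - a1 * b0)%:P%:P * 'X : A); last by rewrite det0 !polyC0 mul0r.
    by rewrite -!mul_polyC !(rmorphB, rmorphD, rmorphM) /=; ring.
  have [w wo ew] := affine_word u0 v0 det0; exists w => // s t; rewrite ew /evst eu ev /=.
  by rewrite !(hornerD, hornerM, hornerX, hornerC, hornerZ); congr pair; ring.
case/orP: (gen_deg_dvd en em n0 m0 g1 J0) => /dvdnP[k ek].
  have k0 : (0 < k)%N by case: k ek m0 => // ->.
  rewrite mulnC in ek; rewrite ek in em nm.
  have [c sc] := top_reduce en em n0 k0 nm sJ.
  set v' := v - cc c * u ^+ k in sc.
  have gu : genby u v' u by exists ('X%:P); rewrite ev2C huX.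
  have gv : genby u v' v.
    exists ('X + ((c *: 'X^k)%:P)); rewrite raddfD /= ev2X ev2C -mul_polyC rmorphM rmorphXn /=.
    by rewrite huC huX subrK.
  have [||w wo ew] := IH u v' _ hu _ (genby_trans g1 gu gv) (genby_trans g2 gu gv).
    have aux (x y z r : nat) : (r <= z -> x + y <= N.+1 -> y = z.+1 -> x + r <= N)%N by lia.
    exact: aux sc sN em.
    by apply: homogD => //; apply/homogN/homogM; [exact: homog_cc|exact: homog_exp].
  (* The swap [lid] before and the trailing swap of [elem c k] make the elementary map act on the
     second coordinate. *)
  exists (w ++ [:: lid K; elem c k]).
    by rewrite all_cat wo /= lok_lid /lok /= oner_eq0.
  move=> s t; rewrite run_cat ew /= step_lid /step tri_elem /swap /= evst_sub.
  by rewrite subrK.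
have k0 : (0 < k)%N by case: k ek n0 => // ->.
rewrite mulnC in ek; rewrite ek addnC in en nm.
have sJ' : (size (jac v u) <= 2)%N by rewrite jacC size_polyN.
have [c sc] := top_reduce em en m0 k0 nm sJ'.
set u' := u - cc c * v ^+ k in sc.
have gv : genby u' v v by exists 'X; rewrite ev2X.
have gu : genby u' v u.
  exists ('X%:P + cc c * 'X ^+ k).
  by rewrite raddfD /= rmorphM rmorphXn /= ev2cc ev2X ev2C huX subrK.
have [||w wo ew] := IH u' v _ _ hv (genby_trans g1 gu gv) (genby_trans g2 gu gv).
  have aux (x y z r : nat) : (r <= z -> x + y <= N.+1 -> x = z.+1 -> r + y <= N)%N by lia.
  exact: aux sc sN en.
  by apply: homogD => //; apply/homogN/homogM; [exact: homog_cc|exact: homog_exp].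
exists (w ++ [:: elem c k; lid K]).
  by rewrite all_cat wo /= lok_lid /lok /= oner_eq0.
move=> s t; rewrite run_cat ew run_tri tri_elem /= evst_sub.
by rewrite subrK.
Qed.

End Jung.

(** * Jung's theorem *)

Section JungMpoly.
Variable K : numFieldType.
Local Notation A := {poly {poly K}}.
Local Notation MP := (mpoly 2 K).

Lemma mmap_comp (S T : comNzRingType) (f : K -> S) (g : {rmorphism S -> T}) (h : 'I_2 -> S) (P : MP) :
  g (mmap f h P) = mmap (g \o f) (g \o h) P.
Proof.
rewrite /mmap rmorph_sum; apply: eq_bigr => m _; rewrite rmorphM; congr (_ * _).
by rewrite /mmap1 rmorph_prod; apply: eq_bigr => i _; rewrite rmorphXn.
Qed.

Lemma mmap_ext (S : comNzRingType) (f f' : K -> S) (h h' : 'I_2 -> S) (P : MP) :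
  f =1 f' -> h =1 h' -> mmap f h P = mmap f' h' P.
Proof.
move=> ef eh; rewrite /mmap; apply: eq_bigr => m _; rewrite ef; congr (_ * _).
by rewrite /mmap1; apply: eq_bigr => i _; rewrite eh.
Qed.

Definition pair2 (T : Type) (a b : T) (i : 'I_2) := if i == 0 then a else b.

Lemma pair2E (T : Type) (h : 'I_2 -> T) : pair2 (h 0) (h 1) =1 h.
Proof. by case=> [[|[|//]] lt]; rewrite /pair2 /=; congr h; apply/val_inj. Qed.

(* P(s, s t), so that the degree in s is the total degree of P. *)
Definition blowup (P : MP) : A := mmap (@cc K) (pair2 'X (st K)) P.

(** The same polynomial with [x] as inner and [y] as outer variable, the form that [ev2] substitutes
    into. *)
Definition mpoly_poly (P : MP) : A := mmap (@cc K) (pair2 'X%:P 'X) P.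

Lemma ev2_mpoly_poly u v P : ev2 u v (mpoly_poly P) = mmap (@cc K) (pair2 u v) P.
Proof.
etransitivity; first exact: (mmap_comp (@cc K) (ev2 u v)).
apply: mmap_ext => [c|i].
  exact: ev2cc.
rewrite /comp /pair2; case: (i == 0); last exact: ev2X.
by etransitivity; [exact: ev2C|exact: huX].
Qed.

Lemma evst_mmap (h : 'I_2 -> A) (P : MP) s t : evst (mmap (@cc K) h P) s t = meval (fun i => evst (h i) s t) P.
Proof.
transitivity (horner_eval t (mmap (horner_eval s%:P \o @cc K) (horner_eval s%:P \o h) P)).
  by congr (horner_eval t _); exact: (mmap_comp (@cc K) (horner_eval s%:P)).
etransitivity; first exact: (mmap_comp _ (horner_eval t)).
apply: mmap_ext => [c|i] //.
by rewrite -[LHS]/((c%:P%:P : A).[s%:P]).[t] !hornerC.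
Qed.

Lemma evst_eq0 (u : A) : (forall s t, evst u s t = 0) -> u = 0.
Proof.
move=> h; apply: contraPP (h) => /eqP u0.
have lu0 : lead_coef u != 0 by rewrite lead_coef_eq0.
have [t lt] := nonroot lu0.
have m0 : map_poly (horner_eval t) u != 0.
  apply: contraNneq lt => m0; rewrite -[_.[t]]/(horner_eval t _) -coef_map.
  by rewrite m0 coef0.
have [s ls] := nonroot m0; move=> h'; move/eqP: ls; apply.
rewrite -(h s t) /evst -[RHS]/(horner_eval t _) -horner_map.
by rewrite /= [horner_eval t _]hornerC.
Qed.

Lemma evst_blowup P s t : evst (blowup P) s t = meval (pair2 s (s * t)) P.
Proof.
rewrite /blowup evst_mmap; apply: meval_eq => i; rewrite /pair2.
by case: eqP => _; rewrite /evst /st !(hornerX, hornerM, hornerC).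
Qed.

Lemma homog_blowup P : homog (blowup P).
Proof.
rewrite /blowup /mmap; apply: homog_sum => m _; apply: homogM; first exact: homog_cc.
rewrite /mmap1; elim/big_ind: _ => [||i _].
- by rewrite -(rmorph1 (@cc K)); apply: homog_cc.
- exact: homogM.
- by rewrite /pair2; case: eqP => _; apply: homog_exp; [exact: homogX|exact: homog_st].
Qed.

Lemma poly_eq_punctured (p q : {poly K}) : (forall x, x != 0 -> p.[x] = q.[x]) -> p = q.
Proof.
move=> h; apply/eqP; rewrite -subr_eq0; apply: contraT => pq0.
have [x] := nonroot (mulf_neq0 pq0 (negbT (polyX_eq0 K))); rewrite !hE mulf_eq0 negb_or.
by case/andP=> + x0; rewrite h // subrr eqxx.
Qed.

(** The word agrees with [F] at the points [(s, s t)], which miss the line [x = 0] except for the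
    origin. For fixed [y] both sides are polynomials in [x], so the equality extends to [x = 0]. *)
Theorem jung (F G : 'I_2 -> MP) :
  (forall h i, meval (fun j => meval h (F j)) (G i) = h i) ->
  exists2 w, all (@lok K) w &
    forall h, run w (h 0, h 1) = (meval h (F 0), meval h (F 1)).
Proof.
move=> GF; pose u := blowup (F 0); pose v := blowup (F 1).
(* As [G] inverts [F], both [s] and [s t] are polynomials in [u] and [v]. *)
have gen (i : 'I_2) : ev2 u v (mpoly_poly (G i)) = pair2 'X (st K) i.
  apply/eqP; rewrite -subr_eq0; apply/eqP/evst_eq0 => s t.
  rewrite /evst hornerD hornerN hornerD hornerN -!/(evst _ s t) ev2_mpoly_poly evst_mmap.
  rewrite (_ : meval _ _ = pair2 s (s * t) i).
    by rewrite /pair2; case: eqP => _; rewrite /evst /st !(hornerX, hornerM, hornerC) subrr.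
  rewrite -[RHS]GF; apply: meval_eq => j; rewrite -[in RHS](pair2E F) /pair2.
  by case: eqP => _; rewrite evst_blowup.
have [w wo ew] := @jung_word K _ u v (leqnn _) (homog_blowup _) (homog_blowup _)
  (ex_intro _ _ (gen 0)) (ex_intro _ _ (gen 1)).
exists w => // h; move: (h 0) (h 1) (pair2E h) => x y eh.
have eF i : meval h (F i) = meval (pair2 x y) (F i) by apply: meval_eq => j; rewrite eh.
rewrite !eF {eF eh h}.
pose lin P : {poly K} := mmap polyC (pair2 'X y%:P) P.
have linE P a : (lin P).[a] = meval (pair2 a y) P.
  etransitivity; first exact: (mmap_comp _ (horner_eval a)).
  apply: mmap_ext => [c|i]; first exact: hornerC.
  by rewrite /pair2 /comp; case: (i == 0); [exact: hornerX|exact: hornerC].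
have e a : a != 0 -> run w (a, y) = ((lin (F 0)).[a], (lin (F 1)).[a]).
  move=> a0; rewrite !linE; have := ew a (y / a); rewrite mulrCA divff // mulr1 => ->.
  by rewrite !evst_blowup mulrCA divff // mulr1.
have pE a : pev (prun w ('X, y%:P)) a = run w (a, y) by rewrite pev_run /pev /= !hE.
have [e1 e2] : (prun w ('X, y%:P)).1 = lin (F 0) /\ (prun w ('X, y%:P)).2 = lin (F 1).
  by split; apply: poly_eq_punctured => a a0; have := pE a; rewrite e // => -[].
by rewrite -pE /pev e1 e2 !linE.
Qed.

End JungMpoly.

(** * Expansion near infinity *)

Import ComplexField.Normc.

Section Estimates.
Variable R : realType.
Local Notation C := R[i].
Local Notation nc := (@normc R).
Implicit Types (x y : C) (z v : C * C).

Lemma nc_ge0 x : 0 <= nc x. Proof. by case: x => a b; rewrite sqrtr_ge0. Qed.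
Lemma nc_gt0 x : (0 < nc x) = (x != 0).
Proof.
rewrite lt0r nc_ge0 andbT; apply/idP/idP; apply: contra => /eqP; last by move/eq0_normc->.
by move=> ->; rewrite normc0.
Qed.
Lemma nc_sqr x : nc x ^+ 2 = complex.Re x ^+ 2 + complex.Im x ^+ 2.
Proof. by case: x => a b /=; rewrite sqr_sqrtr // addr_ge0 ?sqr_ge0. Qed.
Lemma nc_Re x : `|complex.Re x| <= nc x.
Proof. by rewrite -ler_sqr ?nnegrE ?nc_ge0 // nc_sqr real_normK ?num_real // lerDl sqr_ge0. Qed.
Lemma nc_Im x : `|complex.Im x| <= nc x.
Proof. by rewrite -ler_sqr ?nnegrE ?nc_ge0 // nc_sqr real_normK ?num_real // lerDr sqr_ge0. Qed.
Lemma nc_ReIm x : nc x <= `|complex.Re x| + `|complex.Im x|.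
Proof.
rewrite -ler_sqr ?nnegrE ?nc_ge0 ?addr_ge0 // nc_sqr sqrrD !real_normK ?num_real //.
by rewrite lerD2r lerDl mulrn_wge0 // mulr_ge0.
Qed.
Lemma ncN x : nc (- x) = nc x. Proof. exact: normcN. Qed.
Lemma ncD x y : nc (x + y) <= nc x + nc y. Proof. exact: le_normcD. Qed.
Lemma ncB x y : nc (x - y) <= nc x + nc y. Proof. by rewrite -(ncN y) ncD. Qed.
Lemma ncB_ge x y : nc x - nc y <= nc (x - y).
Proof. by rewrite lerBlDr -{1}(subrK y x) ncD. Qed.
Lemma ncD_ge x y : nc x - nc y <= nc (x + y).
Proof. by rewrite -(ncN y) -{2}(opprK y) ncB_ge. Qed.
Lemma ncX x n : nc (x ^+ n) = nc x ^+ n.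
Proof. by elim: n => [|n IH]; rewrite ?expr0 ?normc1 // !exprS normcM IH. Qed.
Lemma ncC (a : R) : nc a%:C%C = `|a|.
Proof. by rewrite /= expr0n /= addr0 sqrtr_sqr. Qed.
Lemma nc_nat n : nc n%:R = n%:R :> R.
Proof. by rewrite -(rmorph_nat (real_complex R)) ncC normr_nat. Qed.
Lemma nc_sum n (F : 'I_n -> C) : nc (\sum_(i < n) F i) <= \sum_(i < n) nc (F i).
Proof.
elim/big_ind2: _ => [|a b c d h1 h2|//]; first by rewrite normc0.
by apply: le_trans (ncD _ _) _; apply: lerD.
Qed.

Lemma poly_upper (p : {poly C}) k : (size p <= k.+1)%N ->
  exists2 K, 1 <= K & forall y, 1 <= nc y -> nc p.[y] <= K * nc y ^+ k.
Proof.
move=> sp; exists (1 + \sum_(i < k.+1) nc p`_i); first by rewrite lerDl sumr_ge0 // => i _; exact: nc_ge0.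
move=> y y1; rewrite (horner_coef_wide _ sp); apply: le_trans (nc_sum _) _.
apply: (@le_trans _ _ ((\sum_(i < k.+1) nc p`_i) * nc y ^+ k)); last first.
  by rewrite ler_wpM2r ?exprn_ge0 ?nc_ge0 // lerDr.
rewrite mulr_suml; apply: ler_sum => i _; rewrite normcM ncX ler_wpM2l ?nc_ge0 //.
by apply: ler_weXn2l => //; rewrite -ltnS.
Qed.

Lemma poly_lower (p : {poly C}) k : size p = k.+1 ->
  exists c r, [/\ 0 < c, 1 <= r & forall y, r <= nc y -> c * nc y ^+ k <= nc p.[y]].
Proof.
case: k => [|k] sp.
  have p0 : p`_0 != 0 by rewrite -[0%N]/(1.-1) -sp lead_coef_eq0 -size_poly_gt0 sp.
  exists (nc p`_0), 1; split=> // [|y _]; first by rewrite nc_gt0.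
  by rewrite (size1_polyC (eq_leq sp)) hornerC coefC eqxx expr0 mulr1.
pose a := p`_k.+1; pose q := p - a *: 'X^(k.+1).
have a0 : 0 < nc a by rewrite nc_gt0 /a -[k.+1]/(k.+2.-1) -sp lead_coef_eq0 -size_poly_gt0 sp.
have sq : (size q <= k.+1)%N.
  apply/leq_sizeP => j; rewrite leq_eqVlt => /orP[/eqP<-|lt].
    by rewrite coefB coefZ coefXn eqxx mulr1 subrr.
  by rewrite coefB coefZ coefXn gtn_eqF // mulr0 subr0 nth_default // sp.
have [K K1 hK] := poly_upper sq.
exists (nc a / 2), (1 + 2 * K / nc a); split=> [||y ry]; first by rewrite divr_gt0.
  by rewrite lerDl divr_ge0 ?mulr_ge0 ?ltW // (lt_le_trans ltr01).
have K0 : 0 < K by apply: lt_le_trans K1.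
have y1 : 1 <= nc y by apply: le_trans ry; rewrite lerDl divr_ge0 ?mulr_ge0 ?ltW.
have -> : p.[y] = a * y ^+ k.+1 + q.[y] by rewrite /q !hE; ring.
apply: le_trans (ncD_ge _ _); rewrite normcM ncX.
have h := hK y y1; have : 2 * K <= nc a * nc y.
  rewrite [leRHS]mulrC -ler_pdivrMr //; apply: le_trans ry; lra.
have yk : 0 <= nc y ^+ k by rewrite exprn_ge0 ?nc_ge0.
move=> /(ler_wpM2r yk); rewrite !exprS; lra.
Qed.

Definition inV (r : R) z := (r <= nc z.2) && (nc z.1 <= nc z.2).

Lemma inV_le r r' z : r <= r' -> inV r' z -> inV r z.
Proof. by move=> le /andP[h1 h2]; rewrite /inV h2 (le_trans le). Qed.

(* F behaves on the region |y| >= r, |x| <= |y| like (x, y) |-> y^D in its second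
   coordinate, with tangent map DF; the last two bounds say that the logarithmic
   derivative eta / y is multiplied by D up to a relative error O(1/y). *)
Definition expanding (D : nat) (F : C * C -> C * C) (DF : C * C -> C * C -> C * C) :=
  exists K r : R, [/\ 1 <= K, 1 <= r & forall z, inV r z ->
   [/\ nc (F z).1 <= nc (F z).2, nc z.2 <= nc (F z).2,
       nc z.2 ^+ D <= K * nc (F z).2, nc (F z).2 <= K * nc z.2 ^+ D &
       forall v,
         nc ((DF z v).2 * z.2 - D%:R * (F z).2 * v.2) * nc z.2
            <= K * nc (F z).2 * (nc v.1 + nc v.2) /\
         nc (DF z v).1 * nc z.2 ^+ 2 <= K * nc (F z).2 * (nc v.1 + nc v.2)]].

(** The source of the [O(1/y)] gain: [p' / p] is [deg p / y] up to a term of lower order. *)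
Lemma leading_cancel (p : {poly C}) k : size p = k.+2 ->
  (size ('X * p^`() - k.+1%:R *: p)%R <= k.+1)%N.
Proof.
move=> sp; apply/leq_sizeP => j; rewrite leq_eqVlt => /orP[/eqP<-|lt].
  by rewrite coefB coefXM /= coefZ coef_deriv mulr_natl subrr.
rewrite coefB coefXM coefZ coef_deriv gtn_eqF ?(ltn_trans _ lt) //.
by case: j lt => // j lt /=; rewrite nth_default ?sp // mul0rn mulr0 subrr.
Qed.

(** In [y' = a x + p(y)] the term [p(y)] dominates. The defect of the logarithmic derivative is [a
    xi y + (y p'(y) - D p(y)) eta - D a x eta], which is [O(|y|^(D-1))] times the vector since the
    leading terms cancel. *)
Lemma expanding_step l : hyper l -> expanding (size (lp l)).-1 (step l) (tstep l).
Proof.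
case: l => p a b c /andP[_ /=] sp.
have [k sk] : exists k, size p = k.+3.
  by exists (size p - 3)%N; move: sp; case: (size p) => [|[|[|n]]] //; rewrite !subSS subn0.
rewrite sk /=.
have [c0 [r0 [c0_gt0 r01 low]]] := poly_lower sk.
have [K0 K01 up] := poly_upper (eq_leq sk).
have [K1 K11 up1] := poly_upper (leading_cancel sk).
have a0 := nc_ge0 a; have b0 := nc_ge0 b; have cc0 := nc_ge0 c.
pose c1 := c0 / 2; have c1_gt0 : 0 < c1 by rewrite divr_gt0.
(* For [|y| >= r] the terms of degree at most one are dominated by [c1 |y|^2]; as [c0 = 2 c1], the
   bound [c1 |y|^D] remains for [y']. *)
pose r := r0 + 1 / c1 * (nc a + nc b + nc c + 1).
have r1 : 1 <= r by apply: le_trans r01 _; rewrite lerDl mulr_ge0 ?divr_ge0 ?addr_ge0 // ltW.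
pose K := K0 + nc a + (1 + nc b + nc a + K1 + k.+2%:R * nc a) / c1.
have KX : [/\ 1 <= K, K0 + nc a <= K, 1 / c1 <= K, nc b / c1 <= K & (nc a + K1 + k.+2%:R * nc a) / c1 <= K].
  have k0 : 0 <= k.+2%:R * nc a by rewrite mulr_ge0.
  have i0 : 0 <= 1 / c1 by rewrite divr_ge0 // ltW.
  have i1 : 0 <= nc b / c1 by rewrite divr_ge0 // ltW.
  have i2 : 0 <= (nc a + K1 + k.+2%:R * nc a) / c1 by rewrite divr_ge0 ?ltW //; lra.
  have -> : K = K0 + nc a + (1 / c1 + nc b / c1 + (nc a + K1 + k.+2%:R * nc a) / c1).
    by rewrite /K; field; rewrite gt_eqF.
  by split; lra.
have [Kge1 KX1 KX2 KX3 KX4] := KX.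
exists K, r; split=> // -[x y] /andP[/= ry xy].
have y1 : 1 <= nc y by apply: le_trans ry.
have y0 : 0 < nc y by apply: lt_le_trans y1.
have yr0 : r0 <= nc y.
  by apply: le_trans ry; rewrite lerDl mulr_ge0 ?divr_ge0 ?addr_ge0 // ltW.
have cy : nc a + nc b + nc c + 1 <= c1 * nc y.
  rewrite mulrC -ler_pdivrMr //; apply: le_trans ry.
  by rewrite /r mul1r mulrC lerDr (le_trans _ r01).
have Y2 : nc y ^+ 2 <= nc y ^+ k.+2 by apply: ler_weXn2l.
have Y0 : 0 <= nc y ^+ k.+2 by rewrite exprn_ge0 ?nc_ge0.
have YS : nc y ^+ k.+2 = nc y * nc y ^+ k.+1 by rewrite exprS.
have Yk1 : 0 <= nc y ^+ k.+1 by rewrite exprn_ge0 ?nc_ge0.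
have yYk : nc y <= nc y ^+ k.+1 by apply: ler_eXnr.
have ax : nc (a * x) <= nc a * nc y by rewrite normcM ler_wpM2l.
have cyY : (nc a + nc b + nc c + 1) * nc y <= c1 * nc y ^+ k.+2.
  rewrite YS mulrA; apply: ler_pM => //; rewrite ?addr_ge0 ?nc_ge0 //.
have c1c : c0 = c1 + c1 by rewrite /c1; field.
rewrite /step /tri /swap /tstep /=.
set y' := a * x + p.[y].
have by0 : 0 <= nc b * nc y by rewrite mulr_ge0 ?nc_ge0.
have ay0 : 0 <= nc a * nc y by rewrite mulr_ge0 ?nc_ge0.
have cy0 : 0 <= nc c * nc y by rewrite mulr_ge0 ?nc_ge0.
have y'low : c1 * nc y ^+ k.+2 <= nc y'.
  have h2 : nc p.[y] - nc (a * x) <= nc y' by rewrite /y' (addrC (a * x)) ncD_ge.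
  have := low y yr0; rewrite c1c => h1; have ny := nc_ge0 y.
  by move: cyY; rewrite !mulrDl mul1r; lra.
have y'up : nc y' <= (K0 + nc a) * nc y ^+ k.+2.
  have h1 := up y y1; have h2 := ncD (a * x) p.[y]; rewrite -/y' in h2.
  have h3 : nc a * nc y <= nc a * nc y ^+ k.+2 by rewrite ler_wpM2l // ler_eXnr.
  lra.
have y'0 := nc_ge0 y'.
have sc : nc y ^+ k.+2 <= nc y' / c1 by rewrite ler_pdivlMr // mulrC.
split.
- apply: le_trans y'low; apply: le_trans cyY.
  have := ncD (b * y) c; rewrite normcM => h.
  have : nc c <= nc c * nc y by rewrite ler_peMr.
  by rewrite !mulrDl mul1r; lra.
- by apply: le_trans y'low; apply: le_trans cyY; rewrite !mulrDl mul1r; lra.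
- by apply: le_trans sc _; rewrite mulrC -[c1^-1]mul1r ler_wpM2r.
- by apply: le_trans y'up _; rewrite ler_wpM2r.
move=> [xi eta] /=.
have S0 := addr_ge0 (nc_ge0 xi) (nc_ge0 eta).
set S := nc xi + nc eta in S0 *.
have xiS : nc xi <= S by rewrite lerDl nc_ge0.
have etaS : nc eta <= S by rewrite lerDr nc_ge0.
split; last first.
  rewrite normcM -mulrA [nc eta * _]mulrC mulrA.
  apply: (@le_trans _ _ (nc b * (nc y' / c1) * S)).
    rewrite ler_pM ?mulr_ge0 ?exprn_ge0 ?nc_ge0 // ler_wpM2l //.
    exact: le_trans Y2 sc.
  by rewrite ler_wpM2r // mulrCA [in leRHS]mulrC ler_wpM2l.
have -> : (a * xi + p^`().[y] * eta) * y - k.+2%:R * y' * eta =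
   a * xi * y + ('X * p^`() - k.+2%:R *: p).[y] * eta - k.+2%:R * (a * x) * eta.
  by rewrite /y' !hE; ring.
have h1 := up1 y y1.
apply: (@le_trans _ _ ((nc a + K1 + k.+2%:R * nc a) * nc y ^+ k.+2 * S)); last first.
  apply: (@le_trans _ _ ((nc a + K1 + k.+2%:R * nc a) * (nc y' / c1) * S)).
    by rewrite ler_wpM2r // ler_wpM2l // !addr_ge0 ?mulr_ge0 // (le_trans ler01).
  by rewrite ler_wpM2r // mulrCA mulrC ler_wpM2r.
have t1 : nc (a * xi * y) <= nc a * nc y ^+ k.+1 * S.
  rewrite !normcM -!mulrA ler_wpM2l // mulrC ler_pM ?nc_ge0 //.
have t2 : nc (('X * p^`() - k.+2%:R *: p).[y] * eta) <= K1 * nc y ^+ k.+1 * S.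
  by rewrite normcM ler_pM ?nc_ge0.
have t3 : nc (k.+2%:R * (a * x) * eta) <= k.+2%:R * nc a * nc y ^+ k.+1 * S.
  rewrite normcM ler_pM ?nc_ge0 // normcM nc_nat -mulrA ler_wpM2l //.
  by apply: le_trans ax _; rewrite ler_wpM2l.
apply: (@le_trans _ _ ((nc a * nc y ^+ k.+1 * S + K1 * nc y ^+ k.+1 * S
    + k.+2%:R * nc a * nc y ^+ k.+1 * S) * nc y)).
  rewrite ler_wpM2r ?nc_ge0 //; apply: le_trans (ncB _ _) _; apply: lerD => //.
  by apply: le_trans (ncD _ _) _; apply: lerD.
by rewrite YS le_eqVlt; apply/orP; left; apply/eqP; ring.
Qed.

(** Multiplied by [y'], the defect of the composite is [y] times the second defect plus [D2 y'']
    times the first. The second is controlled by [|w| / |y'|], where [w] is the transported vector,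
    and [Sw] turns this into [|v| / |y|]. *)
Lemma expanding_comp D1 D2 F1 DF1 F2 DF2 : expanding D1 F1 DF1 -> expanding D2 F2 DF2 ->
  expanding (D1 * D2) (F2 \o F1) (fun z v => DF2 (F1 z) (DF1 z v)).
Proof.
move=> [K1 [r1 [K11 r11 h1]]] [K2 [r2 [K21 r21 h2]]].
have d1 : 0 <= D1%:R :> R by []. have d2 : 0 <= D2%:R :> R by [].
pose K' := 2 * K1 + D1%:R.
pose K := K2 * K' + D2%:R * K1 + K1 ^+ D2 * K2 + K2 * K'.
have K1_0 : 0 <= K1 by apply: le_trans K11.
have K2_0 : 0 <= K2 by apply: le_trans K21.
have K'0 : 0 <= K' by rewrite addr_ge0 ?mulr_ge0.
have e1 : 0 <= K2 * K' by rewrite mulr_ge0.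
have e2 : 0 <= D2%:R * K1 by rewrite mulr_ge0.
have e3 : 1 <= K1 ^+ D2 * K2 by rewrite -[1]mulr1 ler_pM ?exprn_ege1.
exists K, (r1 + r2); split; first by rewrite /K; lra.
  by lra.
move=> z zV.
have z1 : inV r1 z by apply: inV_le zV; lra.
have z2 : inV r2 z by apply: inV_le zV; lra.
have [a1 a2 a3 a4 a5] := h1 z z1.
have fz : inV r2 (F1 z).
  by rewrite /inV a1 andbT (le_trans _ a2) //; case/andP: z2.
have [b1 b2 b3 b4 b5] := h2 _ fz.
have y0 : 0 < nc z.2 by case/andP: z1 => h _; apply: lt_le_trans h; apply: lt_le_trans r11.
have y'0 : 0 < nc (F1 z).2 by apply: lt_le_trans a2.
have y''0 := nc_ge0 (F2 (F1 z)).2.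
split=> //=.
- exact: le_trans b2.
- rewrite exprM; apply: (@le_trans _ _ ((K1 * nc (F1 z).2) ^+ D2)).
    by apply: lerXn2r => //; rewrite nnegrE ?mulr_ge0 ?exprn_ge0 ?nc_ge0.
  rewrite exprMn; apply: (@le_trans _ _ (K1 ^+ D2 * (K2 * nc (F2 (F1 z)).2))).
    by rewrite ler_wpM2l // exprn_ge0.
  by rewrite mulrA ler_wpM2r // /K; lra.
- apply: le_trans b4 _; rewrite exprM.
  apply: (@le_trans _ _ (K2 * (K1 * nc z.2 ^+ D1) ^+ D2)).
    rewrite ler_wpM2l //; apply: lerXn2r => //; rewrite nnegrE ?mulr_ge0 ?exprn_ge0 ?nc_ge0 //.
  rewrite exprMn mulrA [K2 * _]mulrC ler_wpM2r ?exprn_ge0 ?nc_ge0 // /K; lra.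
move=> v; have [c1 c2] := a5 v; have [d3 d4] := b5 (DF1 z v).
set w := DF1 z v in c1 c2 d3 d4 *.
set y := z.2 in y0 a2 a3 a4 c1 c2 *; set y' := (F1 z).2 in y'0 a1 a2 a3 a4 b2 b3 b4 c1 c2 d3 d4 *.
set y'' := (F2 (F1 z)).2 in y''0 b1 b2 b3 b4 d3 d4 *.
set S := nc v.1 + nc v.2 in c1 c2 *.
have S0 : 0 <= S by rewrite addr_ge0 ?nc_ge0.
have y''' : 0 < nc y'' by apply: lt_le_trans b2.
have Sw : (nc w.1 + nc w.2) * nc y <= K' * nc y' * S.
  have q1 : nc w.1 * nc y <= K1 * nc y' * S.
    rewrite -(ler_pM2r y0) -[leLHS]mulrA -expr2; apply: le_trans c2 _.
    rewrite ler_peMr ?mulr_ge0 ?(ltW y'0) //; case/andP: z1 => h _; exact: le_trans h.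
  have q2 : nc w.2 * nc y <= (K1 + D1%:R) * nc y' * S.
    have h : nc (w.2 * y) <= nc (w.2 * y - D1%:R * y' * v.2) + nc (D1%:R * y' * v.2).
      by apply: le_trans (ncD _ _); rewrite subrK.
    have h3 : nc (w.2 * y - D1%:R * y' * v.2) <= K1 * nc y' * S.
      rewrite -(ler_pM2r y0); apply: le_trans c1 _.
      by rewrite ler_peMr ?mulr_ge0 ?(ltW y'0) //; case/andP: z1 => h' _; exact: le_trans h'.
    have h4 : nc (D1%:R * y' * v.2) <= D1%:R * nc y' * S.
      by rewrite !normcM nc_nat ler_wpM2l ?mulr_ge0 ?(ltW y'0) // lerDr nc_ge0.
    by rewrite normcM in h; rewrite !mulrDl; lra.
  by rewrite /K' mulrDl !mulrDl in q2 *; lra.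
have Sw' : (nc w.1 + nc w.2) / nc y' <= K' * S / nc y.
  by rewrite ler_pdivrMr // mulrAC ler_pdivlMr // mulrAC.
have w0 : 0 <= nc w.1 + nc w.2 by rewrite addr_ge0 ?nc_ge0.
split; last first.
  have h : nc (DF2 (F1 z) w).1 * nc y' ^+ 2 * nc y <= K2 * K' * nc y'' * S * nc y'.
    apply: (@le_trans _ _ (K2 * nc y'' * ((nc w.1 + nc w.2) * nc y))).
      by rewrite [leRHS]mulrA ler_wpM2r // ltW.
    rewrite [leRHS](_ : _ = K2 * nc y'' * (K' * nc y' * S)); last by ring.
    by rewrite ler_wpM2l ?mulr_ge0.
  have h' : nc (DF2 (F1 z) w).1 * nc y' * nc y <= K2 * K' * nc y'' * S.
    by rewrite -(ler_pM2r y'0); apply: le_trans h; rewrite expr2 le_eqVlt; apply/orP; left; apply/eqP; ring.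
  apply: (@le_trans _ _ (K2 * K' * nc y'' * S)).
    apply: le_trans h'; rewrite expr2 -mulrA ler_wpM2l ?nc_ge0 // ler_wpM2r // ltW //.
  by rewrite ler_wpM2r // ler_wpM2r // /K; lra.
have id : ((DF2 (F1 z) w).2 * y - (D1 * D2)%:R * y'' * v.2) * y' =
   y * ((DF2 (F1 z) w).2 * y' - D2%:R * y'' * w.2) + D2%:R * y'' * (w.2 * y - D1%:R * y' * v.2).
  by rewrite natrM; ring.
have h : nc ((DF2 (F1 z) w).2 * y - (D1 * D2)%:R * y'' * v.2) * nc y' * nc y'
   <= (K2 * K' * nc y'' * S + D2%:R * K1 * nc y'' * S * (nc y' / nc y)) * nc y'.
  rewrite ler_pM2r // -normcM id; apply: le_trans (ncD _ _) _; apply: lerD.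
    rewrite normcM -(ler_pM2r y'0) -[leLHS]mulrA.
    apply: le_trans (ler_wpM2l (ltW y0) d3) _.
    rewrite [leLHS](_ : _ = K2 * nc y'' * ((nc w.1 + nc w.2) * nc y)); last by ring.
    rewrite [leRHS](_ : _ = K2 * nc y'' * (K' * nc y' * S)); last by ring.
    by rewrite ler_wpM2l ?mulr_ge0.
  rewrite normcM normcM nc_nat.
  have : nc (w.2 * y - D1%:R * y' * v.2) <= K1 * nc y' * S / nc y by rewrite ler_pdivlMr.
  move/(ler_wpM2l (mulr_ge0 d2 y''0)) => /le_trans; apply.
  by rewrite le_eqVlt; apply/orP; left; apply/eqP; ring.
have {}h : nc ((DF2 (F1 z) w).2 * y - (D1 * D2)%:R * y'' * v.2) * nc y'
   <= K2 * K' * nc y'' * S + D2%:R * K1 * nc y'' * S * (nc y' / nc y).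
  by rewrite ler_pM2r in h.
have {}h : nc ((DF2 (F1 z) w).2 * y - (D1 * D2)%:R * y'' * v.2) * nc y * nc y'
   <= (K2 * K' + D2%:R * K1) * nc y'' * S * nc y'.
  rewrite mulrAC; apply: le_trans (ler_wpM2r (ltW y0) h) _.
  have -> : (K2 * K' * nc y'' * S + D2%:R * K1 * nc y'' * S * (nc y' / nc y)) * nc y
    = K2 * K' * nc y'' * S * nc y + D2%:R * K1 * nc y'' * S * nc y'.
    by field; rewrite gt_eqF.
  rewrite !mulrDl lerD2r ler_wpM2l // !mulr_ge0 //.
apply: (@le_trans _ _ ((K2 * K' + D2%:R * K1) * nc y'' * S)).
  by rewrite ler_pM2r in h.
by rewrite ler_wpM2r // ler_wpM2r // /K; lra.
Qed.

End Estimates.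

(** * Growth of words far out in the plane *)

Section Words.
Variable R : realType.
Local Notation C := R[i].
Local Notation nc := (@normc R).
Local Notation letter := (letter R[i]).
Implicit Types (x y : C) (z v : C * C) (l e : letter) (w : seq letter).

(** The algebraic degree when all letters are hyper; otherwise only a formal product. *)
Fixpoint wdeg w := if w is l :: w' then ((size (lp l)).-1 * wdeg w')%N else 1%N.

Lemma wdeg_cat w1 w2 : wdeg (w1 ++ w2) = (wdeg w1 * wdeg w2)%N.
Proof. by elim: w1 => [|l w1 IH] /=; rewrite ?mul1n // IH mulnA. Qed.

Lemma expanding_run w : all (@hyper _) w -> (0 < size w)%N ->
  expanding (wdeg w) (run w) (trun w).
Proof.
elim: w => // l [|l' w] IH /andP[hl hw] _; first by rewrite /= muln1; apply: expanding_step.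
by have := expanding_comp (expanding_step hl) (IH hw isT).
Qed.

Lemma wdeg_gt1 w : all (@hyper _) w -> (0 < size w)%N -> (1 < wdeg w)%N.
Proof.
elim: w => // l w IH /= /andP[/andP[_ hl] hw] _.
have l1 : (1 < (size (lp l)).-1)%N by case: (size (lp l)) hl => [|[|]].
case: w IH hw => [|l' w] IH hw; first by rewrite muln1.
by have := IH hw isT; move: (wdeg _) l1 => a; case: (_.-1) => [|[|b]] //; nia.
Qed.

Definition nc2 z := nc z.1 + nc z.2.

Lemma nc2_ge0 z : 0 <= nc2 z. Proof. by rewrite addr_ge0 ?nc_ge0. Qed.

(** Controls the norm alone, for maps that need not send the region into itself, such as the
    conjugation that follows the last iterate. *)
Definition monomial_growth (c : nat) (F : C * C -> C * C) :=
  exists K r : R, [/\ 1 <= K, 1 <= r & forall z, inV r z ->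
    nc z.2 ^+ c <= K * nc2 (F z) /\ nc2 (F z) <= K * nc z.2 ^+ c].

Lemma monomial_growth_ext c F G : F =1 G -> monomial_growth c F -> monomial_growth c G.
Proof.
by move=> e [K [r [K1 r1 h]]]; exists K, r; split=> // z; rewrite -e; apply: h.
Qed.

Lemma monomial_growth_comp c D F G DG : monomial_growth c F -> expanding D G DG ->
  monomial_growth (D * c) (F \o G).
Proof.
move=> [K1 [r1 [K11 r11 h1]]] [K2 [r2 [K21 r21 h2]]].
have K1_0 : 0 <= K1 by apply: le_trans K11.
have K2_0 : 0 <= K2 by apply: le_trans K21.
have E1 : 1 <= K2 ^+ c by apply: exprn_ege1.
exists (K1 * K2 ^+ c), (r1 + r2); split; first by rewrite -[1]mulr1 ler_pM.
  by lra.
move=> z zV.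
have z1 : inV r1 z by apply: inV_le zV; lra.
have z2 : inV r2 z by apply: inV_le zV; lra.
have [a1 a2 a3 a4 _] := h2 z z2.
have fz : inV r1 (G z) by rewrite /inV a1 andbT (le_trans _ a2) //; case/andP: z1.
have [b1 b2] := h1 _ fz; rewrite exprM; split.
  apply: (@le_trans _ _ ((K2 * nc (G z).2) ^+ c)).
    by apply: lerXn2r => //; rewrite nnegrE ?mulr_ge0 ?exprn_ge0 ?nc_ge0.
  by rewrite exprMn [K1 * _]mulrC -mulrA ler_wpM2l // exprn_ge0.
apply: le_trans b2 _; rewrite -mulrA ler_wpM2l // -exprMn.
by apply: lerXn2r => //; rewrite nnegrE ?mulr_ge0 ?exprn_ge0 ?nc_ge0.
Qed.

(** A hyper letter has the same two coordinates as [step e]. Otherwise the map is affine, and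
    [lb e * y + lc e] alone already has the size of [y]. *)
Lemma monomial_growth_tri e : lok e -> exists2 c, (0 < c)%N & monomial_growth c (tri e).
Proof.
move=> eo; have [a0 b0] := andP eo.
have [he|] := boolP (hyper e).
  have [K [r [K1 r1 h]]] := expanding_step he.
  exists (size (lp e)).-1; first by case/andP: he => _; case: (size _) => [|[]].
  exists (2 * K), r; split=> //; first by lra.
  move=> z zV; have [h1 _ h3 h4 _] := h z zV.
  have n0 := nc_ge0 (step e z).1; have n1 := nc_ge0 (step e z).2.
  have K0 : 0 <= K by lra.
  have -> : nc2 (tri e z) = nc (step e z).1 + nc (step e z).2 by rewrite /nc2 addrC.
  split; last by lra.
  apply: le_trans h3 _; rewrite -mulrA.
  have : 0 <= K * nc (step e z).1 by rewrite mulr_ge0.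
  have : 0 <= K * nc (step e z).2 by rewrite mulr_ge0.
  by rewrite mulrDr; lra.
rewrite /hyper eo /= -leqNgt => se; exists 1%N => //.
pose K := 1 + 2 / nc (lb e) + nc (la e) + nc (lp e)`_1 + nc (lp e)`_0 + nc (lb e) + nc (lc e).
have b1 : 0 < nc (lb e) by rewrite nc_gt0.
have A0 := nc_ge0 (la e); have A1 := nc_ge0 (lp e)`_1; have A2 := nc_ge0 (lp e)`_0.
have A3 := nc_ge0 (lc e).
have A4 : 0 <= 2 / nc (lb e) by rewrite divr_ge0 // ltW.
exists K, (1 + 2 * nc (lc e) / nc (lb e)); split; first by rewrite /K; lra.
  by rewrite lerDl divr_ge0 ?mulr_ge0 // ltW.
move=> [x y] /andP[/= ry xy]; rewrite expr1 /tri /nc2 /= size2_horner //.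
have y1 : 1 <= nc y by apply: le_trans ry; rewrite lerDl divr_ge0 ?mulr_ge0 // ltW.
have y0 : 0 <= nc y by rewrite nc_ge0.
split.
  have h1 : 2 * nc (lc e) <= nc (lb e) * nc y.
    rewrite [leRHS]mulrC -ler_pdivrMr //; apply: le_trans ry; lra.
  have h2 := ncD_ge (lb e * y) (lc e); rewrite normcM in h2.
  have h3 := nc_ge0 (la e * x + ((lp e)`_1 * y + (lp e)`_0)).
  set u := nc (_ + (_ + _)) in h3 *; set v := nc (lb e * y + _) in h2 *.
  apply: (@le_trans _ _ (2 / nc (lb e) * (u + v))).
    by rewrite mulrAC ler_pdivlMr // mulrC; lra.
  apply: ler_wpM2r; last by rewrite /K; lra.
  by rewrite addr_ge0 ?nc_ge0.
have t1 : nc (la e * x) <= nc (la e) * nc y by rewrite normcM ler_wpM2l.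
have t2 : nc ((lp e)`_1 * y + (lp e)`_0) <= nc (lp e)`_1 * nc y + nc (lp e)`_0 * nc y.
  by apply: le_trans (ncD _ _) _; rewrite normcM lerD2l ler_peMr.
have t3 : nc (lb e * y + lc e) <= nc (lb e) * nc y + nc (lc e) * nc y.
  by apply: le_trans (ncD _ _) _; rewrite normcM lerD2l ler_peMr.
have t4 := ncD (la e * x) ((lp e)`_1 * y + (lp e)`_0).
have t5 : 0 <= 2 / nc (lb e) * nc y by rewrite mulr_ge0.
by rewrite /K !mulrDl mul1r; lra.
Qed.

(* Each letter of psi either blocks against the hyperbolic word om or cancels part
   of its last letter, which shortens psi; so psi is absorbed when om is long. *)
Lemma monomial_growth_tail psi e om : all (@lok _) psi -> lok e -> all (@hyper _) om ->
  (size psi <= size om)%N ->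
  exists2 c, (0 < c)%N & monomial_growth c (fun z => run psi (tri e (run om z))).
Proof.
elim: psi e om => [|l psi IH] e om.
  move=> _ eo; case: om => [|a om] ho _.
    by have [c c0 h] := monomial_growth_tri eo; exists c.
  have [c c0 h] := monomial_growth_tri eo.
  exists (wdeg (a :: om) * c)%N; last exact: (monomial_growth_comp h (expanding_run ho isT)).
  by rewrite muln_gt0 c0 andbT ltnW // wdeg_gt1.
move=> /= /andP[lo po] eo.
case: (lastP om) => // om' a; rewrite all_rcons size_rcons ltnS => /andP[ha ho] sz.
have ao := hyper_lok ha; pose g := tmul l e; have go : lok g by apply: lok_tmul.
(* A hyper product joins the word, and the triangular map left over is the identity. *)
have [hg|ng] := boolP (hyper g).
  have [||c c0 h] := IH (lid _) (rcons (rcons om' a) g) po (lok_lid _).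
  - by rewrite !all_rcons hg ha.
  - by rewrite !size_rcons; apply: leq_trans sz _; rewrite ltnW // ltnW.
  exists c => //; apply: monomial_growth_ext h => z /=.
  by rewrite tri_lid -[rcons (rcons om' a) g]cats1 run_cat /= /step triM.
have sg : (size (lp g) <= 2)%N by move: ng; rewrite /hyper go /= -leqNgt.
have runa z : run (rcons om' a) z = swap (tri a (run om' z)) by rewrite -cats1 run_cat.
(* The affine [g] meets the swap of [a]: either [a] is swallowed by a triangular map, or it survives
   as [tmul U2 a] with [U1] left over. So a letter of [psi] costs at most one letter of [om]. *)
have [[D Do eD]|[U1 [U2 [U1o U2o sU eU]]]] := swap_tri_swap go sg.
  have [c c0 h] := IH (tmul D a) om' po (lok_tmul Do ao) ho sz.
  exists c => //; apply: monomial_growth_ext h => z.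
  by rewrite runa /step -triM eD triM.
have [||c c0 h] := IH U1 (rcons om' (tmul U2 a)) po U1o.
- by rewrite all_rcons ho hyper_tmul.
- by rewrite size_rcons ltnW.
exists c => //; apply: monomial_growth_ext h => z.
by rewrite runa /step -triM eU -cats1 run_cat /= /step triM.
Qed.

End Words.

(** * Degrees and the dynamical degree *)

Local Arguments normc {R} x : simpl never.

Section Growth.
Variable R : realType.
Local Notation C := R[i].
Local Notation nc := (@normc R).
Local Notation letter := (letter R[i]).
Local Notation MP := (mpoly 2 R[i]).
Implicit Types (x y : C) (z v : C * C) (l e : letter) (w : seq letter).

(** A bound on the degree that also makes sense for words, whose coordinates are not given as
    polynomials in two variables. *)
Definition bounded_growth (k : nat) (F : C * C -> C * C) :=
  exists2 K : R, 0 <= K & forall z, nc2 (F z) <= K * (1 + nc2 z) ^+ k.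

Lemma bounded_growth_comp a b F G : bounded_growth a F -> bounded_growth b G ->
  bounded_growth (a * b) (F \o G).
Proof.
move=> [K1 K10 h1] [K2 K20 h2]; exists (K1 * (1 + K2) ^+ a).
  by rewrite mulr_ge0 // exprn_ge0 // addr_ge0.
move=> z; apply: le_trans (h1 _) _; rewrite -mulrA ler_wpM2l // mulnC exprM -exprMn.
have n0 := nc2_ge0 z; have n1 := nc2_ge0 (G z).
have p1 : 1 <= (1 + nc2 z) ^+ b by rewrite exprn_ege1 // lerDl.
have c : 1 + nc2 (G z) <= (1 + K2) * (1 + nc2 z) ^+ b.
  by have := h2 z; rewrite mulrDl mul1r; lra.
by apply: (lerXn2r _ _ _ c); rewrite nnegrE; [|apply: le_trans c]; lra.
Qed.

Lemma bounded_growth_ext k F G : F =1 G -> bounded_growth k F -> bounded_growth k G.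
Proof. by move=> e [K K0 h]; exists K => // z; rewrite -e. Qed.

Lemma bounded_growth_tri e k : (size (lp e) <= k.+1)%N -> (0 < k)%N -> bounded_growth k (tri e).
Proof.
move=> se k0; pose s := \sum_(i < k.+1) nc (lp e)`_i.
have s0 : 0 <= s by rewrite sumr_ge0 // => i _; apply: nc_ge0.
have A0 := nc_ge0 (la e); have A1 := nc_ge0 (lb e); have A2 := nc_ge0 (lc e).
exists (nc (la e) + s + nc (lb e) + nc (lc e)); first by rewrite !addr_ge0.
case=> x y; rewrite /nc2 /tri /=; have x0 := nc_ge0 x; have y0 := nc_ge0 y.
set N := 1 + (nc x + nc y); have N1 : 1 <= N by rewrite /N; lra.
have NN : N <= N ^+ k by apply: ler_eXnr.
have N11 : 1 <= N ^+ k by apply: exprn_ege1.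
have hp : nc (lp e).[y] <= s * N ^+ k.
  rewrite (horner_coef_wide _ se); apply: le_trans (nc_sum _) _; rewrite mulr_suml.
  apply: ler_sum => i _; rewrite normcM ncX ler_wpM2l ?nc_ge0 //.
  apply: (@le_trans _ _ (N ^+ i)); last by apply: ler_weXn2l => //; rewrite -ltnS.
  by apply: lerXn2r; rewrite ?nnegrE //; rewrite /N; lra.
have t1 := ncD (la e * x) (lp e).[y]; have t2 := ncD (lb e * y) (lc e).
rewrite !normcM in t1 t2.
have t3 : nc (la e) * nc x <= nc (la e) * N ^+ k by rewrite ler_wpM2l // (le_trans _ NN) // /N; lra.
have t4 : nc (lb e) * nc y <= nc (lb e) * N ^+ k by rewrite ler_wpM2l // (le_trans _ NN) // /N; lra.
have t5 : nc (lc e) <= nc (lc e) * N ^+ k by rewrite ler_peMr.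
by rewrite !mulrDl; lra.
Qed.

Lemma nc2_swap z : nc2 (swap z) = nc2 z. Proof. by rewrite /nc2 addrC. Qed.

Lemma bounded_growth_step e k : (size (lp e) <= k.+1)%N -> (0 < k)%N -> bounded_growth k (step e).
Proof.
by move=> s k0; have [K K0 h] := bounded_growth_tri s k0; exists K => // z; rewrite nc2_swap.
Qed.

Lemma bounded_growth_id : bounded_growth 1 id.
Proof. by exists 1 => // z; rewrite mul1r expr1 lerDr. Qed.

Lemma bounded_growth_word w : exists2 k, (0 < k)%N & bounded_growth k (run w).
Proof.
elim: w => [|l w [k k0 IH]]; first by exists 1%N => //; apply: bounded_growth_id.
have h : bounded_growth (size (lp l)).+1 (step l) by apply: bounded_growth_step; lia.
by exists (k * (size (lp l)).+1)%N; [rewrite muln_gt0 k0|exact: bounded_growth_comp IH h].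
Qed.

Lemma bounded_growth_hyper w : all (@hyper _) w -> bounded_growth (wdeg w) (run w).
Proof.
elim: w => [_|l w IH /= /andP[hl /IH h]]; first exact: bounded_growth_id.
rewrite mulnC; apply: (bounded_growth_comp h); apply: bounded_growth_step.
  by case: (size _).
by case/andP: hl => _; case: (size _) => [|[]].
Qed.

Lemma run_iter w n z : run (flatten (nseq n w)) z = iter n (run w) z.
Proof. by elim: n z => //= n IH z; rewrite run_cat IH -iterSr. Qed.

(** Iterates of a triangular map are triangular, and substituting an affine function of [y] does not
    raise the degree; so one exponent serves all iterates. *)
Lemma bounded_growth_tri_iter e : lok e ->
  exists2 k, (0 < k)%N & forall n, bounded_growth k (iter n (tri e)).
Proof.
move=> eo; exists (size (lp e)).+1 => // n.
suff [e' e'o [se' h]] : exists2 e', lok e' &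
    (size (lp e') <= (size (lp e)).+2)%N /\ forall z, iter n (tri e) z = tri e' z.
  by apply: bounded_growth_ext (bounded_growth_tri se' _) => // z; rewrite h.
elim: n => [|n [e' e'o [se' h]]].
  exists (lid _); first exact: lok_lid.
  by split=> [|z]; rewrite ?tri_lid // size_poly0.
exists (tmul e e'); first exact: lok_tmul.
split=> [|z]; last by rewrite iterS h triM.
apply: leq_trans (size_polyD _ _) _; rewrite geq_max (leq_trans (size_scale_leq _ _)) //=.
apply: leq_trans (size_comp_poly_leq _ _) _.
apply: (@leq_trans ((size (lp e)).-1 * 1).+1); last first.
  by rewrite muln1 ltnS (leq_trans (leq_pred _)).
by rewrite ltnS leq_mul // -subn1 leq_subLR size_lin.
Qed.

Lemma bounded_growth_affine_iter l n : (size (lp l) <= 2)%N -> bounded_growth 1 (iter n (step l)).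
Proof.
move=> sl; elim: n => [|n IH]; first exact: bounded_growth_id.
by apply: (bounded_growth_ext _ (bounded_growth_comp (bounded_growth_step sl _) IH)).
Qed.

Lemma growth_compare (a b : nat) (K r : R) :
  (forall t, r <= t -> t ^+ a <= K * (1 + t) ^+ b) -> (a <= b)%N.
Proof.
move=> h; rewrite leqNgt; apply/negP => ba.
have r0 := normr_ge0 r; have rr := ler_norm r.
have Kpos : 0 <= K.
  rewrite leNgt; apply/negP => Kn; have /h : r <= 1 + `|r| by lra.
  apply/negP; rewrite -ltNge; apply: (@lt_trans _ _ 0); last by rewrite exprn_gt0 //; lra.
  by rewrite nmulr_rlt0 // exprn_gt0 //; lra.
have K0 : 0 <= K * 2 ^+ b by rewrite mulr_ge0.
pose t := 1 + `|r| + K * 2 ^+ b.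
have rt : r <= t by rewrite /t; lra.
have t1 : 1 <= t by rewrite /t; lra.
have tK : K * 2 ^+ b < t by rewrite /t; lra.
have t0 : 0 < t by lra.
have := h t rt; apply/negP; rewrite -ltNge.
apply: (@le_lt_trans _ _ (K * (2 * t) ^+ b)).
  by rewrite ler_wpM2l //; apply: lerXn2r; rewrite ?nnegrE; lra.
rewrite exprMn mulrA; apply: (@lt_le_trans _ _ (t * t ^+ b)).
  by rewrite ltr_pM2r // exprn_gt0.
by rewrite -exprS; apply: ler_weXn2l.
Qed.

Lemma mdeg2 (m : multinom 2) : mdeg m = (m 0%R + m 1%R)%N.
Proof. by rewrite mdegE !big_ord_recl big_ord0 addn0; congr (_ + m _)%N; apply/val_inj. Qed.

Lemma meval_bound (P : MP) : exists2 K : R, 0 <= K & forall h : 'I_2 -> C,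
  nc (meval h P) <= K * (1 + (nc (h 0) + nc (h 1))) ^+ (mmeasure mdeg P).-1.
Proof.
exists (\sum_(m <- msupp P) nc (mcoeff m P)); first by rewrite sumr_ge0 // => i _; apply: nc_ge0.
move=> h; set N := 1 + _; have N1 : 1 <= N by rewrite lerDl addr_ge0 ?nc_ge0.
rewrite mevalE mulr_suml big_seq [leRHS]big_seq.
elim/big_ind2: _ => [|a b c d h1 h2|m mP]; first by rewrite normc0.
  by apply: le_trans (ncD _ _) _; apply: lerD.
rewrite normcM ler_wpM2l ?nc_ge0 //.
apply: (@le_trans _ _ (N ^+ mdeg m)); last first.
  by apply: ler_weXn2l => //; have := msize_mdeg_lt mP; case: (mmeasure _ _).
rewrite mdeg2 !big_ord_recl big_ord0 mulr1 normcM !ncX exprD.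
have -> : lift ord0 ord0 = 1 :> 'I_2 by apply/val_inj.
rewrite ler_pM ?exprn_ge0 ?nc_ge0 //; apply: lerXn2r; rewrite ?nnegrE ?nc_ge0 ?(le_trans ler01) //;
  have := nc_ge0 (h 0); have := nc_ge0 (h 1); rewrite /N; lra.
Qed.

(** A monomial is determined by its degree and its second exponent, so distinct monomials do not
    collide in the blow-up. *)
Lemma blowup_top (P : MP) m : m \in msupp P -> ((blowup P)`_(mdeg m))`_(m 1) = mcoeff m P.
Proof.
move=> mP; rewrite /blowup /mmap coef_sum coef_sum (bigD1_seq m) ?msupp_uniq //=.
have term m' : cc (mcoeff m' P) * mmap1 (pair2 'X (st C)) m' =
     (mcoeff m' P *: 'X^(m' 1))%:P * 'X^(mdeg m').
  rewrite /mmap1 !big_ord_recl big_ord0 mulr1 /pair2 /=.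
  have -> : lift ord0 ord0 = 1 :> 'I_2 by apply/val_inj.
  rewrite /st exprMn mdeg2 exprD -mul_polyC rmorphM /= rmorphXn /= /cc.
  by ring.
rewrite [X in _ + X]big1 ?addr0 => [|m' ne].
  by rewrite term coefCM coefXn eqxx mulr1 coefZ coefXn eqxx mulr1.
rewrite term coefCM coefXn; case: eqP => [e|_]; last by rewrite mulr0 coef0.
rewrite mulr1 coefZ coefXn; case: eqP => [e1|_]; last by rewrite mulr0.
case/eqP: ne; apply/mnmP => i; move: e; rewrite !mdeg2 e1 => /eqP; rewrite eqn_add2r => /eqP e0.
have : (i == 0) || (i == 1) by case: i => [[|[|]]].
by case/orP=> /eqP ->.
Qed.

(** Along a ray [(s, s t)], with [t] not a root of the top coefficient, the polynomial grows at
    least like [s] to the power of its degree. *)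
Lemma degree_le_growth (P : MP) k (K : R) :
  (forall h : 'I_2 -> C, nc (meval h P) <= K * (1 + (nc (h 0) + nc (h 1))) ^+ k) ->
  ((mmeasure mdeg P).-1 <= k)%N.
Proof.
move=> hK; have [->|P0] := eqVneq P 0; first by rewrite mmeasure0.
rewrite -(mlead_deg P0) /=; set m := mlead P.
have mP : m \in msupp P by apply: mlead_supp.
have c0 : (blowup P)`_(mdeg m) != 0.
  apply/eqP => e; have := blowup_top mP; rewrite e coef0 => /esym/eqP.
  by apply/negP; rewrite -mcoeff_msupp.
have [t ht] := nonroot c0.
pose q := map_poly (horner_eval t) (blowup P).
have qm : q`_(mdeg m) != 0 by rewrite coef_map.
have sq : (mdeg m < size q)%N.
  by rewrite ltnNge; apply/negP => le; rewrite nth_default ?eqxx in qm.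
have [D eD] : exists D, size q = D.+1 by exists (size q).-1; rewrite prednK // (leq_trans _ sq).
have [c [r [c_gt0 r1 low]]] := poly_lower eD.
apply: (@leq_trans D); first by rewrite -ltnS -eD.
pose T := 1 + nc t; have T1 : 1 <= T by rewrite lerDl nc_ge0.
apply: (@growth_compare D k (K * T ^+ k / c) (r)) => s rs.
have s0 : 0 <= s by lra.
have ns : nc s%:C%C = s by rewrite ncC ger0_norm.
have := low s%:C%C; rewrite ns => /(_ rs).
have -> : q.[s%:C%C] = meval (pair2 s%:C%C (s%:C%C * t)) P.
  by rewrite -evst_blowup /evst /q -[RHS]/(horner_eval t _) -horner_map /= [horner_eval t _]hornerC.
move=> /le_trans/(_ (hK _)); rewrite /pair2 /= normcM ns => h.
have K0 : 0 <= K.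
  have := hK (fun=> 0); rewrite normc0 !addr0 expr1n mulr1 => /(le_trans _); apply; exact: nc_ge0.
rewrite mulrAC ler_pdivlMr // mulrC; apply: le_trans h _.
have nt := nc_ge0 t; have st0 : 0 <= s * nc t by rewrite mulr_ge0.
have cT : 1 + (s + s * nc t) <= T * (1 + s) by rewrite /T; lra.
rewrite -mulrA -exprMn ler_wpM2l //; apply: (lerXn2r _ _ _ cT); rewrite nnegrE; last apply: le_trans cT; lra.
Qed.

End Growth.

Section Sequences.
Variable R : realType.

Lemma cvgn_epsP (u : nat -> R) (l : R) : (u @ \oo --> l) <->
  (forall e, 0 < e -> exists N, forall n, (N <= n)%N -> `|l - u n| <= e).
Proof.
split=> [/cvgrPdist_le h e e0|h].
  by have [N _ hN] := h e e0; exists N => n Nn; apply: hN.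
apply/cvgrPdist_le => e e0; have [N hN] := h e e0.
by exists N => // n /= Nn; apply: hN.
Qed.

Lemma natinv_small (e : R) : 0 < e -> exists N, forall n, (N <= n)%N -> n%:R^-1 <= e.
Proof.
move=> e0; have ie : 0 <= e^-1 by rewrite invr_ge0 ltW.
have hN := archi_boundP ie; exists (Num.bound e^-1).+1 => n Nn.
rewrite -[e]invrK lef_pV2 ?posrE ?invr_gt0 //; last by rewrite ltr0n (leq_trans _ Nn).
by apply: le_trans (ltW hN) _; rewrite ler_nat (leq_trans _ Nn).
Qed.

(** The logarithms of [u n] and [D ^ n] differ by a bounded amount, which division by [n]
    removes. *)
Lemma root_limit (u : nat -> nat) (D : nat) (a A : R) : 0 < a -> (0 < D)%N ->
  (forall n, a * D%:R ^+ n <= (u n)%:R <= A * D%:R ^+ n) ->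
  (fun n => (u n)%:R `^ n%:R^-1 : R) @ \oo --> (D%:R : R).
Proof.
move=> a0 D0 h; have D1 : 0 < D%:R :> R by rewrite ltr0n.
have Dn n : 0 < D%:R ^+ n :> R by rewrite exprn_gt0.
have u0 n : 0 < (u n)%:R :> R.
  by case/andP: (h n) => h1 _; apply: lt_le_trans h1; rewrite mulr_gt0.
have A0 : 0 < A.
  by case/andP: (h 0%N) => _; rewrite expr0 mulr1; apply: lt_le_trans.
have eu : (fun n => (u n)%:R `^ n%:R^-1 : R) = (fun n => expR (n%:R^-1 * ln (u n)%:R)).
  by apply/funext => n; rewrite /powR gt_eqF.
rewrite eu -[X in _ --> X](lnK (x := D%:R)) ?posrE //.
apply: (@continuous_cvg _ _ _ _ _ (fun n => n%:R^-1 * ln (u n)%:R) expR (ln D%:R)).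
  exact: continuous_expR.
apply/cvgn_epsP => e e0.
pose B := `|ln a| + `|ln A| + 1.
have B0 : 0 < B by rewrite /B; have := normr_ge0 (ln a); have := normr_ge0 (ln A); lra.
have [N hN] := @natinv_small (e / B) (divr_gt0 e0 B0).
exists N.+1 => n Nn; have n0 : 0 < n%:R :> R by rewrite ltr0n (leq_trans _ Nn).
have bound : `|n%:R * ln D%:R - ln (u n)%:R| <= B.
  have [h1 h2] := andP (h n).
  have l1 : ln a + n%:R * ln D%:R <= ln (u n)%:R.
    rewrite mulr_natl -lnXn // -lnM ?posrE // ler_ln ?posrE ?mulr_gt0 //.
  have l2 : ln (u n)%:R <= ln A + n%:R * ln D%:R.
    rewrite mulr_natl -lnXn // -lnM ?posrE // ler_ln ?posrE ?mulr_gt0 //.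
  have := ler_norm (- ln a); rewrite normrN => m1; have := ler_norm (ln A) => m2.
  have := normr_ge0 (ln a); have := normr_ge0 (ln A).
  by rewrite ler_norml /B; lra.
have -> : ln D%:R - n%:R^-1 * ln (u n)%:R = n%:R^-1 * (n%:R * ln D%:R - ln (u n)%:R) :> R.
  by field; rewrite gt_eqF.
rewrite normrM gtr0_norm ?invr_gt0 //.
apply: le_trans (ler_wpM2l _ bound) _; first by rewrite invr_ge0 ltW.
by rewrite -ler_pdivlMr //; apply: hN; rewrite ltnW.
Qed.

End Sequences.

(** * Degrees of iterates and the dynamical degree *)

Section Degree.
Variable R : realType.
Local Notation C := R[i].
Local Notation nc := (@normc R).
Local Notation letter := (letter R[i]).
Implicit Types (z v : C * C) (w : seq letter) (f : polydiffeo R) (F : polymap R).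

Definition topair (p : C2 R) : C * C := (p 0 0, p 0 1).
Definition ofpair z : C2 R := \row_j pair2 z.1 z.2 j.

Lemma ofpairK : cancel ofpair topair.
Proof. by case=> x y; rewrite /topair !mxE. Qed.

Lemma topair_eval F p :
  topair (polymap_eval F p) = (meval (p 0) (tnth F 0), meval (p 0) (tnth F 1)).
Proof. by rewrite /topair !mxE. Qed.

Lemma polydiffeo_word f : exists2 w, all (@lok _) w &
  forall p, topair (polymap_eval (pd_fwd f) p) = run w (topair p).
Proof.
have [h i|w wo ew] := @jung C (tnth (pd_fwd f)) (tnth (pd_bwd f)).
  have := pd_fwdK f (\row_j h j) => /rowP/(_ i); rewrite !mxE => <-.
  apply: meval_eq => j; rewrite mxE; apply: meval_eq => k; by rewrite mxE.
by exists w => // p; rewrite topair_eval -ew.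
Qed.

Lemma polydiffeo_winv f w : all (@lok _) w ->
  (forall p, topair (polymap_eval (pd_fwd f) p) = run w (topair p)) ->
  forall p, topair (polymap_eval (pd_bwd f) p) = run (winv w) (topair p).
Proof. by move=> wo ew p; rewrite -{2}(pd_bwdK f p) ew runK. Qed.

Lemma polymap_eval_iter F n p : polymap_eval (polymap_iter F n) p = iter n (polymap_eval F) p.
Proof.
elim: n p => [|n IH] p; apply/rowP => i.
  by rewrite mxE /= tnth_mktuple mevalXU.
rewrite mxE /= tnth_mktuple comp_mpoly_meval [RHS]mxE; apply: meval_eq => j.
by rewrite -IH mxE.
Qed.

Definition pairmap F z := topair (polymap_eval F (ofpair z)).

Lemma nc2_pairmap F z :
  nc2 (pairmap F z) = nc (meval (pair2 z.1 z.2) (tnth F 0)) + nc (meval (pair2 z.1 z.2) (tnth F 1)).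
Proof.
rewrite /pairmap topair_eval /nc2 /=.
by congr (nc _ + nc _); apply: meval_eq => j; rewrite mxE.
Qed.

Lemma polymap_deg_le F k : bounded_growth k (pairmap F) -> (polymap_deg F <= k)%N.
Proof.
move=> [K K0 hK]; apply/bigmax_leqP => i _.
apply: (@degree_le_growth R _ _ K) => h.
apply: le_trans (hK (h 0, h 1)); rewrite nc2_pairmap /=.
have -> : meval h (tnth F i) = meval (pair2 (h 0) (h 1)) (tnth F i).
  by apply: meval_eq => j; rewrite pair2E.
have : (i == 0) || (i == 1) by case: i => [[|[|]]].
by case/orP=> /eqP ->; rewrite ?lerDl ?lerDr nc_ge0.
Qed.

Lemma polymap_deg_growth F : bounded_growth (polymap_deg F) (pairmap F).
Proof.
have [K0 K00 h0] := meval_bound (tnth F 0); have [K1 K10 h1] := meval_bound (tnth F 1).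
exists (K0 + K1); first by rewrite addr_ge0.
move=> z; rewrite nc2_pairmap mulrDl.
have N1 : 1 <= 1 + nc2 z by rewrite lerDl nc2_ge0.
apply: lerD; [apply: le_trans (h0 _) _|apply: le_trans (h1 _) _];
  rewrite ler_wpM2l // /pair2 /=; apply: ler_weXn2l => //; exact: (leq_bigmax (_ : 'I_2)).
Qed.

(** A map of degree zero is bounded, hence not surjective. *)
Lemma polymap_deg_gt0 F (G : C * C -> C * C) : cancel G (pairmap F) -> (0 < polymap_deg F)%N.
Proof.
move=> GK; rewrite lt0n; apply/eqP => d0.
have [K K0 h] := polymap_deg_growth F; rewrite d0 in h.
have := h (G ((K + 1)%:C%C, 0)); rewrite GK expr0 mulr1 /nc2 /= normc0 addr0.
by rewrite ncC ger0_norm; lra.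
Qed.

Lemma pairmap_iter f w n : (forall p, topair (polymap_eval (pd_fwd f) p) = run w (topair p)) ->
  pairmap (polymap_iter (pd_fwd f) n) =1 iter n (run w).
Proof.
move=> ew z; rewrite /pairmap polymap_eval_iter.
by elim: n => [|n IH]; rewrite ?ofpairK //= ew IH.
Qed.

Lemma conj_iter w (c v : seq letter) n z : (forall z, run c (run w z) = run v (run c z)) ->
  run c (iter n (run w) z) = iter n (run v) (run c z).
Proof. by move=> h; elim: n => //= n IH; rewrite h IH. Qed.

(** Conjugation changes the degree of an iterate at most by the fixed factors [kc] and [kc'], which
    the n-th root removes. Affine and triangular normal forms have iterates of bounded degree, hence
    dynamical degree 1. For a hyper word the images of the points [(0, t)] grow like [t] to the
    power [D ^ n]. *)
Theorem dynamical_degree_normal_form f : 2 <= dynamical_degree f ->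
  exists w c (v : seq letter), [/\ all (@lok _) w /\ (forall p, topair (polymap_eval (pd_fwd f) p) = run w (topair p)),
    all (@lok _) c, all (@hyper _) v /\ (0 < size v)%N,
    forall z, run c (run w z) = run v (run c z) &
    dynamical_degree f = (wdeg v)%:R].
Proof.
move=> hd; have [w wo ew] := polydiffeo_word f.
have [v vo [[c co cv] nv]] := word_normal_form wo.
have wE n z : iter n (run w) z = run (winv c) (iter n (run v) (run c z)).
  by rewrite -(conj_iter n z cv) runK.
pose u n := polymap_deg (polymap_iter (pd_fwd f) n).
have [kc kc0 gc] := bounded_growth_word c.
have [kc' kc'0 gc'] := bounded_growth_word (winv c).
have up n k : bounded_growth k (iter n (run v)) -> (u n <= kc' * (k * kc))%N.
  move=> h; apply: polymap_deg_le.
  apply: bounded_growth_ext (bounded_growth_comp gc' (bounded_growth_comp h gc)) => z.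
  by rewrite (pairmap_iter n ew) wE.
have u1 n : (1 <= u n)%N.
  apply: (@polymap_deg_gt0 _ (iter n (run (winv w)))) => z; rewrite (pairmap_iter n ew).
  by elim: n z => // n IH z; rewrite iterSr iterS runVK // IH.
have cst k : (forall n, bounded_growth k (iter n (run v))) -> False.
  move=> h; have := @root_limit R u 1 1 (kc' * (k * kc))%:R ltr01 isT.
  have hb n : (1 : R) * 1%:R ^+ n <= (u n)%:R <= ((kc' * (k * kc))%:R : R) * 1%:R ^+ n.
    by apply/andP; rewrite !expr1n !mulr1 ler1n ler_nat; split; [exact: u1|exact: up].
  move=> /(_ hb) /cvg_lim => /(_ (@Rhausdorff R)) e; move: hd.
  by rewrite /dynamical_degree e ler_nat.
case: nv => [[v0 hv]|[l lo [ev sl]]|[e eo ev]].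
- exists w, c, v; split=> //.
  have [D eD] : exists D, D = wdeg v by exists (wdeg v).
  have D1 : (1 < D)%N by rewrite eD wdeg_gt1.
  have low n : (D ^ n <= kc * (u n * kc'))%N.
    case: n => [|n]; first by rewrite expn0 !muln_gt0 kc0 kc'0 u1.
    have gv : bounded_growth (kc * (u n.+1 * kc')) (iter n.+1 (run v)).
      apply: bounded_growth_ext (bounded_growth_comp gc (bounded_growth_comp (polymap_deg_growth _) gc')) => z.
      by rewrite /= (pairmap_iter n.+1 ew) (conj_iter n.+1 _ cv) runVK.
    have vn : all (@hyper _) (flatten (nseq n.+1 v)).
      by elim: (n.+1) => // k IH; rewrite /= all_cat hv.
    have sn : (0 < size (flatten (nseq n.+1 v)))%N by rewrite /= size_cat addn_gt0 v0.
    have dn : wdeg (flatten (nseq n.+1 v)) = (D ^ n.+1)%N.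
      by rewrite eD; elim: (n.+1) => // k IH; rewrite /= wdeg_cat IH expnS.
    have [K [r [K1 r1 h]]] := expanding_run vn sn.
    have [K' K'0 h'] := gv.
    apply: (@growth_compare R _ _ (K * K') r) => t rt.
    have t0 : 0 <= t by lra.
    have nt : nc t%:C%C = t by rewrite ncC ger0_norm.
    have [|_ _ h3 _ _] := h (0, t%:C%C); first by rewrite /inV /= nt normc0 rt.
    rewrite dn /= nt in h3; apply: le_trans h3 _.
    rewrite -mulrA; apply: ler_wpM2l; first by lra.
    have := h' (0, t%:C%C); rewrite -run_iter /= => h4.
    have e2 : nc2 (0, t%:C%C) = t by rewrite /nc2 /= nt normc0 add0r.
    by rewrite e2 in h4; apply: le_trans h4; rewrite /nc2 lerDr nc_ge0.
  have A0 : 0 < (kc * kc')%:R :> R by rewrite ltr0n muln_gt0 kc0.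
  have := @root_limit R u D ((kc * kc')%:R^-1) (kc' * kc)%:R _ (ltnW D1).
  rewrite invr_gt0 A0 => /(_ isT).
  have hb m : ((kc * kc')%:R^-1 : R) * D%:R ^+ m <= (u m)%:R <= ((kc' * kc)%:R : R) * D%:R ^+ m.
    rewrite mulrC ler_pdivrMr // -!natrX -!natrM !ler_nat.
    apply/andP; split; first by rewrite mulnC -mulnA [(kc' * _)%N]mulnC low.
    apply: leq_trans (up m (D ^ m)%N _) _; last by rewrite mulnA mulnAC.
    rewrite eD; apply: (@bounded_growth_ext _ _ (run (flatten (nseq m v)))).
      by move=> z; rewrite run_iter.
    have -> : (wdeg v ^ m)%N = wdeg (flatten (nseq m v)).
      by elim: (m) => // k IH; rewrite /= wdeg_cat -IH expnS.
    apply: bounded_growth_hyper.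
    by elim: (m) => // k IH; rewrite /= all_cat hv.
  move=> /(_ hb) /cvg_lim => /(_ (@Rhausdorff R)) e.
  by rewrite -eD -e.
- case: (cst 1%N) => n; rewrite ev; exact: bounded_growth_affine_iter.
- have [k k0 h] := bounded_growth_tri_iter eo; case: (cst k) => n.
  apply: bounded_growth_ext (h n) => z; rewrite ev.
  by elim: n => //= n ->; rewrite step_lid swapK.
Qed.

End Degree.

(** * Convergence of the Green function and of its derivatives *)

Section Limits.
Variable R : realType.
Local Notation C := R[i].
Local Notation nc := (@normc R).
Local Notation hf := (2^-1 : R).

Lemma hf_gt0 n : 0 < hf ^+ n. Proof. by rewrite exprn_gt0 // invr_gt0. Qed.

Lemma hf_small (e B : R) : 0 < e -> exists N, forall n, (N <= n)%N -> B * hf ^+ n <= e.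
Proof.
move=> e0; have B0 : 0 < 1 + `|B| by have := normr_ge0 B; lra.
have [//|N hN'] := @natinv_small R (e / (1 + `|B|)); first by rewrite divr_gt0.
exists N.+1 => n Nn; have n0 : (0 < n)%N by apply: leq_trans Nn.
have h2 : hf ^+ n <= n%:R^-1.
  rewrite exprVn lef_pV2 ?posrE ?ltr0n ?exprn_gt0 // -natrX ler_nat.
  exact: ltnW (ltn_expl _ _).
have := hN' n (ltnW Nn); rewrite ler_pdivlMr // => h3.
apply: le_trans h3; have := ler_norm B => h4; have := hf_gt0 n => h5.
have : 0 <= n%:R^-1 :> R by rewrite invr_ge0.
have := normr_ge0 B; nra.
Qed.

(** The rate [2^-n] is the one that [D >= 2] and the doubling of [|y|] provide, and it reduces
    uniqueness and products of limits to plain inequalities. *)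
Definition geo_cvg (u : nat -> C) (l : C) := exists B, forall n, nc (u n - l) <= B * hf ^+ n.

Lemma geo_limit (u : nat -> R) (B : R) :
  (forall n m, (n <= m)%N -> `|u m - u n| <= B * hf ^+ n) ->
  exists l, (u @ \oo --> l) /\ forall n, `|u n - l| <= B * hf ^+ n.
Proof.
move=> h; have cu : cvgn u.
  apply/cauchy_cvgP/cauchy_exP => e /= e0.
  have e3 : 0 < e / 3 by rewrite divr_gt0.
  have [N hN] := hf_small B e3; exists (u N), N => // n /= Nn; rewrite /ball /= distrC.
  by have := le_trans (h N n Nn) (hN N (leqnn N)); lra.
exists (limn u); split=> // n; rewrite distrC.
apply/ler_addgt0Pr => e e0.
have /cvgn_epsP/(_ e e0)[N hN] : u @ \oo --> limn u by [].
have h1 := h n (maxn n N) (leq_maxl _ _); have h2 := hN (maxn n N) (leq_maxr _ _).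
rewrite (_ : limn u - u n = (limn u - u (maxn n N)) + (u (maxn n N) - u n)); last by ring.
by apply: le_trans (ler_normD _ _) _; lra.
Qed.

Lemma geo_limitC (u : nat -> C) (B : R) :
  (forall n m, (n <= m)%N -> nc (u m - u n) <= B * hf ^+ n) ->
  exists l, forall n, nc (u n - l) <= 2 * B * hf ^+ n.
Proof.
move=> h.
have [n m nm|a [_ ha]] := @geo_limit (fun n => complex.Re (u n)) B.
  by apply: le_trans (h n m nm); rewrite -raddfB; exact: nc_Re.
have [n m nm|b [_ hb]] := @geo_limit (fun n => complex.Im (u n)) B.
  by apply: le_trans (h n m nm); rewrite -raddfB; exact: nc_Im.
exists (Complex a b) => n; apply: le_trans (nc_ReIm _) _.
by have := ha n; have := hb n; rewrite !raddfB /=; lra.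
Qed.

Lemma geo_cvg_unique u l l' : geo_cvg u l -> geo_cvg u l' -> l = l'.
Proof.
move=> [B h] [B' h']; apply/eqP; rewrite -subr_eq0; apply: contraT; rewrite -nc_gt0 => e0.
have e2 : 0 < nc (l - l') / 2 by rewrite divr_gt0.
have [N hN] := hf_small (B + B') e2.
have := hN N (leqnn N); have := h N; have := h' N.
have : nc (l - l') <= nc (u N - l') + nc (u N - l).
  by rewrite (_ : l - l' = (u N - l') - (u N - l)); [exact: ncB|ring].
by rewrite mulrDl; lra.
Qed.

Lemma geo_cvg_linear u v l m a b : geo_cvg u l -> geo_cvg v m ->
  geo_cvg (fun n => a * u n + b * v n) (a * l + b * m).
Proof.
move=> [B h] [B' h']; exists (nc a * B + nc b * B') => n.
have -> : a * u n + b * v n - (a * l + b * m) = a * (u n - l) + b * (v n - m) by ring.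
apply: le_trans (ncD _ _) _; rewrite !normcM mulrDl -!mulrA.
by apply: lerD; rewrite ler_wpM2l ?nc_ge0.
Qed.

Definition wpow (K : fieldType) (w : seq (letter K)) n := flatten (nseq n w).

Lemma wpowSr (K : fieldType) (w : seq (letter K)) n : wpow w n.+1 = wpow w n ++ w.
Proof. by elim: n => [|n IH]; rewrite /wpow /= ?cats0 // -/(wpow w n) -catA -IH. Qed.

Implicit Types (z v : C * C) (w : seq (letter R[i])).

(* d(log y_n)(v) / D^n, where y_n is the second coordinate of the n-th iterate. *)
Definition ldir w n z v : C :=
  (trun (wpow w n) z v).2 / ((wdeg w)%:R ^+ n * (run (wpow w n) z).2).

Definition lgreen w n z : R := ln (nc (run (wpow w n) z).2) / (wdeg w)%:R ^+ n.

Definition escape_region w (K r : R) := [/\ 1 <= K, 1 <= r & forall z, inV r z -> forall n,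
    [/\ inV r (run (wpow w n) z), 2 ^+ n * nc z.2 <= nc (run (wpow w n) z).2,
        `|lgreen w n.+1 z - lgreen w n z| <= K * hf ^+ n.+1 &
        forall v m, (n <= m)%N ->
          nc (ldir w m z v - ldir w n z v) <= K / nc z.2 * (nc2 v / nc z.2) * hf ^+ n]].

(** Far out [|y|] at least doubles at every step, so relative errors [O(1/|y_n|)] are summable. [sg]
    measures the whole transported vector in the units of [ldir]; for it the recursion with factor
    [1 + 2 ep k] closes. *)
Lemma orbit_estimates w : all (@hyper _) w -> (0 < size w)%N ->
  exists K r : R, escape_region w K r.
Proof.
move=> hw sw; have [K0 [r0 [K01 r01 hE]]] := expanding_run hw sw.
have D1 := wdeg_gt1 hw sw; have [D eD] : exists D, wdeg w = D by exists (wdeg w).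
rewrite eD in hE D1.
have D2 : 2 <= D%:R :> R by rewrite ler_nat.
have D0 : 0 < D%:R :> R by lra.
(* As [|y|^2 <= K0 |y'|], this radius yields the doubling; it also keeps [ep k] below
   [2^-k / 32]. *)
pose r := r0 + 16 * K0.
exists (2 * K0), r; split; [lra|rewrite /r; lra|] => z zV.
have step_inV z' : inV r z' -> inV r (run w z') /\ 2 * nc z'.2 <= nc (run w z').2.
  move=> z'V; have z'0 : inV r0 z' by apply: inV_le z'V; rewrite /r; lra.
  have [h1 h2 h3 _ _] := hE z' z'0; have /andP[ry _] := z'V.
  split; first by rewrite /inV h1 andbT (le_trans ry).
  have y1 : 1 <= nc z'.2 by move: ry; rewrite /r; lra.
  have h4 : nc z'.2 ^+ 2 <= K0 * nc (run w z').2.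
    by apply: le_trans h3; apply: ler_weXn2l.
  rewrite -(@ler_pM2l _ K0); last by lra.
  by apply: le_trans h4; move: ry; rewrite /r expr2; nra.
have orb n : inV r (run (wpow w n) z) /\ 2 ^+ n * nc z.2 <= nc (run (wpow w n) z).2.
  elim: n => [|n [IH1 IH2]]; first by rewrite expr0 mul1r.
  rewrite wpowSr run_cat; have [h1 h2] := step_inV _ IH1; split=> //.
  by apply: le_trans h2; rewrite exprS -mulrA ler_wpM2l.
have y1 : 1 <= nc z.2 by case/andP: zV => h _; apply: le_trans h; rewrite /r; lra.
have y0 : 0 < nc z.2 by lra.
have ypos n : 0 < nc (run (wpow w n) z).2.
  by have [_ h] := orb n; apply: lt_le_trans h; rewrite mulr_gt0 // exprn_gt0.
move=> n; have [i1 i2] := orb n; split=> //.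
  have oV0 : inV r0 (run (wpow w n) z) by apply: inV_le i1; rewrite /r; lra.
  have [_ _ h3 h4 _] := hE _ oV0.
  rewrite /lgreen eD wpowSr run_cat; set y := nc (run (wpow w n) z).2 in h3 h4 *.
  set y' := nc (run w _).2 in h3 h4 *.
  have yp : 0 < y by apply: ypos.
  have yD : 0 < y ^+ D by rewrite exprn_gt0.
  have y'p : 0 < y' by have := ypos n.+1; rewrite wpowSr run_cat.
  have l1 : D%:R * ln y <= ln K0 + ln y'.
    by rewrite mulr_natl -lnXn // -lnM ?posrE //; [rewrite ler_ln ?posrE // mulr_gt0 //|]; lra.
  have l2 : ln y' <= ln K0 + D%:R * ln y.
    by rewrite mulr_natl -lnXn // -lnM ?posrE //; [rewrite ler_ln ?posrE // mulr_gt0 //|]; lra.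
  have lK : ln K0 <= K0 by apply/ltW/ln_sublinear; lra.
  have -> : ln y' / D%:R ^+ n.+1 - ln y / D%:R ^+ n = (ln y' - D%:R * ln y) / D%:R ^+ n.+1.
    by rewrite exprS; field; rewrite expf_neq0 // gt_eqF.
  rewrite normrM [X in _ * X]gtr0_norm ?invr_gt0 ?exprn_gt0 //.
  apply: ler_pM; first exact: normr_ge0.
  - by rewrite invr_ge0 exprn_ge0 // ltW.
  - by rewrite ler_norml; lra.
  by rewrite -exprVn; apply: lerXn2r; rewrite ?nnegrE ?invr_ge0 ?ler0n // lef_pV2 ?posrE.
move=> v.
pose sg k := nc2 (trun (wpow w k) z v) / (D%:R ^+ k * nc (run (wpow w k) z).2).
have sg0 k : 0 <= sg k by rewrite divr_ge0 ?nc2_ge0 // mulr_ge0 ?nc_ge0 // exprn_ge0 // ltW.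
pose ep k := K0 / (D%:R * nc (run (wpow w k) z).2).
have ep0 k : 0 <= ep k by rewrite divr_ge0 ?mulr_ge0 ?nc_ge0 //; lra.
have nz k : nc (run (wpow w k) z).2 != 0 by rewrite gt_eqF ?ypos.
have nzC k : (run (wpow w k) z).2 != 0 by rewrite -nc_gt0 ypos.
have Dk k : 0 < D%:R ^+ k :> R by rewrite exprn_gt0.
have DkC k : D%:R ^+ k != 0 :> C by rewrite expf_neq0 // pnatr_eq0; case: (D) D1.
have epb k : ep k <= K0 / (2 * nc z.2) * hf ^+ k.
  have [_ h] := orb k.
  have p : 0 < 2 ^+ k :> R by rewrite exprn_gt0.
  rewrite exprVn -mulrA -invfM ler_wpM2l //; first by lra.
  rewrite lef_pV2 ?posrE ?mulr_gt0 ?ypos //.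
  apply: (@le_trans _ _ (2 * (2 ^+ k * nc z.2))).
    by rewrite le_eqVlt; apply/orP; left; apply/eqP; ring.
  by apply: ler_pM => //; rewrite mulr_ge0 // ltW.
have epb' k : ep k <= 16^-1 * hf * hf ^+ k.
  apply: le_trans (epb k) _; rewrite ler_wpM2r ?(ltW (hf_gt0 _)) //.
  rewrite ler_pdivrMr ?mulr_gt0 //; case/andP: zV => rz _.
  by move: rz; rewrite /r; lra.
have next k : nc (ldir w k.+1 z v - ldir w k z v) <= ep k * sg k /\
              sg k.+1 <= nc (ldir w k.+1 z v) + ep k * sg k.
  have [i1' _] := orb k.
  have oV0 : inV r0 (run (wpow w k) z) by apply: inV_le i1'; rewrite /r; lra.
  have [_ _ _ _ /(_ (trun (wpow w k) z v)) [h5 h6]] := hE _ oV0.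
  have yp := ypos k; have yp' := ypos k.+1; have nzk := nz k; have nzk' := nz k.+1.
  have nzCk := nzC k; have nzCk' := nzC k.+1; have dk := Dk k; have dk' := Dk k.+1.
  have dkC := DkC k; have dkC' := DkC k.+1.
  have es : ep k * sg k * (D%:R ^+ k.+1 * nc (run (wpow w k.+1) z).2) =
      K0 * nc (run (wpow w k.+1) z).2 * nc2 (trun (wpow w k) z v) / nc (run (wpow w k) z).2 ^+ 2.
    rewrite /ep /sg exprS; field.
    by rewrite nzk !gt_eqF.
  have wS : (run (wpow w k.+1) z) = run w (run (wpow w k) z) by rewrite wpowSr run_cat.
  have tS : (trun (wpow w k.+1) z v) = trun w (run (wpow w k) z) (trun (wpow w k) z v).
    by rewrite wpowSr trun_cat.
  rewrite -wS -tS in h5 h6.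
  split.
    rewrite /ldir eD.
    have -> : (trun (wpow w k.+1) z v).2 / (D%:R ^+ k.+1 * (run (wpow w k.+1) z).2) -
       (trun (wpow w k) z v).2 / (D%:R ^+ k * (run (wpow w k) z).2) =
       ((trun (wpow w k.+1) z v).2 * (run (wpow w k) z).2 -
         D%:R * (run (wpow w k.+1) z).2 * (trun (wpow w k) z v).2) /
       (D%:R ^+ k.+1 * (run (wpow w k.+1) z).2 * (run (wpow w k) z).2).
      rewrite exprS; field; rewrite nzCk nzCk' dkC /=.
      by rewrite pnatr_eq0; case: (D) D1.
    rewrite normcM normcV !normcM ncX nc_nat ler_pdivrMr ?mulr_gt0 //.
    have -> : ep k * sg k * (D%:R ^+ k.+1 * nc (run (wpow w k.+1) z).2 * nc (run (wpow w k) z).2)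
        = K0 * nc (run (wpow w k.+1) z).2 * nc2 (trun (wpow w k) z v) / nc (run (wpow w k) z).2.
      by rewrite mulrA es; field.
    by rewrite ler_pdivlMr.
  rewrite {1}/sg /nc2 mulrDl addrC; apply: lerD.
    by rewrite /ldir eD normcM normcV normcM ncX nc_nat.
  rewrite ler_pdivrMr ?mulr_gt0 // es ler_pdivlMr ?exprn_gt0 //.
have sgl k : nc (ldir w k z v) <= sg k.
  rewrite /ldir eD /sg normcM normcV normcM ncX nc_nat ler_wpM2r ?invr_ge0 ?mulr_ge0 ?nc_ge0 ?(ltW (Dk _)) //.
  by rewrite lerDr nc_ge0.
have sgS k : sg k.+1 <= (1 + 2 * ep k) * sg k.
  have [h1 h2] := next k; have h3 := sgl k.
  have : nc (ldir w k.+1 z v) <= nc (ldir w k.+1 z v - ldir w k z v) + nc (ldir w k z v).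
    by apply: le_trans (ncD _ _); rewrite subrK.
  by rewrite mulrDl mul1r -mulrA; lra.
(* [2 - 2^-k] bounds the product of the first [k] factors [1 + 2 ep] and leaves room for the next
   one. *)
have sgb k : sg k <= (2 - hf ^+ k) * sg 0%N.
  elim: k => [|k IH]; first by rewrite expr0; lra.
  apply: le_trans (sgS k) _; apply: (@le_trans _ _ ((1 + 2 * ep k) * ((2 - hf ^+ k) * sg 0%N))).
    by rewrite ler_wpM2l //; have := ep0 k; lra.
  rewrite mulrA ler_wpM2r // exprS.
  have h1 := epb' k; have h2 := hf_gt0 k; have h3 := ep0 k.
  have : 0 <= ep k * hf ^+ k by rewrite mulr_ge0 // ltW.
  by move: (ep k) (hf ^+ k) h1 h2 h3 => a h h1 h2 h3 h4; nra.
have sg00 : sg 0%N = nc2 v / nc z.2 by rewrite /sg /= expr0 mul1r.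
have one k : nc (ldir w k.+1 z v - ldir w k z v) <= K0 / nc z.2 * (nc2 v / nc z.2) * hf ^+ k.
  have [h1 _] := next k; apply: le_trans h1 _; rewrite -sg00.
  apply: (@le_trans _ _ (K0 / (2 * nc z.2) * hf ^+ k * (2 * sg 0%N))).
    apply: ler_pM => //; apply: le_trans (sgb k) _; rewrite ler_wpM2r //.
    by have := hf_gt0 k; lra.
  rewrite le_eqVlt; apply/orP; left; apply/eqP; field.
  by rewrite gt_eqF.
move=> m nm; rewrite -(subnKC nm); elim: (m - n)%N => [|j IH].
  rewrite addn0 subrr normc0 !mulr_ge0 ?invr_ge0 ?nc_ge0 ?nc2_ge0 ?(ltW (hf_gt0 _)) //; lra.
suff tele i : nc (ldir w (n + i) z v - ldir w n z v) <=
   K0 / nc z.2 * (nc2 v / nc z.2) * (2 * (hf ^+ n - hf ^+ (n + i))).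
  apply: le_trans (tele j.+1) _.
  have q : 0 <= K0 / nc z.2 * (nc2 v / nc z.2) by rewrite !mulr_ge0 ?invr_ge0 ?nc_ge0 ?nc2_ge0 //; lra.
  rewrite [2 * K0]mulrC -!mulrA [leRHS](_ : _ = (K0 / nc z.2 * (nc2 v / nc z.2)) * (2 * hf ^+ n)); last by ring.
  rewrite [leLHS](_ : _ = (K0 / nc z.2 * (nc2 v / nc z.2)) * (2 * (hf ^+ n - hf ^+ (n + j.+1)))); last by ring.
  by rewrite ler_wpM2l //; have := hf_gt0 (n + j.+1); lra.
elim: i => [|i IHi]; first by rewrite addn0 !subrr normc0 !mulr0.
rewrite addnS (_ : ldir w (n + i).+1 z v - ldir w n z v =
  (ldir w (n + i).+1 z v - ldir w (n + i) z v) + (ldir w (n + i) z v - ldir w n z v)); last by ring.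
apply: le_trans (ncD _ _) _; have := one (n + i)%N.
by rewrite exprS; lra.
Qed.

End Limits.

(** * Derivatives of limits of [ln |q|] along a real line *)

Section Derivatives.
Variable R : realType.
Local Notation C := R[i].
Local Notation nc := (@normc R).
Local Notation hf := (2^-1 : R).
Implicit Types (z v : C * C) (w : seq (letter R[i])).

Lemma derive1_epsP (f : R -> R) a l :
  (forall e, 0 < e -> exists2 d, 0 < d & forall t, t != 0 -> `|t| < d ->
     `|t^-1 * (f (t + a) - f a) - l| <= e) -> derive1 f a = l.
Proof.
move=> h; apply/cvg_lim; first exact: Rhausdorff.
apply/cvgrPdist_le => e e0; have [d d0 hd] := h e e0.
exists d => //= t; rewrite /ball /= sub0r normrN => td t0.
by rewrite distrC; apply: hd.
Qed.

Lemma is_derive_eps (f : R -> R) (a l e : R) : is_derive a (1 : R) f l -> 0 < e ->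
  exists2 d, 0 < d & forall t, t != 0 -> `|t| < d -> `|t^-1 * (f (t + a) - f a) - l| <= e.
Proof.
move=> [df dv] e0.
have : h^-1 *: ((f \o shift a) (h *: 1) - f a) @[h --> 0^'] --> l by rewrite -dv.
move=> /cvgrPdist_le/(_ e e0)[d /= d0 hd]; exists d => // t t0 td.
have := hd t; rewrite /ball /= sub0r normrN => /(_ td t0).
by rewrite distrC /= [t *: 1]mulr1.
Qed.

Lemma mvt_bound (g g' : R -> R) (d B : R) :
  (forall t : R, `|t| < d -> is_derive t (1 : R) g (g' t)) ->
  (forall t : R, `|t| < d -> `|g' t| <= B) ->
  forall t, `|t| < d -> `|g t - g 0| <= B * `|t|.
Proof.
move=> hg hB t td.
have seg a b : a <= b -> `|a| < d -> `|b| < d -> `|g b - g a| <= B * (b - a).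
  move=> ab ad bd.
  have inside x : a <= x <= b -> `|x| < d.
    by move: ad bd; rewrite !ltr_norml => /andP[? ?] /andP[? ?] /andP[? ?]; apply/andP; split; lra.
  have [||x xab ->] := @MVT_segment R g g' a b ab.
  - by move=> x; rewrite in_itv /= => /andP[h1 h2]; apply/hg/inside; rewrite !ltW.
  - apply: derivable_within_continuous => x; rewrite in_itv /= => xab.
    by have [] := hg x (inside x xab).
  - rewrite normrM [`|b - a|]ger0_norm ?subr_ge0 // ler_wpM2r ?subr_ge0 //.
    by apply/hB/inside; move: xab; rewrite in_itv.
have d0 : `|0 : R| < d by rewrite normr0; apply: le_lt_trans td.
have [t0|t0] := leP 0 t.
  by have := seg 0 t t0 d0 td; rewrite subr0 [`|t|]ger0_norm.
by have := seg t 0 (ltW t0) td d0; rewrite sub0r distrC [`|t|]ltr0_norm.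
Qed.

(** The mean value theorem bounds the increment of [L m - L N] by the tail of the derivatives, and
    the bound survives the limit in [m]. The derivative of the single function [L N] does the
    rest. *)
Lemma derive1_limit (L l : nat -> R -> R) (G : R -> R) (d B lim : R) : 0 < d ->
  (forall n (t : R), `|t| < d -> is_derive t (1 : R) (L n) (l n t)) ->
  (forall n m (t : R), (n <= m)%N -> `|t| < d -> `|l m t - l n t| <= B * hf ^+ n) ->
  (forall t : R, `|t| < d -> (fun n => L n t) @ \oo --> G t) ->
  (forall n, `|l n 0 - lim| <= B * hf ^+ n) ->
  derive1 G 0 = lim.
Proof.
move=> d0 hL hl hG h0; apply: derive1_epsP => e e0.
have e3 : 0 < e / 3 by rewrite divr_gt0.
have [N hN] := hf_small B e3; have BN := hN N (leqnn N).
have zd : `|0 : R| < d by rewrite normr0.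
have [d1 d10 hd1] := is_derive_eps (hL N 0 zd) e3.
exists (Num.min d d1); first by rewrite lt_min d0.
move=> t t0; rewrite lt_min addr0 => /andP[td td1].
have main : `|(G t - G 0) - (L N t - L N 0)| <= e / 3 * `|t|.
  apply/ler_addgt0Pr => e' e'0; have e'2 : 0 < e' / 2 by rewrite divr_gt0.
  have /cvgn_epsP/(_ _ e'2)[M1 hM1] := hG t td.
  have /cvgn_epsP/(_ _ e'2)[M2 hM2] := hG 0 zd.
  pose m := maxn N (maxn M1 M2).
  have m1 : (M1 <= m)%N by rewrite /m !leq_max leqnn ?orbT.
  have m2 : (M2 <= m)%N by rewrite /m !leq_max leqnn ?orbT.
  have mN : (N <= m)%N by rewrite /m leq_max leqnn.
  have der (s : R) : `|s| < d -> is_derive s (1 : R) (L m \- L N) (l m s - l N s).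
    by move=> sd; apply: is_deriveB; apply: hL.
  have bd s : `|s| < d -> `|l m s - l N s| <= e / 3.
    by move=> sd; apply: le_trans (hl N m s mN sd) BN.
  have h1 := mvt_bound der bd td; have h2 := hM1 m m1; have h3 := hM2 m m2.
  rewrite (_ : G t - G 0 - (L N t - L N 0) =
    (G t - L m t) - (G 0 - L m 0) + ((L m \- L N) t - (L m \- L N) 0)); last by rewrite /=; ring.
  apply: le_trans (ler_normD _ _) _; have := ler_normB (G t - L m t) (G 0 - L m 0); lra.
have := hd1 t t0 td1; rewrite addr0 => h1; have h2 := h0 N.
have t'0 : 0 < `|t| by rewrite normr_gt0.
have h3 : `|t^-1 * ((G t - G 0) - (L N t - L N 0))| <= e / 3.
  by rewrite normrM normfV mulrC ler_pdivrMr.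
rewrite (_ : t^-1 * (G t - G 0) - lim = t^-1 * ((G t - G 0) - (L N t - L N 0))
   + (t^-1 * (L N t - L N 0) - l N 0) + (l N 0 - lim)); last by ring.
apply: le_trans (ler_normD _ _) _.
have := ler_normD (t^-1 * ((G t - G 0) - (L N t - L N 0))) (t^-1 * (L N t - L N 0) - l N 0).
lra.
Qed.

(** Makes the real and imaginary parts of [q] on the real line into real polynomials, so that
    [|q|^2] is a real polynomial too. *)
Definition re_poly (g : C -> R) (q : {poly C}) : {poly R} := \poly_(i < size q) g q`_i.

Lemma re_polyE (g : {additive C -> R}) (q : {poly C}) (t : R) :
  (forall (x : C) (a : R), g (x * a%:C%C) = g x * a) -> (re_poly g q).[t] = g q.[t%:C%C].
Proof.
move=> hg; rewrite horner_poly horner_coef raddf_sum; apply: eq_bigr => i _.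
by rewrite -rmorphXn /= hg.
Qed.

Lemma deriv_re_poly (g : {additive C -> R}) (q : {poly C}) :
  (re_poly g q)^`() = re_poly g q^`().
Proof.
have c p i : (re_poly g p)`_i = g p`_i.
  by rewrite coef_poly; case: ltnP => // h; rewrite nth_default // raddf0.
by apply/polyP => i; rewrite coef_deriv !c coef_deriv raddfMn.
Qed.

Lemma is_derive_ln_nc (q : {poly C}) (t : R) : q.[t%:C%C] != 0 ->
  is_derive t (1 : R) (fun s => ln (nc q.[s%:C%C])) (complex.Re (q^`().[t%:C%C] / q.[t%:C%C])).
Proof.
move=> q0.
pose re := @complex.Re R : C -> R; pose im := @complex.Im R : C -> R.
have hre (x : C) (a : R) : re (x * a%:C%C) = re x * a.
  by case: x => x y; rewrite /re /= mulr0 subr0.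
have him (x : C) (a : R) : im (x * a%:C%C) = im x * a.
  by case: x => x y; rewrite /im /= mulr0 add0r.
pose A := re_poly re q; pose B := re_poly im q; pose P := A ^+ 2 + B ^+ 2.
have PE s : P.[s] = nc q.[s%:C%C] ^+ 2.
  by rewrite /P hornerD !horner_exp (@re_polyE re) // (@re_polyE im) // nc_sqr.
have n0 s : q.[s%:C%C] != 0 -> 0 < nc q.[s%:C%C] by rewrite nc_gt0.
(* This also holds at the zeros of [q], where both logarithms are [ln 0 = 0]. *)
have fE : (fun s => ln (nc q.[s%:C%C])) = (fun s => 2^-1 * ln P.[s]).
  apply/funext => s; rewrite PE; have [z|nz] := eqVneq (nc q.[s%:C%C]) 0.
    by rewrite z expr0n /= ln0 // mulr0.
  have p : 0 < nc q.[s%:C%C] by rewrite lt0r nz nc_ge0.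
  by rewrite lnXn // -mulr_natl; field.
have P0 : 0 < P.[t] by rewrite PE exprn_gt0 // n0.
have d1 : is_derive t (1 : R) (@ln R \o horner P) (P.[t]^-1 * P^`().[t]).
  by apply: is_derive1_comp; exact: is_derive1_ln.
rewrite fE; have := @is_deriveZ _ _ _ (@ln R \o horner P) 2^-1 t 1 _ d1.
rewrite (_ : 2^-1 *: (P.[t]^-1 * P^`().[t]) = complex.Re (q^`().[t%:C%C] / q.[t%:C%C])) //.
rewrite /P derivD !deriv_exp /= !expr1 !(hornerD, horner_exp, hornerM, hornerMn).
rewrite !deriv_re_poly /A /B !(@re_polyE re) // !(@re_polyE im) //.
have := n0 t q0; rewrite nc_gt0 => _.
rewrite /re /im; have : nc q.[t%:C%C] != 0 by rewrite gt_eqF // n0.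
case: (q.[t%:C%C]) => a b; case: (q^`().[t%:C%C]) => c e /= nz.
have ab : a ^+ 2 + b ^+ 2 != 0.
  by move: nz; rewrite -sqrf_eq0 nc_sqr.
rewrite /GRing.scale /=; field; exact: ab.
Qed.

Lemma poly_continuousC p x0 (e : R) : 0 < e ->
  exists2 d, 0 < d & forall x, nc (x - x0) < d -> nc (p.[x] - p.[x0]) <= e.
Proof.
move=> e0; pose q := p \Po ('X + x0%:P); pose S := 1 + \sum_(i < size q) nc q`_i.
have S0 : 0 < S by rewrite ltr_pwDl // sumr_ge0 // => i _; apply: nc_ge0.
exists (Num.min 1 (e / S)); first by rewrite lt_min ltr01 divr_gt0.
move=> x; rewrite lt_min => /andP[t1 te].
have -> : p.[x] - p.[x0] = q.[x - x0] - q.[0] by rewrite /q !horner_comp !hE subrK add0r.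
set t := x - x0 in t1 te *.
have -> : q.[t] - q.[0] = \sum_(i < size q) (if i == 0 :> nat then 0 else q`_i * t ^+ i).
  rewrite !horner_coef -sumrB; apply: eq_bigr => i _; case: eqP => [->|i0].
    by rewrite !expr0 subrr.
  by rewrite expr0n; case: eqP i0 => //= _ _; rewrite mulr0 subr0.
apply: le_trans (nc_sum _) _.
apply: (@le_trans _ _ (S * nc t)); last by rewrite mulrC -ler_pdivlMr // ltW.
rewrite mulrDl mulr_suml; apply: (@le_trans _ _ (\sum_(i < size q) nc q`_i * nc t)).
  apply: ler_sum => i _; case: eqP => i0; first by rewrite normc0 mulr_ge0 ?nc_ge0.
  rewrite normcM ncX ler_wpM2l ?nc_ge0 //; case: (i : nat) i0 => // k _.
  by rewrite exprS ler_piMr ?nc_ge0 // exprn_ile1 ?nc_ge0 // ltW.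
by rewrite lerDr mul1r nc_ge0.
Qed.

Lemma poly_continuous (p : {poly C}) (e : R) : 0 < e ->
  exists2 d, 0 < d & forall t : R, `|t| < d -> nc (p.[t%:C%C] - p.[0]) <= e.
Proof.
move=> e0; have [d d0 hd] := poly_continuousC p 0 e0; exists d => // t td.
by apply: hd; rewrite subr0 ncC.
Qed.

End Derivatives.

(** * The Green functions and their forms in the escape region *)

Section Green.
Variable R : realType.
Local Notation C := R[i].
Local Notation nc := (@normc R).
Local Notation hf := (2^-1 : R).
Implicit Types (z v : C * C) (c psi w : seq (letter R[i])).

Lemma telescope_bound (u : nat -> R) (K : R) :
  (forall n, `|u n.+1 - u n| <= K * hf ^+ n.+1) ->
  forall n m, (n <= m)%N -> `|u m - u n| <= K * hf ^+ n.
Proof.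
move=> h n m nm; rewrite -(subnKC nm).
have K0 : 0 <= K.
  have := le_trans (normr_ge0 _) (h 0%N); have := hf_gt0 R 1.
  by move=> h1; rewrite pmulr_lge0.
suff tele i : `|u (n + i)%N - u n| <= K * (hf ^+ n - hf ^+ (n + i)).
  apply: le_trans (tele _) _; rewrite ler_wpM2l //.
  by have := hf_gt0 R (n + (m - n)); lra.
elim: i => [|i IH]; first by rewrite addn0 !subrr normr0 mulr0.
rewrite addnS (_ : u (n + i).+1 - u n = (u (n + i).+1 - u (n + i)%N) + (u (n + i)%N - u n)); last by ring.
apply: le_trans (ler_normD _ _) _; have := h (n + i)%N.
by rewrite exprS; lra.
Qed.

Definition green w z : R := limn (fun n => lgreen w n z).

Lemma lgreen_cvg w K r z : escape_region w K r -> inV r z ->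
  (fun n => lgreen w n z) @ \oo --> green w z.
Proof.
move=> [K1 r1 h] zV.
have [n|l [cl _]] := @geo_limit R (fun n => lgreen w n z) K.
  apply: telescope_bound => k; by have [] := h z zV k.
by apply: cvgP; exact: cl.
Qed.

Lemma ldir_cvg w K r z v : escape_region w K r -> inV r z ->
  exists2 l, forall n, nc (ldir w n z v - l) <= 2 * (K / nc z.2 * (nc2 v / nc z.2)) * hf ^+ n
    & geo_cvg (fun n => ldir w n z v) l.
Proof.
move=> [K1 r1 h] zV.
have [n m nm|l hl] := @geo_limitC R (fun n => ldir w n z v) (K / nc z.2 * (nc2 v / nc z.2)).
  by have [_ _ _] := h z zV n; apply.
by exists l => //; exists (2 * (K / nc z.2 * (nc2 v / nc z.2))).
Qed.

Lemma ldir_linear w n z (a b : C) (v1 v2 : C * C) :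
  ldir w n z (a * v1.1 + b * v2.1, a * v1.2 + b * v2.2) = a * ldir w n z v1 + b * ldir w n z v2.
Proof. by rewrite /ldir trun_linear /=; ring. Qed.

Lemma inV_open (r : R) z : r < nc z.2 -> nc z.1 < nc z.2 ->
  exists2 e, 0 < e & forall z', nc (z'.1 - z.1) <= e -> nc (z'.2 - z.2) <= e -> inV r z'.
Proof.
move=> h1 h2; pose e := Num.min (nc z.2 - r) ((nc z.2 - nc z.1) / 2).
exists e; first by rewrite lt_min subr_gt0 h1 divr_gt0 ?subr_gt0.
move=> z' /= e1 e2; have : e <= nc z.2 - r by rewrite ge_min lexx.
have : e <= (nc z.2 - nc z.1) / 2 by rewrite ge_min lexx orbT.
have t1 : nc z'.1 <= nc (z'.1 - z.1) + nc z.1 by apply: le_trans (ncD _ _); rewrite subrK.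
have t2 : nc z.2 <= nc (z'.2 - z.2) + nc z'.2.
  rewrite -(ncN (z'.2 - z.2)); apply: le_trans (ncD _ _); rewrite opprB subrK //.
by move=> t3 t4; apply/andP; split; lra.
Qed.

Lemma Re_mul_real (x : C) (a : R) : complex.Re (x * a%:C%C) = complex.Re x * a.
Proof. by case: x => u v; rewrite /= mulr0 subr0. Qed.

(** On the line [p + t v] the iterates are polynomials in [t], so [lgreen] is a multiple of some
    [ln |q|], with derivative the real part of [ldir]. The strict inequalities at [p] keep an
    interval of [t] inside the region, where convergence is uniform. *)
Lemma real_derive_green w K r c (G : C2 R -> R) (kap : R) (p v : C2 R) (lam : C) :
  escape_region w K r ->
  (forall q, inV r (run c (topair q)) -> G q = kap * green w (run c (topair q))) ->
  r < nc (run c (topair p)).2 -> nc (run c (topair p)).1 < nc (run c (topair p)).2 ->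
  geo_cvg (fun n => ldir w n (run c (topair p)) (trun c (topair p) (topair v))) lam ->
  real_derive G p v = kap * complex.Re lam.
Proof.
move=> esc hG h1 h2 [B hB]; have [K1 r1 hEs] := esc.
pose Z : {poly C} * {poly C} := ((p 0 0)%:P + v 0 0 *: 'X, (p 0 1)%:P + v 0 1 *: 'X).
pose X := prun c Z; pose V := ptrun c Z (pder Z).
have evZ (t : R) : pev Z t%:C%C = topair (p + t%:C%C *: v).
  by rewrite /pev /topair !hE !mxE; congr pair; rewrite mulrC.
have evX (t : R) : pev X t%:C%C = run c (topair (p + t%:C%C *: v)) by rewrite pev_run evZ.
have evX0 : pev X 0 = run c (topair p) by rewrite -(rmorph0 (real_complex R)) evX rmorph0 scale0r addr0.
have evV (t : R) : pev V t%:C%C = trun c (topair (p + t%:C%C *: v)) (topair v).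
  rewrite pev_trun evZ; congr trun.
  by rewrite /pev /pder /= !derivD !derivC !derivZ !derivX !hE !add0r !mulr1.
have evV0 : pev V 0 = trun c (topair p) (topair v).
  by rewrite -(rmorph0 (real_complex R)) evV rmorph0 scale0r addr0.
have [e e0 he] := inV_open h1 h2.
have [d1 d10 hd1] := poly_continuous X.1 e0; have [d2 d20 hd2] := poly_continuous X.2 e0.
have [d3 d30 hd3] := poly_continuous V.1 ltr01; have [d4 d40 hd4] := poly_continuous V.2 ltr01.
pose d := Num.min (Num.min d1 d2) (Num.min d3 d4).
have d0 : 0 < d by rewrite !lt_min d10 d20 d30 d40.
pose S := nc2 (pev V 0) + 2.
have near0 (t : R) : `|t| < d -> inV r (pev X t%:C%C) /\ nc2 (pev V t%:C%C) <= S.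
  rewrite !lt_min => /andP[/andP[t1 t2] /andP[t3 t4]]; split.
    by apply: he; rewrite -evX0; [exact: hd1|exact: hd2].
  have h3 := hd3 t t3; have h4 := hd4 t t4.
  have := ncD (V.1.[t%:C%C] - V.1.[0]) V.1.[0]; have := ncD (V.2.[t%:C%C] - V.2.[0]) V.2.[0].
  by rewrite !subrK /S /nc2 /pev /=; lra.
have [D eD] : exists D, wdeg w = D by exists (wdeg w).
have S0 : 0 <= S by rewrite addr_ge0 ?nc2_ge0.
have K0 : 0 <= K by lra.
have k0 := normr_ge0 kap; have B0 := normr_ge0 B.
rewrite /real_derive.
apply: (@derive1_limit R
  (fun n t => kap * lgreen w n (pev X t%:C%C))
  (fun n t => kap * complex.Re (ldir w n (pev X t%:C%C) (pev V t%:C%C)))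
  _ d (`|kap| * (K * S) + `|kap| * `|B|) _ d0).
- move=> n t td; have [tV _] := near0 t td.
  pose q := (prun (c ++ wpow w n) Z).2.
  have qE (s : C) : q.[s] = (run (wpow w n) (pev X s)).2.
    by rewrite -[LHS]/((pev (prun (c ++ wpow w n) Z) s).2) pev_run run_cat -pev_run.
  have q'E (s : C) : q^`().[s] = (trun (wpow w n) (pev X s) (pev V s)).2.
    rewrite -[LHS]/((pev (pder (prun (c ++ wpow w n) Z)) s).2) pder_run pev_trun trun_cat.
    by rewrite -pev_run -pev_trun.
  have q0 : q.[t%:C%C] != 0.
    rewrite qE -nc_gt0; have [_ + _ _] := hEs _ tV n; apply: lt_le_trans.
    rewrite mulr_gt0 ?exprn_gt0 //; case/andP: tV => + _; apply: lt_le_trans.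
    exact: lt_le_trans r1.
  have fE : (fun s : R => kap * lgreen w n (pev X s%:C%C)) =
      (kap / D%:R ^+ n) *: (fun s : R => ln (nc q.[s%:C%C])).
    apply/funext => s; rewrite -[RHS]/((kap / D%:R ^+ n) * ln (nc q.[s%:C%C])).
    by rewrite /lgreen eD -qE; ring.
  rewrite fE.
  have -> : kap * complex.Re (ldir w n (pev X t%:C%C) (pev V t%:C%C)) =
     (kap / D%:R ^+ n) *: complex.Re (q^`().[t%:C%C] / q.[t%:C%C]).
    rewrite /ldir eD -q'E -qE invfM mulrA mulrAC.
    have -> : (D%:R ^+ n)^-1 = ((D%:R ^+ n)^-1 : R)%:C%C :> C.
      by rewrite -exprVn -[in RHS]exprVn rmorphXn /= fmorphV rmorph_nat.
    by rewrite Re_mul_real /GRing.scale /=; ring.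
  by apply: is_deriveZ; apply: is_derive_ln_nc.
- move=> n m t nm td; have [tV tS] := near0 t td.
  rewrite -mulrBr normrM -raddfB.
  have y1 : 1 <= nc (pev X t%:C%C).2 by case/andP: tV => h _; apply: le_trans h.
  have [_ _ _ /(_ (pev V t%:C%C) m nm) h] := hEs _ tV n.
  apply: (@le_trans _ _ (`|kap| * (K * S * hf ^+ n))).
    rewrite ler_wpM2l //; apply: le_trans (nc_Re _) _; apply: le_trans h _.
    rewrite ler_wpM2r ?(ltW (hf_gt0 _ _)) //; apply: ler_pM.
    + by rewrite divr_ge0 ?nc_ge0.
    + by rewrite divr_ge0 ?nc_ge0 ?nc2_ge0.
    + by rewrite ler_pdivrMr ?(lt_le_trans ltr01) // ler_peMr.
    + by rewrite ler_pdivrMr ?(lt_le_trans ltr01) // (le_trans tS) // ler_peMr.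
  rewrite mulrDl mulrA lerDl !mulr_ge0 //; exact: ltW (hf_gt0 _ _).
- move=> t td; have [tV _] := near0 t td.
  rewrite hG -?evX //; apply: cvgM; first exact: cvg_cst.
  exact: lgreen_cvg esc tV.
- move=> n; rewrite rmorph0 evX0 evV0 -mulrBr normrM -raddfB.
  apply: (@le_trans _ _ (`|kap| * (`|B| * hf ^+ n))).
    rewrite ler_wpM2l //; apply: le_trans (nc_Re _) _; apply: le_trans (hB n) _.
    by rewrite ler_wpM2r ?ler_norm // ltW // hf_gt0.
  by rewrite mulrDl mulrA lerDr !mulr_ge0 // ltW // hf_gt0.
Qed.

(** The limit [L] of [ldir] is complex linear in the direction. The derivatives along [e_j] and
    [i e_j] are [kap Re L] and [- kap Im L], and their Wirtinger combination is [kap L / 2]. *)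
Lemma del_green w K r c (G : C2 R -> R) (kap : R) (p : C2 R) (lx ly : C) :
  escape_region w K r ->
  (forall q, inV r (run c (topair q)) -> G q = kap * green w (run c (topair q))) ->
  r < nc (run c (topair p)).2 -> nc (run c (topair p)).1 < nc (run c (topair p)).2 ->
  geo_cvg (fun n => ldir w n (run c (topair p)) (1, 0)) lx ->
  geo_cvg (fun n => ldir w n (run c (topair p)) (0, 1)) ly ->
  forall j, del G p 0 j = (kap / 2)%:C%C *
    (lx * (trun c (topair p) (topair (delta_mx 0 j))).1 +
     ly * (trun c (topair p) (topair (delta_mx 0 j))).2).
Proof.
move=> esc hG h1 h2 cx cy j; set T := trun c (topair p) (topair (delta_mx 0 j)).
have cT (a : C) : geo_cvg (fun n => ldir w n (run c (topair p)) (a * T.1, a * T.2))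
    (a * (lx * T.1 + ly * T.2)).
  have := geo_cvg_linear (a * T.1) (a * T.2) cx cy.
  rewrite (_ : a * T.1 * lx + a * T.2 * ly = a * (lx * T.1 + ly * T.2)); last by ring.
  rewrite (_ : (fun n => a * T.1 * ldir w n (run c (topair p)) (1, 0) +
       a * T.2 * ldir w n (run c (topair p)) (0, 1)) =
     (fun n => ldir w n (run c (topair p)) (a * T.1, a * T.2))) //.
  by apply/funext => n; rewrite -ldir_linear /= !mulr1 !mulr0 addr0 add0r.
have Ta (a : C) : trun c (topair p) (topair (a *: delta_mx 0 j)) = (a * T.1, a * T.2).
  have := trun_linear c (topair p) a 0 (topair (delta_mx 0 j)) (topair (delta_mx 0 j)).
  rewrite !mul0r !addr0 => <-; congr trun; by rewrite /topair !mxE.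
have rd a : real_derive G p (a *: delta_mx 0 j) = kap * complex.Re (a * (lx * T.1 + ly * T.2)).
  by apply: (real_derive_green esc hG h1 h2); rewrite Ta; apply: cT.
rewrite mxE -{1}[delta_mx 0 j]scale1r !rd mul1r.
case: (lx * T.1 + ly * T.2) => a b.
apply/eqP; rewrite eq_complex /=; apply/andP; split; apply/eqP; ring.
Qed.

Lemma norm2_nc2 (p : C2 R) : nc2 (topair p) / 2 <= norm2 p <= nc2 (topair p).
Proof.
have e : norm2 p ^+ 2 = nc (p 0 0) ^+ 2 + nc (p 0 1) ^+ 2.
  rewrite /norm2 sqr_sqrtr; last by rewrite sumr_ge0 // => i _; rewrite addr_ge0 ?sqr_ge0.
  rewrite !big_ord_recl big_ord0 addr0 !nc_sqr.
  by have -> : lift ord0 ord0 = 1 :> 'I_2 by apply/val_inj.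
have n0 : 0 <= norm2 p by rewrite sqrtr_ge0.
have := nc_ge0 (p 0 0); have := nc_ge0 (p 0 1); rewrite /nc2 /topair /=.
set a := nc (p 0 0) in e *; set b := nc (p 0 1) in e * => b0 a0; apply/andP; split.
  by rewrite -ler_sqr ?nnegrE ?divr_ge0 ?addr_ge0 // e; nra.
by rewrite -ler_sqr ?nnegrE ?addr_ge0 // e; nra.
Qed.

Lemma ln_close_pow (y N B : R) (c : nat) : 0 < y -> 0 < N -> 1 <= B ->
  y ^+ c <= 2 * B * N -> N <= B * y ^+ c -> `|ln N - c%:R * ln y| <= 2 * B.
Proof.
move=> y0 N0 B1 h1 h2; have B0 : 0 < B by lra.
have B20 : 0 < 2 * B by lra.
have yc0 : 0 < y ^+ c by rewrite exprn_gt0.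
move: h1 h2; rewrite -ler_ln ?posrE ?mulr_gt0 // lnM ?posrE // lnXn // -[ln y *+ c]mulr_natl => l1.
rewrite -ler_ln ?posrE ?mulr_gt0 // lnM ?posrE // lnXn // -[ln y *+ c]mulr_natl => l2.
have := ln_sublinear B20; have := ln_sublinear B0; rewrite ler_norml; lra.
Qed.

(** After [n + N0] steps the point is [psi] after [w^N0], applied to [w^n z]. By
    [monomial_growth_tail] its norm is comparable to [|y_n| ^ c0], so its logarithm is
    [c0 ln |y_n| + O(1)]; the shift by [N0] divides by [D ^ N0]. *)
Lemma green_limit (E : C2 R -> C2 R) psi c w :
  all (@lok _) psi -> all (@hyper _) w -> (0 < size w)%N ->
  (forall p, topair (E p) = run psi (run w (run c (topair p)))) ->
  (forall z, run c (run psi z) = z) ->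
  exists r kap : R, forall p, inV r (run c (topair p)) ->
    (forall M, exists n, M < norm2 (iter n E p)) /\
    limn (fun n => (wdeg w)%:R ^- n * logp (norm2 (iter n E p))) =
      kap * green w (run c (topair p)).
Proof.
move=> po hw sw eE ck.
have [K [r0 esc]] := orbit_estimates hw sw; have [K1 r01 hEs] := esc.
have it n p : run c (topair (iter n E p)) = run (wpow w n) (run c (topair p)).
  by elim: n => // n IH; rewrite iterS eE ck IH wpowSr run_cat.
have itE n p : topair (iter n.+1 E p) = run psi (run (wpow w n.+1) (run c (topair p))).
  by rewrite iterS eE it wpowSr run_cat.
(* Enough copies of [w] to absorb [psi], and a positive number, as [itE] describes nonzero
   iterates. *)
have [N0 eN0] : exists N0, N0 = (size psi).+1 by exists (size psi).+1.
have hN0 : all (@hyper _) (wpow w N0).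
  by elim: (N0) => // k IH; rewrite /wpow /= all_cat hw.
have sN0 : (size psi <= size (wpow w N0))%N.
  have -> : size (wpow w N0) = (N0 * size w)%N.
    by elim: (N0) => // k IH; rewrite /wpow /= size_cat -/(wpow w k) IH mulSn.
  by apply: leq_trans (leq_pmulr _ sw); rewrite eN0 leqnSn.
have [c0 c00 [K' [r' [K'1 r'1 hg]]]] := monomial_growth_tail po (lok_lid _) hN0 sN0.
have [D eD] : exists D, wdeg w = D by exists (wdeg w).
have D1 : (1 < D)%N by rewrite -eD wdeg_gt1.
have D2 : 2 <= D%:R :> R by rewrite ler_nat.
have D0 : 0 < D%:R :> R by lra.
(* The term [4 * K'] makes the norm after [n + N0] steps at least [2 ^ n]: the orbit is unbounded
   and [logp] agrees with [ln] on it. *)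
exists (r0 + r' + 4 * K'), (c0%:R / D%:R ^+ N0) => p pV.
set z := run c (topair p) in pV *.
have z0 : inV r0 z by apply: inV_le pV; lra.
have itN n : topair (iter (n + N0) E p) = run psi (tri (lid _) (run (wpow w N0) (run (wpow w n) z))).
  rewrite [in LHS]eN0 addnS itE -addnS -eN0 tri_lid.
  rewrite (_ : wpow w (n + N0) = wpow w n ++ wpow w N0) ?run_cat //.
  by rewrite /wpow nseqD flatten_cat.
have est n : let N := norm2 (iter (n + N0) E p) in
   [/\ 2 ^+ n <= N & `|ln N - c0%:R * ln (nc (run (wpow w n) z).2)| <= 2 * K'].
  move=> N; have [zn1 zn2 _ _] := hEs z z0 n.
  have y4 : 2 ^+ n * (4 * K') <= nc (run (wpow w n) z).2.
    apply: le_trans zn2; rewrite ler_wpM2l //; case/andP: pV => h _; apply: le_trans h; lra.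
  have p2n : 1 <= 2 ^+ n :> R by rewrite exprn_ege1 // ler1n.
  have znV : inV r' (run (wpow w n) z).
    case/andP: zn1 => _ h; rewrite /inV h andbT; apply: le_trans zn2.
    case/andP: pV => h' _; have nz := nc_ge0 z.2.
    by apply: (@le_trans _ _ (nc z.2)); [lra|rewrite ler_peMl].
  have [g1 g2] := hg _ znV; have /andP[n1 n2] := norm2_nc2 (iter (n + N0) E p).
  rewrite itN -/N in n1 n2; set y := nc (run (wpow w n) z).2 in y4 g1 g2 *.
  set M := nc2 _ in g1 g2 n1 n2.
  have y1 : 1 <= y.
    by apply: le_trans y4; move: (2 ^+ n) p2n => a a1; nra.
  have yc : y <= y ^+ c0 by apply: ler_eXnr.
  have yc0 : 0 < y ^+ c0 by rewrite exprn_gt0 //; lra.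
  have yN : y ^+ c0 <= 2 * K' * N.
    by apply: le_trans g1 _; rewrite [2 * K']mulrC -mulrA ler_wpM2l //; lra.
  have N1 : 2 ^+ n <= N.
    rewrite -(@ler_pM2l _ (2 * K')); last by lra.
    apply: le_trans yN; apply: le_trans yc; apply: le_trans y4; nra.
  have N0' : 0 < N by lra.
  split=> //.
  by apply: ln_close_pow => //; [lra|apply: le_trans n2 g2].
split.
  move=> M; exists (Num.bound M + N0)%N; have [h _] := est (Num.bound M).
  have hM : M < (Num.bound M)%:R.
    apply: le_lt_trans (ler_norm M) _.
    by have := archi_boundP (normr_ge0 M); rewrite /Num.bound normr_id.
  apply: lt_le_trans hM _; apply: le_trans h.
  by rewrite -natrX ler_nat ltnW // ltn_expl.
apply/cvg_lim; first exact: Rhausdorff.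
apply/cvgn_epsP => e e0; rewrite eD.
have kap0 : 0 <= c0%:R / D%:R ^+ N0 :> R by rewrite divr_ge0 // exprn_ge0 // ltW.
set kap := c0%:R / _ in kap0 *.
have k1 : 0 < kap + 1 by lra.
have e2 : 0 < e / 2 / (kap + 1) by rewrite !divr_gt0.
have e3 : 0 < e / 2 by rewrite divr_gt0.
have /cvgn_epsP/(_ _ e2)[M1 hM1] := lgreen_cvg esc z0.
have [M2 hM2] := hf_small (2 * K') e3.
exists (maxn M1 M2 + N0)%N => n' nn.
have [n en] : exists n, n' = (n + N0)%N.
  by exists (n' - N0)%N; rewrite subnK //; apply: leq_trans nn; rewrite leq_addl.
move: nn; rewrite en leq_add2r geq_max => /andP[nM1 nM2].
have [N1 hN] := est n; set N := norm2 _ in N1 hN *.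
have p2n : 1 <= 2 ^+ n :> R by rewrite exprn_ege1 // ler1n.
have -> : logp N = ln N.
  by rewrite /logp max_r // ln_ge0 //; apply: le_trans N1.
have Dn0 : 0 < D%:R ^+ n :> R by rewrite exprn_gt0.
have DN0 : 0 < D%:R ^+ N0 :> R by rewrite exprn_gt0.
have -> : kap * green w z - D%:R ^- (n + N0) * ln N = kap * (green w z - lgreen w n z)
   - (ln N - c0%:R * ln (nc (run (wpow w n) z).2)) / D%:R ^+ (n + N0).
  rewrite /lgreen eD /kap exprD; move: (D%:R ^+ n) (D%:R ^+ N0) Dn0 DN0 => a b a0 b0.
  by field; rewrite !gt_eqF.
apply: le_trans (ler_normB _ _) _.
have q1 : `|kap * (green w z - lgreen w n z)| <= e / 2.
  rewrite normrM ger0_norm //; have h := hM1 n nM1.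
  apply: (@le_trans _ _ ((kap + 1) * (e / 2 / (kap + 1)))).
    by apply: ler_pM => //; lra.
  by rewrite mulrCA divff ?mulr1 // gt_eqF.
have q2 : `|(ln N - c0%:R * ln (nc (run (wpow w n) z).2)) / D%:R ^+ (n + N0)| <= e / 2.
  apply: le_trans (hM2 n nM2); rewrite normrM; apply: ler_pM => //.
  rewrite gtr0_norm ?invr_gt0 ?exprn_gt0 // -exprVn exprD.
  apply: (@le_trans _ _ (D%:R^-1 ^+ n)).
    rewrite ler_piMr ?exprn_ge0 ?invr_ge0 ?(ltW D0) // exprn_ile1 ?invr_ge0 ?(ltW D0) // invf_le1 //; lra.
  by apply: lerXn2r; rewrite ?nnegrE ?invr_ge0 ?ler0n // lef_pV2 ?posrE.
lra.
Qed.

End Green.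

(** * Zeros of perturbed polynomials *)

Section Rouche.
Variable R : realType.
Local Notation C := R[i].
Local Notation nc := (@normc R).
Local Notation hf := (2^-1 : R).
Implicit Types (p q f : {poly C}) (x s : C).

Lemma size_even_poly_lt f : (1 < size f)%N -> (size (even_poly f) < size f)%N.
Proof.
move=> sf; apply: leq_ltn_trans (size_even_poly _) _.
by case: (size f) sf => [|[|n]] //= _; rewrite uphalf_half; lia.
Qed.

(* Squaring the circle of radius rho kills the odd part of f, and the even part has
   about half the degree. *)
Lemma circle_mean f (rho B : R) : 0 <= rho ->
  (forall x, nc x = rho -> nc f.[x] <= B) -> nc f.[0] <= B.
Proof.
have [n] := ubnP (size f); elim: n f rho => // n IH f rho sf rho0 h.
have [f1|f1] := leqP (size f) 1.
  have := h rho%:C%C; rewrite ncC ger0_norm // => /(_ erefl).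
  by rewrite (size1_polyC f1) !hornerC.
have fE x : f.[x] = (even_poly f).[x ^+ 2] + (odd_poly f).[x ^+ 2] * x.
  rewrite -{1}(poly_even_odd f) hornerD hornerM hornerX !horner_comp hornerXn.
  by [].
have := fE 0; rewrite expr0n /= mulr0 addr0 => ->.
apply: (IH (even_poly f) (rho ^+ 2)); rewrite ?exprn_ge0 //.
  by rewrite -ltnS; apply: leq_trans (size_even_poly_lt f1) _.
(* The even part at [w] is the mean of [f] over the two square roots of [w], so it inherits the
   bound on the circle of radius [rho ^+ 2]. *)
move=> w nw; pose x := sqrtc w.
have x2 : x ^+ 2 = w by apply: sqr_sqrtc.
have nx : nc x = rho.
  by apply/eqP; rewrite -(@eqrXn2 _ 2) ?nc_ge0 // -ncX x2 nw.
have h1 := h x nx; have nNx : nc (- x) = rho by rewrite ncN.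
have h2 := h (- x) nNx.
have e2 : (even_poly f).[w] = (f.[x] + f.[- x]) / 2.
  by rewrite !fE sqrrN x2; field.
rewrite e2 normcM normcV (_ : nc 2 = 2); last by rewrite nc_nat.
by rewrite ler_pdivrMr //; apply: le_trans (ncD _ _) _; lra.
Qed.

(** One root is removed at a time. Division by [x - r] is replaced by multiplication by the
    truncated geometric sum [S], for which [(x - r) S = x^(k+1) - r^(k+1)]. The loss at the centre
    is the factor [1 + (rho / |r|)^(k+1)], which tends to 1. *)
Lemma max_modulus_roots (rs : seq C) f (rho th : R) : 0 <= rho -> 0 <= th ->
  (forall r, r \in rs -> rho < nc r) ->
  (forall x, nc x = rho -> nc f.[x] <= th * nc (\prod_(r <- rs) ('X - r%:P)).[x]) ->
  nc f.[0] <= th * nc (\prod_(r <- rs) ('X - r%:P)).[0].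
Proof.
move=> rho0; elim: rs f th => [|r rs IH] f th th0 hr h.
  rewrite big_nil hornerC normc1 mulr1; apply: (circle_mean rho0) => x nx.
  by have := h x nx; rewrite big_nil hornerC normc1 mulr1.
have rr : rho < nc r by apply: hr; rewrite mem_head.
have r0 : 0 < nc r by apply: le_lt_trans rr.
rewrite big_cons hornerM hornerXsubC sub0r normcM ncN.
set P := \prod_(r <- rs) _ in IH *.
have P0 := nc_ge0 P.[0].
apply/ler_addgt0Pr => e e0.
pose Q := th * nc r * nc P.[0].
have Q0 : 0 <= Q by rewrite !mulr_ge0 // ltW.
have qlt : `|rho / nc r| < 1.
  by rewrite ger0_norm ?divr_ge0 ?(ltW r0) // ltr_pdivrMr // mul1r.
have e1 : 0 < e / (Q + 1) by rewrite divr_gt0 //; lra.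
have /cvgn_epsP/(_ _ e1)[k hk] := cvg_expr qlt.
have {hk} := hk k.+1 (leqnSn k); rewrite sub0r normrN ger0_norm; last first.
  by rewrite exprn_ge0 // divr_ge0 // ltW.
set g := (rho / nc r) ^+ k.+1 => hg.
have g0 : 0 <= g by rewrite exprn_ge0 // divr_ge0 // ltW.
pose S : {poly C} := \sum_(i < k.+1) 'X^(k - i) * (r%:P) ^+ i.
have SE : 'X^(k.+1) - (r ^+ k.+1)%:P = ('X - r%:P) * S.
  by rewrite rmorphXn /= subrXX.
have := IH (f * S) (th * (rho ^+ k.+1 + nc r ^+ k.+1)) _ _ _.
have t0 : 0 <= th * (rho ^+ k.+1 + nc r ^+ k.+1).
  by rewrite mulr_ge0 // addr_ge0 // exprn_ge0 // ltW.
have mem r' : r' \in rs -> rho < nc r' by move=> r'rs; apply: hr; rewrite inE r'rs orbT.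
have bnd x : nc x = rho -> nc (f * S).[x] <= th * (rho ^+ k.+1 + nc r ^+ k.+1) * nc P.[x].
  move=> nx; rewrite hornerM normcM.
  apply: (@le_trans _ _ (th * nc (('X - r%:P) * P).[x] * nc S.[x])).
    by rewrite ler_wpM2r ?nc_ge0 //; have := h x nx; rewrite big_cons.
  rewrite hornerM normcM; have -> : th * (nc ('X - r%:P).[x] * nc P.[x]) * nc S.[x] =
    th * nc (('X - r%:P) * S).[x] * nc P.[x] by rewrite hornerM normcM; ring.
  rewrite ler_wpM2r ?nc_ge0 // ler_wpM2l // -SE !hE.
  by apply: le_trans (ncB _ _) _; rewrite !ncX nx.
move=> /(_ t0 mem bnd).
have S0 : S.[0] = r ^+ k.
  apply: (@mulfI _ (- r)); first by rewrite oppr_eq0 -nc_gt0.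
  have := congr1 (fun p : {poly C} => p.[0]) SE.
  rewrite hornerM !hE expr0n /= !sub0r exprS => <-; ring.
rewrite hornerM normcM S0 ncX => h3.
have rk : 0 < nc r ^+ k by rewrite exprn_gt0.
have h4 : nc f.[0] <= Q * (1 + g).
  rewrite -(ler_pM2r rk); apply: le_trans h3 _; rewrite le_eqVlt; apply/orP; left; apply/eqP.
  rewrite /Q /g expr_div_n exprS; rewrite [nc r ^+ k.+1]exprS.
  by field; rewrite !gt_eqF.
apply: le_trans h4 _; rewrite mulrDr mulr1 /Q -!mulrA lerD2l mulrA.
have : g <= e / (Q + 1) by [].
rewrite ler_pdivlMr; last by lra.
by rewrite -/Q /Q; nra.
Qed.

Lemma max_modulus (N T : {poly C}) (rho th : R) : 0 <= rho -> 0 <= th ->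
  (forall x, nc x <= rho -> T.[x] != 0) ->
  (forall x, nc x = rho -> nc N.[x] <= th * nc T.[x]) ->
  nc N.[0] <= th * nc T.[0].
Proof.
move=> rho0 th0 T0 h; have [rs eT] := closed_field_poly_normal T.
have l0 : 0 < nc (lead_coef T).
  rewrite nc_gt0 lead_coef_eq0; apply/eqP => z; have := T0 0; rewrite z horner0 eqxx normc0.
  by move=> /(_ rho0).
have hT x : nc T.[x] = nc (lead_coef T) * nc (\prod_(z <- rs) ('X - z%:P)).[x].
  by rewrite {1}eT hornerZ normcM.
rewrite hT mulrA; apply: (@max_modulus_roots rs N rho _ rho0).
- by rewrite mulr_ge0 // ltW.
- move=> r rrs; rewrite ltNge; apply/negP => /T0/negP; apply.
  by rewrite -[_ == 0]/(root T r) eT rootZ -?nc_gt0 // root_prod_XsubC.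
- by move=> x nx; rewrite -mulrA -hT; apply: h.
Qed.

(** If [T = q M - N] had no zero, the maximum principle would apply to [N / T]. On the circle
    [|T| >= 3 |N| - |N|], so the quotient is at most [1/2]; at the centre [q] vanishes and
    [T = - N], which forces [T = 0] there. *)
Lemma root_perturb (q M N : {poly C}) (rho : R) : 0 <= rho -> q.[0] = 0 ->
  (forall x, nc x = rho -> 1 <= nc q.[x]) ->
  (forall x, nc x <= rho -> M.[x] != 0 /\ 3 * nc N.[x] <= nc M.[x]) ->
  exists2 x, nc x <= rho & q.[x] * M.[x] = N.[x].
Proof.
move=> rho0 q0 hq hM; apply: contrapT => no.
pose T := q * M - N.
have T0 x : nc x <= rho -> T.[x] != 0.
  move=> xr; apply/eqP => z; apply: no; exists x => //; apply/eqP.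
  by move: z; rewrite /T !hE => /eqP; rewrite subr_eq0.
have := @max_modulus N T rho 2^-1 rho0 _ T0 _.
have h2 : 0 <= 2^-1 :> R by [].
have circle x : nc x = rho -> nc N.[x] <= 2^-1 * nc T.[x].
  move=> nx; have xr : nc x <= rho by rewrite nx.
  have [_ h3] := hM x xr; have h1 := hq x nx.
  have := ncB_ge (q.[x] * M.[x]) N.[x]; rewrite normcM => h4.
  have h5 : nc M.[x] <= nc q.[x] * nc M.[x] by rewrite ler_peMl // nc_ge0.
  by rewrite /T !hE; lra.
move=> /(_ h2 circle).
have -> : T.[0] = - N.[0] by rewrite /T !hE q0 mul0r sub0r.
rewrite ncN => h6; have n0 := nc_ge0 N.[0].
have zN : N.[0] = 0 by apply: eq0_normc; lra.
have := T0 0; rewrite normc0 => /(_ rho0).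
by rewrite /T !hE q0 mul0r zN subr0 eqxx.
Qed.

Lemma poly_bound_disc p (rho : R) : exists2 K, 0 <= K & forall x, nc x <= rho -> nc p.[x] <= K.
Proof.
exists (\sum_(i < size p) nc p`_i * `|rho| ^+ i).
  by rewrite sumr_ge0 // => i _; rewrite mulr_ge0 ?nc_ge0 ?exprn_ge0.
move=> x xr; rewrite horner_coef; apply: le_trans (nc_sum _) _; apply: ler_sum => i _.
rewrite normcM ncX ler_wpM2l ?nc_ge0 //; apply: lerXn2r; rewrite ?nnegrE ?nc_ge0 //.
exact: le_trans (ler_norm _).
Qed.

Lemma bounded_subsequence (u : nat -> R) (M : R) : (forall n, `|u n| <= M) ->
  exists f : nat -> nat, (forall n, (n <= f n)%N) /\ exists l : R, (u \o f) @ \oo --> l.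
Proof.
move=> hu; have [|f fi fc] := @bolzano_weierstrass R u.
  exists M; split; first by rewrite num_real.
  by move=> x Mx y _ /=; apply: le_trans (hu y) (ltW Mx).
exists f; split; last by exists (limn (u \o f)).
elim=> // n IH; apply: leq_ltn_trans IH _; rewrite ltnNge.
by have := fi n.+1 n; rewrite !leEnat ltnn => ->.
Qed.

Lemma complex_subsequence (s : nat -> C) (M : R) : (forall n, nc (s n) <= M) ->
  exists x, nc x <= M /\
    forall e, 0 < e -> forall N, exists2 n, (N <= n)%N & nc (s n - x) < e.
Proof.
move=> hs.
have [n|f1 [f1n [a ha]]] := @bounded_subsequence (fun n => complex.Re (s n)) M.
  exact: le_trans (nc_Re _) (hs n).
have [n|f2 [f2n [b hb]]] := @bounded_subsequence (fun n => complex.Im (s (f1 n))) M.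
  exact: le_trans (nc_Im _) (hs _).
have main e : 0 < e -> forall N, exists2 n, (N <= n)%N & nc (s n - Complex a b) < e.
  move=> e0 N; have e3 : 0 < e / 3 by rewrite divr_gt0.
  have /cvgn_epsP/(_ _ e3)[N1 h1] := ha; have /cvgn_epsP/(_ _ e3)[N2 h2] := hb.
  pose k := maxn N (maxn N1 N2).
  have k1 : (N1 <= f2 k)%N by apply: leq_trans (f2n k); rewrite !leq_max leqnn orbT.
  have k2 : (N2 <= k)%N by rewrite !leq_max leqnn !orbT.
  exists (f1 (f2 k)); first by apply: leq_trans (f1n _); apply: leq_trans (f2n _); rewrite leq_max leqnn.
  apply: le_lt_trans (nc_ReIm _) _; rewrite !raddfB /=.
  have t1 := h1 _ k1; have t2 := h2 _ k2; rewrite /= distrC in t1; rewrite /= distrC in t2.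
  lra.
exists (Complex a b); split=> //; apply/ler_addgt0Pr => e e0.
have [n _ hn] := main e e0 0%N.
have h : nc (Complex a b) <= nc (s n) + nc (s n - Complex a b).
  by apply: le_trans (ncB _ _); rewrite opprB addrC subrK.
by have := hs n; lra.
Qed.

(** The zeros stay in a disc and accumulate at some [s]. At the zero of [P n] the Cauchy bound says
    that [P m / Q m] is at most [B 2^-m], and continuity for fixed [m] carries this to [s]. *)
Lemma zero_of_limit (P Q : nat -> {poly C}) (rho B : R) : 0 <= rho ->
  (forall n, exists2 s, nc s <= rho & (P n).[s] = 0) ->
  (forall n s, nc s <= rho -> (Q n).[s] != 0) ->
  (forall m n s, (m <= n)%N -> nc s <= rho ->
     nc ((P n).[s] / (Q n).[s] - (P m).[s] / (Q m).[s]) <= B * hf ^+ m) ->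
  exists2 s, nc s <= rho & geo_cvg (fun n => (P n).[s] / (Q n).[s]) 0.
Proof.
move=> rho0 hz hQ hc.
pose s n := s2val (cid2 (hz n)).
have sr n : nc (s n) <= rho by rewrite /s; case: cid2.
have sz n : (P n).[s n] = 0 by rewrite /s; case: cid2.
have [x [xr hx]] := complex_subsequence sr.
exists x => //; exists B => m; rewrite subr0 normcM normcV.
have Q0 : 0 < nc (Q m).[x] by rewrite nc_gt0 hQ.
rewrite ler_pdivrMr //; apply/ler_addgt0Pr => e e0.
have Bm : 0 <= B * hf ^+ m.
  by apply: le_trans (hc m m x (leqnn _) xr); apply: nc_ge0.
set b := B * hf ^+ m in Bm *.
have e1 : 0 < e / (1 + b) by rewrite divr_gt0 //; lra.
have [d1 d10 hd1] := poly_continuousC (P m) x e1.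
have [d2 d20 hd2] := poly_continuousC (Q m) x e1.
have d0 : 0 < Num.min d1 d2 by rewrite lt_min d10.
have [n mn] := hx _ d0 m; rewrite lt_min => /andP[n1 n2].
have h1 := hd1 _ n1; have h2 := hd2 _ n2.
have := hc m n (s n) mn (sr n); rewrite sz mul0r sub0r ncN normcM normcV -/b => h3.
have Qn : 0 < nc (Q m).[s n] by rewrite nc_gt0 hQ.
rewrite ler_pdivrMr // in h3.
have h4 : nc (P m).[x] <= nc (P m).[s n] + nc ((P m).[s n] - (P m).[x]).
  by apply: le_trans (ncB _ _); rewrite opprB addrC subrK.
have h5 : nc (Q m).[s n] <= nc (Q m).[x] + nc ((Q m).[s n] - (Q m).[x]).
  by apply: le_trans (ncD _ _); rewrite addrC subrK.
have h6 : b * nc (Q m).[s n] <= b * (nc (Q m).[x] + e / (1 + b)).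
  by rewrite ler_wpM2l //; lra.
have h7 : e / (1 + b) * (1 + b) = e by rewrite divfK // gt_eqF //; lra.
by rewrite mulrDr in h6; rewrite mulrDr mulr1 in h7; lra.
Qed.

(** The circle is taken large, where growth at infinity makes [|p| >= 1], so multiple and clustered
    roots are treated like a simple one. *)
Lemma exists_root_circle p : (1 < size p)%N ->
  exists x0 rho, [/\ 0 <= rho, p.[x0] = 0 & forall s, nc s = rho -> 1 <= nc p.[x0 + s]].
Proof.
move=> sp.
have [x0 rx] : exists x, root p x by apply/closed_rootP; case: (size p) sp => [|[]].
pose q := p \Po ('X + x0%:P).
have sq : size q = (size p).-2.+2.
  rewrite size_comp_poly2; last by rewrite size_XaddC.
  by case: (size p) sp => [|[]].
have [c [r [c0 r1 low]]] := poly_lower sq.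
exists x0, (r + c^-1); split; first by rewrite addr_ge0 ?invr_ge0 //; lra.
  exact/eqP.
move=> s ns; have ci : 0 < c^-1 by rewrite invr_gt0.
have -> : p.[x0 + s] = q.[s] by rewrite /q horner_comp !hE addrC.
apply: le_trans (low s _); rewrite ns; last by lra.
apply: (@le_trans _ _ (c * (r + c^-1))).
  by rewrite mulrDr mulfV ?gt_eqF // lerDr mulr_ge0 //; lra.
by rewrite ler_wpM2l ?(ltW c0) //; apply: ler_eXnr => //; lra.
Qed.

Lemma geo_cvgM u v l m : geo_cvg u l -> geo_cvg v m ->
  geo_cvg (fun n => u n * v n : C) (l * m).
Proof.
move=> [A hA] [B hB]; exists (`|A| * (nc m + `|B|) + nc l * `|B|) => n.
have h0 := hf_gt0 R n; have h1 : hf ^+ n <= 1 by rewrite exprn_ile1 // invf_le1 // ler1n.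
have hA' : nc (u n - l) <= `|A| * hf ^+ n.
  by apply: le_trans (hA n) _; rewrite ler_wpM2r ?ler_norm // ltW.
have hB' : nc (v n - m) <= `|B| * hf ^+ n.
  by apply: le_trans (hB n) _; rewrite ler_wpM2r ?ler_norm // ltW.
have vb : nc (v n) <= nc m + `|B|.
  have := ncD (v n - m) m; rewrite subrK => h; apply: le_trans h _.
  by rewrite addrC lerD2l; apply: le_trans hB' _; rewrite ler_piMr.
have -> : u n * v n - l * m = (u n - l) * v n + l * (v n - m) by ring.
apply: le_trans (ncD _ _) _; rewrite !normcM mulrDl; apply: lerD.
  rewrite mulrAC; apply: ler_pM; rewrite ?nc_ge0 //.
by rewrite -mulrA ler_wpM2l ?nc_ge0.
Qed.

End Rouche.

(** * A critical pair *)

Section Critical.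
Variable R : realType.
Local Notation C := R[i].
Local Notation nc := (@normc R).
Local Notation hf := (2^-1 : R).
Implicit Types (z v : C * C) (w : seq (letter R[i])).

Lemma product_cauchy (a b a' b' : C) (B e : R) : nc b <= B -> nc a' <= B ->
  nc (a - a') <= e -> nc (b - b') <= e -> nc (a * b - a' * b') <= 2 * B * e.
Proof.
move=> hb ha' ha hb'.
have -> : a * b - a' * b' = (a - a') * b + a' * (b - b') by ring.
have B0 : 0 <= B by apply: le_trans hb; apply: nc_ge0.
have h1 : nc (a - a') * nc b <= e * B by apply: ler_pM; rewrite ?nc_ge0.
have h2 : nc a' * nc (b - b') <= B * e by apply: ler_pM; rewrite ?nc_ge0.
by apply: le_trans (ncD _ _) _; rewrite !normcM; lra.
Qed.

(** [ldir] starts at [v.2 / y] and moves by at most [K / |y|^2] on unit vectors. Hence it stays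
    comparable to [1 / y] in direction [(0, 1)] and is [O(1 / y^2)] in direction [(1, 0)]. *)
Lemma ldir_bounds w K r z n : escape_region w K r -> inV r z -> 2 * K <= nc z.2 ->
  [/\ nc (ldir w n z (0, 1)) <= 2, nc (ldir w n z (1, 0)) <= 2,
      ldir w n z (0, 1) != 0 &
      nc (ldir w n z (1, 0)) <= 2 * K / nc z.2 * nc (ldir w n z (0, 1))].
Proof.
move=> [K1 r1 hEs] zV yK; have y0 : 0 < nc z.2 by lra.
have z20 : z.2 != 0 by rewrite -nc_gt0.
have l0 v : ldir w 0 z v = v.2 / z.2 by rewrite /ldir /= expr0 mul1r.
have yi : 0 < (nc z.2)^-1 by rewrite invr_gt0.
have Ky : K / nc z.2 <= 2^-1 by rewrite ler_pdivrMr //; lra.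
have Ky0 : 0 <= K / nc z.2 by rewrite divr_ge0 //; lra.
have d v : nc v.1 + nc v.2 = 1 -> nc (ldir w n z v - v.2 / z.2) <= K / nc z.2 * (nc z.2)^-1.
  move=> v1; have [_ _ _ /(_ v n (leq0n n))] := hEs z zV 0%N.
  by rewrite l0 expr0 mulr1 /nc2 v1 mul1r.
have i1 : (nc z.2)^-1 <= 1 by rewrite invf_le1 //; lra.
have d0 := d (1, 0); rewrite /= normc1 normc0 addr0 mul0r subr0 in d0; have {}d0 := d0 erefl.
have d1 := d (0, 1); rewrite /= normc1 normc0 add0r mul1r in d1; have {}d1 := d1 erefl.
have vz : nc z.2^-1 = (nc z.2)^-1 by rewrite normcV.
have q : K / nc z.2 * (nc z.2)^-1 <= 2^-1 * (nc z.2)^-1 by rewrite ler_pM2r.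
have low : 2^-1 * (nc z.2)^-1 <= nc (ldir w n z (0, 1)).
  have := ncB_ge z.2^-1 (z.2^-1 - ldir w n z (0, 1)).
  rewrite (_ : z.2^-1 - (z.2^-1 - ldir w n z (0, 1)) = ldir w n z (0, 1)); last by ring.
  have -> : nc (z.2^-1 - ldir w n z (0, 1)) = nc (ldir w n z (0, 1) - z.2^-1).
    by rewrite -ncN opprB.
  by rewrite vz; lra.
split.
- have := ncD (ldir w n z (0, 1) - z.2^-1) z.2^-1; rewrite subrK vz; lra.
- by lra.
- by rewrite -nc_gt0; apply: lt_le_trans low; rewrite mulr_gt0.
apply: le_trans d0 _; rewrite [2 * K]mulrC -!mulrA ler_wpM2l //; first by lra.
rewrite mulrCA ler_pM2l //; lra.
Qed.


(* The zero is sought near a critical point x of the polynomial of l, with the other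
   coordinate t very large: there the equation is a small perturbation of p'(x) = 0. *)
Lemma critical_pair w w' (l : letter R[i]) (K r K' r' : R) : hyper l ->
  escape_region w K r -> escape_region w' K' r' ->
  exists z : C * C, [/\ r < nc z.2 /\ nc z.1 < nc z.2,
     r' < nc (step l (swap z)).2 /\ nc (step l (swap z)).1 < nc (step l (swap z)).2 &
     exists a b a' b' : C,
       [/\ geo_cvg (fun n => ldir w n z (1, 0)) a, geo_cvg (fun n => ldir w n z (0, 1)) b,
           geo_cvg (fun n => ldir w' n (step l (swap z)) (1, 0)) a',
           geo_cvg (fun n => ldir w' n (step l (swap z)) (0, 1)) b' &
           a * (la l * b') - b * (lb l * a' + (lp l)^`().[z.1] * b') = 0]].
Proof.
case: l => p al be ga /andP[/andP[/= al0 be0] sp] esc esc'.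
have [K1 r1 hEs] := esc; have [K'1 r'1 hEs'] := esc'.
have sp' : (1 < size p^`())%N.
  have : p^`()`_(size p).-2 != 0.
    rewrite coef_deriv -mulr_natr; apply: mulf_neq0; last by rewrite pnatr_eq0.
    have -> : (size p).-2.+1 = (size p).-1 by case: (size p) sp => [|[]].
    by rewrite -/(lead_coef p) lead_coef_eq0 -size_poly_gt0; case: (size p) sp.
  apply: contraNltn => h; rewrite nth_default //; apply: leq_trans h _.
  by case: (size p) sp => [|[|[]]].
have [x0 [rho [rho0 px0 circ]]] := exists_root_circle sp'.
pose q := p^`() \Po ('X + x0%:P).
have qE s : q.[s] = p^`().[x0 + s] by rewrite /q horner_comp !hE addrC.
have [Kq Kq0 hKq] := poly_bound_disc q rho.
have [Kp Kp0 hKp] := poly_bound_disc (p \Po ('X + x0%:P)) rho.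
have nal : 0 < nc al by rewrite nc_gt0.
have nbe : 0 < nc be by rewrite nc_gt0.
pose KK := K + K'.
pose Xm := nc x0 + rho; have Xm0 : 0 <= Xm by rewrite addr_ge0 ?nc_ge0.
(* The term with factor 12 keeps each of the two error terms below one sixth of the product of the
   [dy] coefficients; the others place both points in their regions. In [t], the summand
   [(Kp + T1) / nc al] ensures [|al t + p(x)| >= T1] on the disc. *)
pose T1 := r + r' + 12 * KK * (1 + nc al + nc be) + Xm + nc be * Xm + nc ga + 1.
pose t := T1 + (Kp + T1) / nc al.
have ga0 := nc_ge0 ga; have bx : 0 <= nc be * Xm by rewrite mulr_ge0 // ltW.
have KK2 : 2 <= KK by rewrite /KK; lra.
have KKa : 0 <= KK * (nc al + nc be) by rewrite mulr_ge0; lra.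
have T1b : [/\ 0 <= T1, r < T1, r' < T1, Xm < T1 & nc be * Xm + nc ga < T1 /\ 12 * KK * (1 + nc al + nc be) <= T1].
  have : 12 * KK * (1 + nc al + nc be) = 12 * KK + 12 * (KK * (nc al + nc be)) by ring.
  by rewrite /T1 => ->; clear - KKa KK2 r1 r'1 Xm0 ga0 bx; split; [| | | |split]; lra.
have [T10 T1r T1r' T1X [T1g T1K]] := T1b.
clearbody T1.
have T1r1 : 1 <= T1 by lra.
have tT1 : T1 <= t by rewrite lerDl divr_ge0 ?(ltW nal) //; lra.
have alt : Kp + T1 <= nc al * t.
  rewrite /t mulrDr [X in _ <= _ + X]mulrC divfK ?gt_eqF // lerDr mulr_ge0 // ltW //.
have t0 : 0 <= t by lra.
have nt : nc t%:C%C = t by rewrite ncC ger0_norm.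
pose x s := x0 + s.
have xb s : nc s <= rho -> nc (x s) <= Xm.
  by move=> h; apply: le_trans (ncD _ _) _; rewrite /Xm lerD2l.
pose z s : C * C := (x s, t%:C%C).
pose l := Letter p al be ga.
have z'E s : step l (swap (z s)) = (be * x s + ga, al * t%:C%C + p.[x s]) by [].
have zV s : nc s <= rho -> r < nc (z s).2 /\ nc (z s).1 < nc (z s).2.
  by move=> h; rewrite /z /= nt; split; [exact: lt_le_trans T1r tT1|exact: le_lt_trans (xb s h) (lt_le_trans T1X tT1)].
have y'low s : nc s <= rho -> T1 <= nc (step l (swap (z s))).2.
  move=> h; rewrite z'E /=; have := ncD_ge (al * t%:C%C) p.[x s]; rewrite normcM nt.
  have := hKp s h; rewrite horner_comp !hE [s + x0]addrC -/(x s); lra.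
have z'V s : nc s <= rho ->
    r' < nc (step l (swap (z s))).2 /\ nc (step l (swap (z s))).1 < nc (step l (swap (z s))).2.
  move=> h; have h1 := y'low s h; split; first by lra.
  apply: lt_le_trans h1; rewrite z'E /=; apply: le_lt_trans (ncD _ _) _.
  rewrite normcM; have : nc be * nc (x s) <= nc be * Xm by rewrite ler_wpM2l ?xb // ltW.
  lra.
have inVz s : nc s <= rho -> inV r (z s) by move=> /zV[h1 h2]; rewrite /inV !ltW.
have inVz' s : nc s <= rho -> inV r' (step l (swap (z s))).
  by move=> /z'V[h1 h2]; rewrite /inV !ltW.
have KKb : 12 * KK <= T1 /\ (12 * KK * nc al <= T1 /\ 12 * KK * nc be <= T1).
  have : 12 * KK * (1 + nc al + nc be) = 12 * KK + 12 * KK * nc al + 12 * KK * nc be by ring.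
  have := mulr_ge0 (ler0n R 12) (mulr_ge0 (le_trans (ler0n R 2) KK2) (ltW nal)).
  have := mulr_ge0 (ler0n R 12) (mulr_ge0 (le_trans (ler0n R 2) KK2) (ltW nbe)).
  by rewrite !mulrA; clear - T1K KK2; split; [|split]; lra.
have [KKb1 [KKb2 KKb3]] := KKb.
have bz n s : nc s <= rho -> [/\ nc (ldir w n (z s) (0, 1)) <= 2, nc (ldir w n (z s) (1, 0)) <= 2,
      ldir w n (z s) (0, 1) != 0 &
      6 * nc al * nc (ldir w n (z s) (1, 0)) <= nc (ldir w n (z s) (0, 1))].
  move=> h; have [|h1 h2 h3 h4] := @ldir_bounds w K r (z s) n esc (inVz s h).
    by rewrite /z /= nt; clear - K1 K'1 tT1 KKb1; move: KKb1; rewrite /KK; lra.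
  split=> //; rewrite /z /= nt -/(z s) in h4.
  set A := nc (ldir w n (z s) (1, 0)) in h4 *; set B := nc (ldir w n (z s) (0, 1)) in h4 *.
  have t1 : 0 < t := lt_le_trans (lt_le_trans ltr01 T1r1) tT1.
  apply: (@le_trans _ _ (6 * nc al * (2 * K / t * B))).
    by rewrite ler_wpM2l // mulr_ge0 // ltW.
  have -> : 6 * nc al * (2 * K / t * B) = (12 * K * nc al) / t * B by field; rewrite gt_eqF.
  rewrite ler_piMl ?nc_ge0 // ler_pdivrMr // mul1r; apply: le_trans tT1; apply: le_trans KKb2.
  by rewrite ler_wpM2r ?(ltW nal) // /KK; clear - K'1; lra.
have bz' n s : nc s <= rho -> [/\ nc (ldir w' n (step l (swap (z s))) (0, 1)) <= 2,
      nc (ldir w' n (step l (swap (z s))) (1, 0)) <= 2,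
      ldir w' n (step l (swap (z s))) (0, 1) != 0 &
      6 * nc be * nc (ldir w' n (step l (swap (z s))) (1, 0)) <= nc (ldir w' n (step l (swap (z s))) (0, 1))].
  move=> h; have yT := y'low s h.
  have [|h1 h2 h3 h4] := @ldir_bounds w' K' r' _ n esc' (inVz' s h).
    by move: KKb1; rewrite /KK; lra.
  split=> //; set y' := nc (step l (swap (z s))).2 in h4 yT.
  set A := nc (ldir w' n _ (1, 0)) in h4 *; set B := nc (ldir w' n _ (0, 1)) in h4 *.
  have t1 : 0 < y' := lt_le_trans (lt_le_trans ltr01 T1r1) yT.
  apply: (@le_trans _ _ (6 * nc be * (2 * K' / y' * B))).
    by rewrite ler_wpM2l // mulr_ge0 // ltW.
  have -> : 6 * nc be * (2 * K' / y' * B) = (12 * K' * nc be) / y' * B by field; rewrite gt_eqF.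
  rewrite ler_piMl ?nc_ge0 // ler_pdivrMr // mul1r; apply: le_trans yT; apply: le_trans KKb3.
  by rewrite ler_wpM2r ?(ltW nbe) // /KK; clear - K1; lra.
(* The points [z s] and their images become polynomial curves in [s], and the approximations to the
   forms rational functions of [s]. *)
pose Z : {poly C} * {poly C} := ('X + x0%:P, (t%:C%C)%:P).
pose Z' := pstep l (Z.2, Z.1).
have evZ s : pev Z s = z s by rewrite /pev /Z /= !hE /z /x addrC.
have evZ' s : pev Z' s = step l (swap (z s)) by rewrite pev_step -evZ.
pose cst (a b : C) : {poly C} * {poly C} := (a%:P, b%:P).
have evc a b s : pev (cst a b) s = (a, b) by rewrite /pev /cst /= !hornerC.
pose A n := (ptrun (wpow w n) Z (cst 1 0)).2; pose B n := (ptrun (wpow w n) Z (cst 0 1)).2.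
pose A' n := (ptrun (wpow w' n) Z' (cst 1 0)).2; pose B' n := (ptrun (wpow w' n) Z' (cst 0 1)).2.
pose Y n := (prun (wpow w n) Z).2; pose Y' n := (prun (wpow w' n) Z').2.
have AE n s a b : (ptrun (wpow w n) Z (cst a b)).2.[s] = (trun (wpow w n) (z s) (a, b)).2.
  by rewrite -[LHS]/(pev (ptrun (wpow w n) Z (cst a b)) s).2 pev_trun evZ evc.
have A'E n s a b : (ptrun (wpow w' n) Z' (cst a b)).2.[s] = (trun (wpow w' n) (step l (swap (z s))) (a, b)).2.
  by rewrite -[LHS]/(pev (ptrun (wpow w' n) Z' (cst a b)) s).2 pev_trun evZ' evc.
have YE n s : (Y n).[s] = (run (wpow w n) (z s)).2.
  by rewrite -[LHS]/(pev (prun (wpow w n) Z) s).2 pev_run evZ.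
have Y'E n s : (Y' n).[s] = (run (wpow w' n) (step l (swap (z s)))).2.
  by rewrite -[LHS]/(pev (prun (wpow w' n) Z') s).2 pev_run evZ'.
(* Denominators are nonzero because [ldir] is, while division by zero would make it [0]; [D] and
   [D'] are treated in the same way. *)
have Y0 n s : nc s <= rho -> (Y n).[s] != 0.
  move=> h; have [_ _ + _] := bz n s h; apply: contraNneq; rewrite YE /ldir => ->.
  by rewrite mulr0 invr0 mulr0.
have Y'0 n s : nc s <= rho -> (Y' n).[s] != 0.
  move=> h; have [_ _ + _] := bz' n s h; apply: contraNneq; rewrite Y'E /ldir => ->.
  by rewrite mulr0 invr0 mulr0.
have [D eD] : exists D, (wdeg w)%:R = D :> C by exists (wdeg w)%:R.
have [D' eD'] : exists D', (wdeg w')%:R = D' :> C by exists (wdeg w')%:R.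
have D0 : D != 0.
  have := bz 1%N 0; rewrite normc0 => /(_ rho0)[_ _ + _]; apply: contraNneq => D0.
  by rewrite /ldir eD D0 expr1 mul0r invr0 mulr0.
have D'0 : D' != 0.
  have := bz' 1%N 0; rewrite normc0 => /(_ rho0)[_ _ + _]; apply: contraNneq => D'0.
  by rewrite /ldir eD' D'0 expr1 mul0r invr0 mulr0.
(* [P n / Q n] is [W n], the n-th approximation of the wedge factor, written as a single fraction;
   its main term is the one with [q], the translate of [p']. *)
pose P n := al *: (A n * B' n) - be *: (B n * A' n) - q * (B n * B' n).
pose Q n := (D ^+ n * D' ^+ n) *: (Y n * Y' n).
pose W n s := al * (ldir w n (z s) (1, 0) * ldir w' n (step l (swap (z s))) (0, 1))
   - be * (ldir w n (z s) (0, 1) * ldir w' n (step l (swap (z s))) (1, 0))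
   - p^`().[x s] * (ldir w n (z s) (0, 1) * ldir w' n (step l (swap (z s))) (0, 1)).
have PQ n s : nc s <= rho -> (P n).[s] / (Q n).[s] = W n s.
  move=> h; have := Y0 n s h; have := Y'0 n s h; have := expf_neq0 n D0; have := expf_neq0 n D'0.
  rewrite /P /Q /W !hE qE -/(x s) /A /B /A' /B' !AE !A'E YE Y'E /ldir eD eD'.
  move: (D ^+ n) (D' ^+ n) => d d' d'0 d0 y'0 y0; field.
  by rewrite d0 d'0 y0 y'0.
have Q0 n s : nc s <= rho -> (Q n).[s] != 0.
  move=> h; rewrite /Q !hE; apply: mulf_neq0; last by apply: mulf_neq0; [exact: Y0|exact: Y'0].
  by rewrite mulf_neq0 // expf_neq0.
(* [P n = 0] reads [q M = N] with [M = B n * B' n], and the two bounds by one sixth add up to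
   [|N| <= |M| / 3]. *)
have zeros n : exists2 s, nc s <= rho & (P n).[s] = 0.
  have [|s nsr|s nsr|s nsr es] := @root_perturb R q (B n * B' n)
     (al *: (A n * B' n) - be *: (B n * A' n)) rho rho0.
  - by rewrite qE addr0.
  - by rewrite qE; apply: circ.
  - have [_ _ u0 u1] := bz n s nsr; have [_ _ v0 v1] := bz' n s nsr.
    have Y0' := Y0 n s nsr; have Y'0' := Y'0 n s nsr.
    have eA : (A n).[s] = D ^+ n * (Y n).[s] * ldir w n (z s) (1, 0).
      rewrite /A AE YE /ldir eD; rewrite -YE mulrC divfK // mulf_neq0 // expf_neq0 //.
    have eB : (B n).[s] = D ^+ n * (Y n).[s] * ldir w n (z s) (0, 1).
      rewrite /B AE YE /ldir eD; rewrite -YE mulrC divfK // mulf_neq0 // expf_neq0 //.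
    have eA' : (A' n).[s] = D' ^+ n * (Y' n).[s] * ldir w' n (step l (swap (z s))) (1, 0).
      rewrite /A' A'E Y'E /ldir eD'; rewrite -Y'E mulrC divfK // mulf_neq0 // expf_neq0 //.
    have eB' : (B' n).[s] = D' ^+ n * (Y' n).[s] * ldir w' n (step l (swap (z s))) (0, 1).
      rewrite /B' A'E Y'E /ldir eD'; rewrite -Y'E mulrC divfK // mulf_neq0 // expf_neq0 //.
    have c0 : D ^+ n * (Y n).[s] != 0 by rewrite mulf_neq0 // expf_neq0.
    have c'0 : D' ^+ n * (Y' n).[s] != 0 by rewrite mulf_neq0 // expf_neq0.
    rewrite !hE eA eB eA' eB'.
    move: (ldir w n (z s) (1, 0)) (ldir w n (z s) (0, 1)) u0 u1 => a b b0 ab.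
    move: (ldir w' n _ (1, 0)) (ldir w' n _ (0, 1)) v0 v1 => a' b' b'0 ab'.
    move: (D ^+ n * _) (D' ^+ n * _) c0 c'0 => c c' c0 c'0.
    split; first by rewrite !mulf_neq0.
    have -> : al * (c * a * (c' * b')) - be * (c * b * (c' * a')) =
        c * c' * (al * a * b' - be * a' * b) by ring.
    have -> : c * b * (c' * b') = c * c' * (b * b') by ring.
    rewrite [nc (c * c' * _)]normcM [nc (c * c' * (b * _))]normcM mulrCA ler_wpM2l ?nc_ge0 //.
    have h1 := ncB (al * a * b') (be * a' * b).
    have h2 : 6 * nc (al * a * b') <= nc b * nc b'.
      by rewrite !normcM !mulrA ler_wpM2r ?nc_ge0.
    have h3 : 6 * nc (be * a' * b) <= nc b * nc b'.
      by rewrite !normcM [nc b * nc b']mulrC !mulrA ler_wpM2r ?nc_ge0.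
    by rewrite normcM; clear - h1 h2 h3; lra.
  exists s => //; rewrite /P; move: es; rewrite !hE => es.
  by apply/eqP; rewrite subr_eq0 eq_sym; apply/eqP; rewrite -es; ring.
pose KM := Num.max K K'.
have KM0 : 0 <= KM by rewrite le_max (le_trans ler01 K1).
have cau m n s v : (m <= n)%N -> nc s <= rho -> nc2 v = 1 ->
    nc (ldir w n (z s) v - ldir w m (z s) v) <= KM * hf ^+ m /\
    nc (ldir w' n (step l (swap (z s))) v - ldir w' m (step l (swap (z s))) v) <= KM * hf ^+ m.
  move=> mn h v1; have hh := ltW (hf_gt0 R m).
  have yT := y'low s h; have y1 : 1 <= nc (z s).2.
    by rewrite /z /= nt; apply: le_trans tT1; apply: le_trans T1r1.
  have y'1 : 1 <= nc (step l (swap (z s))).2 by apply: le_trans yT; apply: le_trans T1r1.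
  have [_ _ _ /(_ v n mn) h1] := hEs _ (inVz s h) m.
  have [_ _ _ /(_ v n mn) h2] := hEs' _ (inVz' s h) m.
  have sm (k y : R) : 0 <= k -> 1 <= y -> k <= KM -> k / y * (1 / y) * hf ^+ m <= KM * hf ^+ m.
    move=> k0 y1' kK; rewrite ler_wpM2r //; apply: le_trans kK; rewrite -mulrA ler_piMr //.
    have y0 : 0 < y by apply: lt_le_trans y1'.
    have yi : y^-1 <= 1 by rewrite invf_le1.
    have yi0 : 0 <= y^-1 by rewrite invr_ge0 ltW.
    by rewrite mul1r; apply: mulr_ile1.
  have kp : 0 <= K by apply: le_trans K1.
  have kp' : 0 <= K' by apply: le_trans K'1.
  rewrite v1 in h1 h2; split; [apply: le_trans h1 _|apply: le_trans h2 _]; apply: sm => //.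
    by rewrite le_max lexx.
  by rewrite le_max lexx orbT.
have v10 : nc2 ((1, 0) : C * C) = 1 by rewrite /nc2 /= normc1 normc0 addr0.
have v01 : nc2 ((0, 1) : C * C) = 1 by rewrite /nc2 /= normc1 normc0 add0r.
have [|s nsr ws] := @zero_of_limit R P Q rho ((nc al + nc be + Kq) * (2 * 2 * KM)) rho0 zeros Q0.
  move=> m n s mn nsr; rewrite !PQ //.
  have [e1 e1'] := cau m n s _ mn nsr v10; have [e2 e2'] := cau m n s _ mn nsr v01.
  have [f1 f2 _ _] := bz n s nsr; have [f3 f4 _ _] := bz' n s nsr.
  have [g1 g2 _ _] := bz m s nsr; have [g3 g4 _ _] := bz' m s nsr.
  rewrite /W.
  move: (ldir w n _ (1, 0)) (ldir w n _ (0, 1)) (ldir w' n _ (1, 0)) (ldir w' n _ (0, 1))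
    (ldir w m _ (1, 0)) (ldir w m _ (0, 1)) (ldir w' m _ (1, 0)) (ldir w' m _ (0, 1))
    e1 e1' e2 e2' f1 f2 f3 f4 g1 g2 g3 g4 => a b a' b' c d c' d' e1 e1' e2 e2' f1 f2 f3 f4 g1 g2 g3 g4.
  have p1 := product_cauchy f3 g2 e1 e2'.
  have p2 := product_cauchy f4 g1 e2 e1'.
  have p3 := product_cauchy f3 g1 e2 e2'.
  have -> : al * (a * b') - be * (b * a') - p^`().[x s] * (b * b') -
     (al * (c * d') - be * (d * c') - p^`().[x s] * (d * d')) =
     al * (a * b' - c * d') - be * (b * a' - d * c') - p^`().[x s] * (b * b' - d * d') by ring.
  have pq : nc p^`().[x s] <= Kq by rewrite -qE; apply: hKq.
  have -> : (nc al + nc be + Kq) * (2 * 2 * KM) * hf ^+ m = nc al * (2 * 2 * (KM * hf ^+ m)) +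
     nc be * (2 * 2 * (KM * hf ^+ m)) + Kq * (2 * 2 * (KM * hf ^+ m)) by ring.
  apply: le_trans (ncB _ _) _; apply: lerD; last by rewrite normcM; apply: ler_pM; rewrite ?nc_ge0.
  by apply: le_trans (ncB _ _) _; apply: lerD; rewrite normcM; apply: ler_wpM2l; rewrite ?nc_ge0.
exists (z s); split; [exact: zV|exact: z'V|].
have [a _ ca] := ldir_cvg (1, 0) esc (inVz s nsr).
have [b _ cb] := ldir_cvg (0, 1) esc (inVz s nsr).
have [a' _ ca'] := ldir_cvg (1, 0) esc' (inVz' s nsr).
have [b' _ cb'] := ldir_cvg (0, 1) esc' (inVz' s nsr).
exists a, b, a', b'; split=> //=.
have cW : geo_cvg (fun n => W n s) (1 * (al * (a * b') + (- be) * (b * a')) + (- p^`().[x s]) * (b * b')).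
  have t1 := geo_cvg_linear al (- be) (geo_cvgM ca cb') (geo_cvgM cb ca').
  have t2 := geo_cvg_linear 1 (- p^`().[x s]) t1 (geo_cvgM cb cb').
  have [Bd hBd] := t2; exists Bd => n; apply: le_trans (hBd n).
  by rewrite /W le_eqVlt; apply/orP; left; apply/eqP; congr nc; ring.
have c0 : geo_cvg (fun n => W n s) 0.
  by have [Bd hBd] := ws; exists Bd => n; rewrite -PQ.
have := geo_cvg_unique cW c0; rewrite /z /= => e0.
by rewrite -[RHS]e0; ring.
Qed.

End Critical.

(** * The critical locus *)

Section InverseWord.
Variable K : fieldType.
Implicit Types (l e : letter K) (v : seq (letter K)).

(** The inverse of a letter is the swap followed by [tri (tinv e)], and conjugation by the swap
    turns this into [step (tinv e)]. So the inverse of a word is again a word of the same length, up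
    to this conjugation. *)
Lemma run_tinv v z : all (@lok K) v ->
  run (rev (map (@tinv K) v)) (swap (run v z)) = swap z.
Proof.
elim: v z => //= e v IH z /andP[eo vo].
by rewrite rev_cons -cats1 run_cat IH //= /step swapK triK.
Qed.

End InverseWord.

Section Main.
Variable R : realType.
Local Notation C := R[i].
Local Notation nc := (@normc R).
Implicit Types (z : C * C) (w v : seq (letter R[i])).

Lemma hyper_tinv (e : letter C) : hyper e -> hyper (tinv e).
Proof.
move=> /andP[eo se]; rewrite /hyper lok_tinv //=; have [a0 b0] := andP eo.
rewrite size_scale ?oppr_eq0 ?invr_eq0 // size_comp_poly2 //.
by rewrite -polyCN size_polyDl size_scale ?invr_eq0 ?size_polyX // size_polyC; case: eqP.
Qed.

Lemma size_tinv (e : letter C) : lok e -> size (lp (tinv e)) = size (lp e).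
Proof.
move=> /andP[a0 b0]; rewrite /= size_scale ?oppr_eq0 ?invr_eq0 // size_comp_poly2 //.
by rewrite -polyCN size_polyDl size_scale ?invr_eq0 ?size_polyX // size_polyC; case: eqP.
Qed.

Lemma wdeg_rcons w (l : letter C) : wdeg (rcons w l) = (wdeg w * (size (lp l)).-1)%N.
Proof. by rewrite -cats1 wdeg_cat /= muln1. Qed.

Lemma wdeg_tinv v : all (@lok C) v -> wdeg (rev (map (@tinv C) v)) = wdeg v.
Proof.
elim: v => //= e v IH /andP[eo vo].
by rewrite rev_cons wdeg_rcons IH // size_tinv // mulnC.
Qed.

(** The orbit remains in the smaller region because [|y_n| >= 2^n |y|]. *)
Lemma escape_region_le w (K r r' : R) : r <= r' -> escape_region w K r -> escape_region w K r'.
Proof.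
move=> le [K1 r1 h]; split=> //; first exact: le_trans le.
move=> z zV n; have zV0 : inV r z by apply: inV_le zV.
have [h1 h2 h3 h4] := h z zV0 n; split=> //.
case/andP: h1 => _ h1; rewrite /inV h1 andbT; apply: le_trans h2.
case/andP: zV => h5 _; apply: le_trans h5 _; rewrite ler_peMl ?nc_ge0 //.
by rewrite exprn_ege1 // ler1n.
Qed.

(** The wedge product contains the Jacobian determinant [xi 0 * eta 1 - xi 1 * eta 0] of the
    conjugation; the other factor is the expression that [critical_pair] makes vanish. *)
Lemma wedge_eq0 (dp dm : 'rV[C]_2) (k1 k2 a b a' b' al be q : C) (xi eta : 'I_2 -> C) :
  (forall j, dp 0 j = k1 * (a * xi j + b * eta j)) ->
  (forall j, dm 0 j = k2 * (a' * (be * xi j) + b' * (al * eta j + q * xi j))) ->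
  a * (al * b') - b * (be * a' + q * b') = 0 -> wedge dp dm = 0.
Proof.
move=> h1 h2 e0; rewrite /wedge !h1 !h2.
transitivity (k1 * k2 * (xi 0 * eta 1 - xi 1 * eta 0) *
  (a * (al * b') - b * (be * a' + q * b'))); last by rewrite e0 mulr0.
by ring.
Qed.

End Main.

Theorem propositionB3 (R : realType) (f : polydiffeo R)
    (hd : 2 <= dynamical_degree f) :
  critical_locus f !=set0.
Proof.
have [w0 [c [v [[w0o ew0] co [hv sv] cv dE]]]] := dynamical_degree_normal_form hd.
have vo := all_hyper_lok hv.
have eb := polydiffeo_winv w0o ew0.
have hvr : all (@hyper _) (rev (map (@tinv _) v)).
  by rewrite all_rev all_map; apply: sub_all hv => e; exact: hyper_tinv.
have := run_tinv; have := wdeg_tinv vo; have svr : size (rev (map (@tinv _) v)) = size v.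
  by rewrite size_rev size_map.
case evr: (rev (map (@tinv _) v)) hvr svr => [|l rest]; first by move=> _ s0; rewrite -s0 in sv.
move=> /= /andP[hl hrest] _ dvr invr.
(* At [z = (x, t)] with [t] large, [swap z] has its large coordinate first and lies outside the
   region for the inverse word. The first letter [l] therefore goes into the conjugation and returns
   at the end of the word; the base point becomes [step l (swap z)], whose second coordinate is
   large. *)
pose cm := c ++ [:: lid _; l]; pose wm := rcons rest l.
have lo := hyper_lok hl.
have cmo : all (@lok _) cm by rewrite all_cat co /= lok_lid lo.
have hwm : all (@hyper _) wm by rewrite all_rcons hl.
have swm : (0 < size wm)%N by rewrite size_rcons.
have dwm : wdeg wm = wdeg v by rewrite wdeg_rcons mulnC -dvr.
have runcm z : run cm z = step l (swap (run c z)) by rewrite run_cat /= step_lid.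
have runwm z : run wm (step l z) = step l (run (l :: rest) z) by rewrite /wm -cats1 run_cat.
have fwdE p : topair (polymap_eval (pd_fwd f) p) = run (winv c) (run v (run c (topair p))).
  by rewrite -cv runK // ew0.
have bwdE p : topair (polymap_eval (pd_bwd f) p) = run (winv cm) (run wm (run cm (topair p))).
  rewrite eb -{2}(runVK w0o (topair p)); set z1 := run (winv w0) (topair p).
  rewrite runcm runwm cv -evr invr // -runcm runK //.
have [r1 [k1 gp]] := green_limit (all_winv co) hv sv fwdE (runVK co).
have [r2 [k2 gm]] := green_limit (all_winv cmo) hwm swm bwdE (runVK cmo).
have [K [r3 esc]] := orbit_estimates hv sv.
have [K' [r4 esc']] := orbit_estimates hwm swm.
(* One radius for both the limit formula of the Green function and the orbit estimates. *)
have esc1 : escape_region v K (Num.max r3 r1) by apply: escape_region_le esc; rewrite le_max lexx.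
have esc2 : escape_region wm K' (Num.max r4 r2) by apply: escape_region_le esc'; rewrite le_max lexx.
have [z [[z1 z2] [z3 z4] [a [b [a' [b' [ca cb ca' cb' e0]]]]]]] := critical_pair hl esc1 esc2.
pose p := ofpair (run (winv c) z).
have pz : run c (topair p) = z by rewrite /p ofpairK runVK.
have pz' : run cm (topair p) = step l (swap z) by rewrite runcm pz.
have hG1 q : inV (Num.max r3 r1) (run c (topair q)) -> Gplus f q = k1 * green v (run c (topair q)).
  move=> qV; have [|_ <-] := gp q; first by apply: inV_le qV; rewrite le_max lexx orbT.
  by rewrite /Gplus dE.
have hG2 q : inV (Num.max r4 r2) (run cm (topair q)) -> Gminus f q = k2 * green wm (run cm (topair q)).
  move=> qV; have [|_ <-] := gm q; first by apply: inV_le qV; rewrite le_max lexx orbT.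
  by rewrite /Gminus dE dwm.
have zV : inV r1 (run c (topair p)).
  rewrite pz; move: z1; rewrite gt_max => /andP[_ z1]; by rewrite /inV !ltW.
have z'V : inV r2 (run cm (topair p)).
  rewrite pz'; move: z3; rewrite gt_max => /andP[_ z3]; by rewrite /inV !ltW.
exists p; split; first by split; [have [] := gp p zV|have [] := gm p z'V].
have d1 := del_green (p := p) esc1 hG1; rewrite !pz in d1.
have d2 := del_green (p := p) esc2 hG2; rewrite !pz' in d2.
have {}d1 := d1 _ _ z1 z2 ca cb; have {}d2 := d2 _ _ z3 z4 ca' cb'.
have tcm u : trun cm (topair p) u =
    tstep l (swap z) ((trun c (topair p) u).2, (trun c (topair p) u).1).
  rewrite trun_cat pz /= step_lid; congr tstep.
  by rewrite /tstep /= deriv0 horner0 mul0r addr0 !mul1r.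
apply: (wedge_eq0 d1 _ e0) => j; etransitivity; first exact: d2.
by rewrite tcm.
Qed.
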